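(* For all integers $j\ge1$: $\mathscr N_0(6,j)=60^j\frac{(3j-1)!}{(2j+2)!}$ and $\mathscr N_1(6,j)=\frac{40}{3j+1}(j-1)!\,60^{j-1}\binom{2+3j}{j-1}{}_2F_1(3,1-j;4+2j;-2)$. For all $j\ge6$, $\mathscr N_2(6,j)=\frac{3}{2(3j+1)}(j-1)!\,60^{j-1}\Big[371\binom{3j}{j-2}{}_2F_1(8,2-j;3+2j;-2)+6735\binom{3j}{j-3}{}_2F_1(8,3-j;4+2j;-2)+23496\binom{3j}{j-4}{}_2F_1(8,4-j;5+2j;-2)+25004\binom{3j}{j-5}{}_2F_1(8,5-j;6+2j;-2)+7872\binom{3j}{j-6}{}_2F_1(8,6-j;7+2j;-2)\Big]$, and $\mathscr N_2(6,1)=0$, $\mathscr N_2(6,2)=4770$, $\mathscr N_2(6,3)=17290800$, $\mathscr N_2(6,4)=54015984\times10^3$, $\mathscr N_2(6,5)=174855024\times10^6$.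
   Context: ${}_2F_1(a,b;c;z)=\sum_{k\ge0}\frac{(a)_k(b)_k}{(c)_kk!}z^k$. Labelled graphs: take $j$ vertices labelled $1,\dots,j$, each carrying $6$ half-edges labelled $1,\dots,6$ in counterclockwise cyclic order. A labelled $6$-valent graph is a perfect matching of all $6j$ half-edges. With the prescribed cyclic orders it is a ribbon graph (a graph embedded in a compact oriented surface whose complement is a disjoint union of open cells); its genus is the minimal genus of a compact Riemann surface on which it so embeds. $\mathscr N_g(6,j)$ is the number of such graphs that are connected of minimal genus exactly $g$. *)

(* Defs.v *)
From mathcomp Require Import all_boot all_order all_algebra.
From mathcomp Require Import reals topology normedtype sequences.
Set Implicit Arguments.
Unset Strict Implicit.
Unset Printing Implicit Defensive.
Import Order.TTheory GRing.Theory Num.Theory.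
Import numFieldNormedType.Exports.
Local Open Scope ring_scope.

(* The pair (v, i) is the i-th half-edge at the vertex v; both labels start
   at 0 instead of 1. *)
Definition halfedge (nu j : nat) : finType := ('I_j * 'I_nu)%type.

(* Counterclockwise successor at the same vertex: i |-> i + 1 modulo nu. *)
Definition ccw_next (nu j : nat) (h : halfedge nu j) : halfedge nu j :=
  (h.1, ordS h.2).

(* A labelled nu-valent graph on j vertices is a set M of edges, an edge being
   an unordered pair of distinct half-edges. *)
Definition perfect_matching (nu j : nat) (M : {set {set halfedge nu j}}) : bool :=
  partition M [set: halfedge nu j] && [forall e in M, #|e| == 2%N].

Definition share_edge (nu j : nat) (M : {set {set halfedge nu j}}) : rel 'I_j :=
  fun u v => [exists a : 'I_nu, exists b : 'I_nu,
    [set ((u, a) : halfedge nu j); ((v, b) : halfedge nu j)] \in M].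

Definition connected_graph (nu j : nat) (M : {set {set halfedge nu j}}) : bool :=
  [forall u : 'I_j, forall v : 'I_j, connect (share_edge M) u v].

(* The other half of the edge containing h (h itself is only a default value,
   never reached when M is a perfect matching). *)
Definition mate (nu j : nat) (M : {set {set halfedge nu j}})
    (h : halfedge nu j) : halfedge nu j :=
  odflt h [pick h' | (h' != h) && ([set h; h'] \in M)].

(* Cross the edge of h, then turn to the neighbouring half-edge at the vertex
   reached.  For a perfect matching this is a permutation of the half-edges,
   and its cycles are the boundaries of the faces of the ribbon graph. *)
Definition face_step (nu j : nat) (M : {set {set halfedge nu j}})
    (h : halfedge nu j) : halfedge nu j :=
  ccw_next (mate M h).

Definition num_faces (nu j : nat) (M : {set {set halfedge nu j}}) : nat :=
  fcard (face_step M) predT.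

(* V - E + F *)
Definition euler_char (nu j : nat) (M : {set {set halfedge nu j}}) : int :=
  j%:Z - #|M|%:Z + (num_faces M)%:Z.

(* For a connected M: gluing an open disk along each face boundary yields the
   closed oriented surface in which M is cellularly embedded.  This surface has
   Euler characteristic 2 - 2 g, g being the genus of the ribbon graph. *)
Definition has_genus (g nu j : nat) (M : {set {set halfedge nu j}}) : bool :=
  euler_char M == 2 - 2 * g%:Z.

Definition num_graphs (g nu j : nat) : nat :=
  #|[set M : {set {set halfedge nu j}} |
      [&& perfect_matching M, connected_graph M & has_genus g M]]|.

(* The rising factorial a (a + 1) ... (a + k - 1). *)
Definition pochhammer (R : realType) (a : R) (k : nat) : R :=
  \prod_(0 <= i < k) (a + i%:R).

(* The sum over all k >= 0, as the limit of the partial sums; `limn` is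
   meaningful only if the series converges, e.g. when a or b is a nonpositive
   integer and c is not, in which case it terminates. *)
Definition hyp2F1 (R : realType) (a b c z : R) : R :=
  limn (series (fun k : nat =>
    pochhammer a k * pochhammer b k / (pochhammer c k * (k`!)%:R) * z ^+ k)).

(* Main.v *)
(* By Wick's formula, the sum of N ^ #faces over all graphs with j vertices, connected or
   not, is the Gaussian mean of (tr M ^ 6) ^ j over N x N matrices M.  The loop equations
   determine such means, and the eigenvalue model, where tr M ^ k becomes a power sum and
   the square of the Vandermonde determinant is the weight, satisfies the same equations.
   Hence the exponential generating function Z_N(t) is, up to a constant, the Hankel
   determinant of the moments of exp(- x^2 / 2 + t x^6).  The recurrence coefficients r_N
   of the orthogonal polynomials satisfy the Freud equation, and Z_(N+1) Z_(N-1) / Z_N ^ 2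
   is proportional to r_N (Toda).  Connected graphs are counted by tau = t d/dt log Z_N,
   whose t ^ j coefficient is a polynomial in N; the coefficient of N ^ (2 j + 2 - 2 g) is
   the contribution of genus g.  Solving the Freud equation for large N up to the fourth
   order below the leading one expresses everything rationally in the series
   z = 15 t (2 + z) ^ 3 and w = 1 / (1 - z), and Lagrange inversion extracts the
   coefficients. *)
From HB Require Import structures.
From mathcomp Require Import all_boot all_order all_algebra.
Require Import Defs.
From mathcomp Require Import boolp ring lra zify.
From mathcomp Require mpoly ssrcomplements.
From Stdlib Require PeanoNat.
Set Implicit Arguments.
Unset Strict Implicit.
Unset Printing Implicit Defensive.
Import Order.TTheory GRing.Theory Num.Theory.
Local Open Scope ring_scope.

(** * Formal power series *)

(** No analysis enters: means are linear functionals given by their values on monomials, [Z_N] is a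
    formal series over [rat], and integration by parts is an identity between functionals.
    Diagonalisation of matrices is avoided as well: the loop equations determine a functional up to
    scale by a terminating recursion, so the two models are compared by induction.

    The Freud and Toda equations hold at integers only. Since each coefficient is a polynomial in
    [N] for large [N], they become identities over [{poly rat}], where [N] may be shifted by
    negative amounts too. Each power of [t] raises the degree in [N] by at most two, which makes
    sense of orders below the leading one.

    Toda yields only the second difference of [tau] in [N], in which genus [g] is mixed with the
    lower genera. With [delta = 2 t d/dt], acting on the coefficient of [t ^ j] as [2 j], suitable
    polynomials in [delta] remove these contributions. The denominator [3 j + 1] of the counts is
    cleared by [3 delta + 2], which multiplies by [2 (3 j + 1)]; what remains are rational
    identities in [z] and [w], within reach of [ring]. *)

Record fps (R : Type) := Fps { fcoef : nat -> R }.

Lemma fpsP (R : Type) (f g : fps R) : (forall n, fcoef f n = fcoef g n) -> f = g.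
Proof. by case: f => f; case: g => g /= fg; congr Fps; apply: funext. Qed.

HB.instance Definition _ (R : Type) := gen_eqMixin (fps R).
HB.instance Definition _ (R : Type) := gen_choiceMixin (fps R).

Section FpsRing.
Variable R : comNzRingType.
Implicit Types f g h : fps R.

Definition fps_add f g := Fps (fun n => fcoef f n + fcoef g n).
Definition fps_opp f := Fps (fun n => - fcoef f n).
Definition fps_zero : fps R := Fps (fun=> 0).
Definition fpsC (c : R) : fps R := Fps (fun n => if n == 0%N then c else 0).
Definition fps_mul f g :=
  Fps (fun n => \sum_(i < n.+1) fcoef f i * fcoef g (n - i)).

Lemma fps_addA : associative fps_add.
Proof. by move=> f g h; apply: fpsP => n /=; rewrite addrA. Qed.
Lemma fps_addC : commutative fps_add.
Proof. by move=> f g; apply: fpsP => n /=; rewrite addrC. Qed.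
Lemma fps_add0 : left_id fps_zero fps_add.
Proof. by move=> f; apply: fpsP => n /=; rewrite add0r. Qed.
Lemma fps_addN : left_inverse fps_zero fps_opp fps_add.
Proof. by move=> f; apply: fpsP => n /=; rewrite addNr. Qed.

HB.instance Definition _ :=
  GRing.isZmodule.Build (fps R) fps_addA fps_addC fps_add0 fps_addN.

Definition fps_trunc n f : {poly R} := \poly_(i < n) fcoef f i.

Lemma fps_mul_trunc f g n k : (n < k)%N ->
  fcoef (fps_mul f g) n = (fps_trunc k f * fps_trunc k g)`_n.
Proof.
move=> nk; rewrite coefM /=; apply: eq_bigr => i _.
by rewrite !coef_poly !(leq_ltn_trans _ nk) ?leq_subr // -ltnS.
Qed.

(** A coefficient of a product depends only on truncations of the factors, so associativity is
    inherited from polynomials. *)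
Lemma fps_mulA : associative fps_mul.
Proof.
move=> f g h; apply: fpsP => n.
have E f1 f2 f3 f4 : fcoef (fps_mul f1 f2) n = (fps_trunc n.+1 f1 * fps_trunc n.+1 f2)`_n ->
  (forall i, (i < n.+1)%N -> fcoef f2 i = (fps_trunc n.+1 f3 * fps_trunc n.+1 f4)`_i) ->
  fcoef (fps_mul f1 f2) n = (fps_trunc n.+1 f1 * (fps_trunc n.+1 f3 * fps_trunc n.+1 f4))`_n.
  move=> -> H; rewrite !coefM; apply: eq_bigr => i _; congr (_ * _).
  by rewrite coef_poly ltnS leq_subr H // ltnS leq_subr.
rewrite (E f (fps_mul g h) g h); first last.
- by move=> i ik; exact: fps_mul_trunc.
- exact: fps_mul_trunc.
have fpsC_ f1 f2 : fps_mul f1 f2 = fps_mul f2 f1.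
  apply: fpsP => m; rewrite (@fps_mul_trunc _ _ m m.+1) // mulrC.
  by rewrite -fps_mul_trunc.
rewrite fpsC_ (E h (fps_mul f g) f g); first last.
- by move=> i ik; exact: fps_mul_trunc.
- exact: fps_mul_trunc.
by rewrite mulrA [in RHS]mulrC.
Qed.

Lemma fps_mulC : commutative fps_mul.
Proof.
move=> f1 f2; apply: fpsP => m; rewrite (@fps_mul_trunc _ _ m m.+1) // mulrC.
by rewrite -fps_mul_trunc.
Qed.

Lemma fps_mul1 : left_id (fpsC 1) fps_mul.
Proof.
move=> f; apply: fpsP => n /=.
rewrite big_ord_recl /= mul1r subn0 big1 ?addr0 // => i _.
by rewrite mul0r.
Qed.

Lemma fps_mulDl : left_distributive fps_mul fps_add.
Proof.
move=> f g h; apply: fpsP => n /=; rewrite -big_split /=.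
by apply: eq_bigr => i _; rewrite mulrDl.
Qed.

Lemma fps_one_neq0 : fpsC 1 != 0.
Proof. by apply/eqP => /(congr1 (@fcoef R ^~ 0%N)) /= /eqP; rewrite oner_eq0. Qed.

HB.instance Definition _ := GRing.Zmodule_isComNzRing.Build (fps R)
  fps_mulA fps_mulC fps_mul1 fps_mulDl fps_one_neq0.

Lemma fcoefD f g n : fcoef (f + g) n = fcoef f n + fcoef g n.
Proof. by []. Qed.
Lemma fcoefN f n : fcoef (- f) n = - fcoef f n.
Proof. by []. Qed.
Lemma fcoefB f g n : fcoef (f - g) n = fcoef f n - fcoef g n.
Proof. by []. Qed.
Lemma fcoef0 n : fcoef (0 : fps R) n = 0.
Proof. by []. Qed.
Lemma fcoef1 n : fcoef (1 : fps R) n = (n == 0%N)%:R.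
Proof. by rewrite /=; case: n. Qed.
Lemma fcoefM f g n :
  fcoef (f * g) n = \sum_(i < n.+1) fcoef f i * fcoef g (n - i).
Proof. by []. Qed.

Lemma fcoef_sum (I : Type) (r : seq I) (P : pred I) (F : I -> fps R) n :
  fcoef (\sum_(i <- r | P i) F i) n = \sum_(i <- r | P i) fcoef (F i) n.
Proof. by elim/big_rec2: _ => [|i x y _ <-]; rewrite ?fcoef0. Qed.

Lemma fcoefM0 f g : fcoef (f * g) 0 = fcoef f 0 * fcoef g 0.
Proof. by rewrite fcoefM big_ord1. Qed.

Lemma fpsC_is_additive : {morph fpsC : x y / x - y}.
Proof. by move=> x y; apply: fpsP => -[|n] //=; rewrite subr0. Qed.
HB.instance Definition _ := GRing.isZmodMorphism.Build R (fps R) fpsC fpsC_is_additive.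

Lemma fcoefCM c f n : fcoef (fpsC c * f) n = c * fcoef f n.
Proof.
rewrite fcoefM big_ord_recl /= subn0 big1 ?addr0 // => i _.
by rewrite mul0r.
Qed.

Lemma fpsC_is_multiplicative : {morph fpsC : x y / x * y} /\ fpsC 1 = 1.
Proof.
split=> // x y; apply: fpsP => n; rewrite fcoefCM /=.
by case: ifP; rewrite ?mulr0.
Qed.
HB.instance Definition _ :=
  GRing.isMonoidMorphism.Build R (fps R) fpsC (conj fpsC_is_multiplicative.2 fpsC_is_multiplicative.1).

Lemma fcoef_nat m n : fcoef (m%:R : fps R) n = if n == 0%N then m%:R else 0.
Proof. by rewrite -(rmorph_nat fpsC). Qed.

Lemma fcoef_natM m f n : fcoef (m%:R * f) n = m%:R * fcoef f n.
Proof. by rewrite -(rmorph_nat fpsC) fcoefCM. Qed.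

Definition fpsX : fps R := Fps (fun n => (n == 1%N)%:R).

Lemma fcoefXM f n : fcoef (fpsX * f) n = if n is m.+1 then fcoef f m else 0.
Proof.
rewrite fcoefM; case: n => [|n]; first by rewrite big_ord1 mul0r.
rewrite 2!big_ord_recl /= mul0r add0r mul1r subn1 /= big1 ?addr0 // => i _.
by rewrite mul0r.
Qed.

Lemma fcoefM_lt f g a b n :
  (forall i, (i < a)%N -> fcoef f i = 0) -> (forall i, (i < b)%N -> fcoef g i = 0) ->
  (n < a + b)%N -> fcoef (f * g) n = 0.
Proof.
move=> Hf Hg nab; rewrite fcoefM big1 // => i _.
have [ia|ia] := ltnP i a; first by rewrite Hf ?mul0r.
by rewrite Hg ?mulr0 //; have := ltn_ord i; lia.
Qed.

Lemma fcoefX_lt f n k : fcoef f 0 = 0 -> (k < n)%N -> fcoef (f ^+ n) k = 0.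
Proof.
move=> f0; elim: n k => // n IH k kn; rewrite exprS.
by apply: (@fcoefM_lt _ _ 1 n) => // -[|i].
Qed.

Definition theta f := Fps (fun n => n%:R * fcoef f n).

Lemma thetaD f g : theta (f + g) = theta f + theta g.
Proof. by apply: fpsP => n /=; rewrite mulrDr. Qed.
Lemma thetaN f : theta (- f) = - theta f.
Proof. by apply: fpsP => n /=; rewrite mulrN. Qed.
Lemma thetaC c : theta (fpsC c) = 0.
Proof. by apply: fpsP => -[|n] /=; rewrite ?mul0r ?mulr0. Qed.
Lemma theta_nat n : theta n%:R = 0.
Proof. by rewrite -(rmorph_nat fpsC) thetaC. Qed.
Lemma theta1 : theta 1 = 0. Proof. exact: (theta_nat 1). Qed.

Lemma thetaM f g : theta (f * g) = theta f * g + f * theta g.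
Proof.
apply: fpsP => n; rewrite fcoefD !fcoefM /= -big_split big_distrr /=.
apply: eq_bigr => i _.
have {1}-> : n%:R = i%:R + (n - i)%:R :> R by rewrite -natrD subnKC // -ltnS.
by ring.
Qed.

Lemma thetaX f n : theta (f ^+ n) = n%:R * f ^+ n.-1 * theta f.
Proof.
elim: n => [|n IH]; first by rewrite expr0 theta1 !mul0r.
rewrite exprS thetaM IH /=; case: n {IH} => [|n]; first by rewrite expr0; ring.
by rewrite /= exprS; ring.
Qed.

Lemma theta_fpsX : theta fpsX = fpsX.
Proof. by apply: fpsP => -[|[|n]] /=; rewrite ?mulr0 ?mulr1. Qed.

End FpsRing.

Arguments fcoef : simpl never.

(** Geometric series: after division by its constant term, [f] is [1 - x] with [x] of positive
    valuation. *)
Lemma fps_inv_exists (F : fieldType) (f : fps F) : fcoef f 0 != 0 ->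
  exists g, f * g = 1.
Proof.
move=> f0; pose c := fcoef f 0.
pose x := 1 - fpsC c^-1 * f.
have xE : 1 - x = fpsC c^-1 * f by rewrite /x; ring.
have x0 : fcoef x 0 = 0 by rewrite fcoefB fcoefCM fcoef1 mulVf ?subrr.
clearbody x.
pose S n := \sum_(i < n) x ^+ i.
have SP n : (1 - x) * S n = 1 - x ^+ n by have := subrX1 x n; rewrite -/(S n) => e; rewrite -[RHS]opprB e; ring.
have Sext n k m : (k < n)%N -> (n <= m)%N -> fcoef (S m) k = fcoef (S n) k.
  move=> kn nm; rewrite /S -!(big_mkord xpredT (fun i => x ^+ i)) (big_cat_nat _ (n := n)) //.
  rewrite fcoefD !fcoef_sum [X in _ + X]big1_seq ?addr0 // => i.
  rewrite mem_index_iota => /andP[_ /andP[ni _]].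
  by rewrite fcoefX_lt // (leq_trans kn).
(* The partial sums are stable in degree [n] from [S n.+1] on, so the limit is read off
   diagonally. *)
pose g := Fps (fun n => fcoef (S n.+1) n).
exists (fpsC c^-1 * g).
have -> : f * (fpsC c^-1 * g) = (1 - x) * g by rewrite xE; ring.
apply: fpsP => n.
transitivity (fcoef ((1 - x) * S n.+1) n).
  rewrite !fcoefM; apply: eq_bigr => i _; congr (_ * _).
  by apply/esym/Sext; rewrite ?ltnS ?leq_subr.
by rewrite SP fcoefB fcoefX_lt // subr0.
Qed.

(** * Gaussian functionals and matrix integrals *)

Module Gauss.
Import ssrcomplements mpoly.

Fixpoint gmom (k : nat) : rat :=
  match k with 0 => 1 | 1 => 0 | (k'.+1 as k1).+1 => k1%:R * gmom k' end.

Lemma gmomS k : gmom k.+1 = k%:R * gmom k.-1.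
Proof. by case: k => [|k] //=; rewrite mul0r. Qed.

Section Functional.
Variables (n : nat) (s : 'I_n -> 'I_n).
Hypothesis sK : involutive s.

(** The involution [s] encodes complex conjugation of the variables. A fixed point is a real
    standard Gaussian with moments [gmom]; an orbit of size two is a complex Gaussian and its
    conjugate, whose mixed moments are [a!] for equal exponents [a] and 0 otherwise. The orbit is
    charged to its smaller index, hence the factor 1 at the larger one. *)
Definition gfac (m : 'X_{1..n}) (k : 'I_n) : rat :=
  if s k == k then gmom (m k)
  else if (k < s k)%N then (m k == m (s k))%:R * (m k)`!%:R else 1.

Definition gmon (m : 'X_{1..n}) : rat := \prod_(k < n) gfac m k.

(** Integration by parts on monomials. Only the factor stored at [o], the smaller index of the orbit
    of [i], changes. If [m (s i) = 0], the truncated subtraction is multiplied by zero. *)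
Lemma gmon_step i m :
  gmon (U_(i) + m) = (m (s i))%:R * gmon (m - U_(s i)).
Proof.
pose o := if (i < s i)%N then i else s i.
have oP : o = i \/ o = s i by rewrite /o; case: ifP; [left|right].
have same k : k != o -> gfac (U_(i) + m) k = gfac (m - U_(s i)) k.
  move=> ko; rewrite /gfac.
  have [kk|kk] := eqVneq (s k) k.
    have ki : (i == k) = false.
      apply/negP => /eqP e; move: ko; rewrite /o e kk ltnn => /eqP; apply.
      by [].
    have ksi : (s i == k) = false.
      by apply/negP => /eqP e; move: ki; rewrite -[i]sK e kk eqxx.
    by rewrite mnmDE mnmBE !mnm1E ki ksi subn0.
  case: ifP => // kl.
  have ki : (i == k) = false.
    by apply/negP => /eqP e; move: ko; rewrite /o e kl eqxx.
  have ksi : (s i == k) = false.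
    apply/negP => /eqP e; move: ko kl; rewrite /o -e sK => H kl.
    by move: H; rewrite ltnNge ltnW // eqxx.
  have ski : (s i == s k) = false by rewrite (inj_eq (inv_inj sK)).
  have sksi : (i == s k) = false.
    by apply/negP => /eqP e; move: ksi; rewrite e sK eqxx.
  by rewrite !(mnmDE, mnmBE, mnm1E) ki ksi ski sksi !subn0.
rewrite /gmon (bigD1 o) //= [in RHS](bigD1 o) //= mulrA; congr (_ * _); last first.
  exact: eq_bigr.
rewrite {same}/gfac; have [ii|ii] := eqVneq (s i) i.
  have -> : o = i by rewrite /o ii if_same.
  by rewrite ii eqxx mnmDE mnmBE mnm1E eqxx add1n subn1 gmomS.
have oo : s o == o = false.
  by apply/negP; case: oP => ->; rewrite ?sK ?(eq_sym i) (negPf ii).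
have -> : (o < s o)%N.
  rewrite /o; case: (ltnP i (s i)) => // H; rewrite sK; rewrite ltn_neqAle H andbT.
  by rewrite -val_eqE in ii.
rewrite oo.
have E : ((U_(i) + m)%MM o == (U_(i) + m)%MM (s o)) = ((m i).+1 == m (s i)).
  case: oP => ->; rewrite ?sK !(mnmDE, mnm1E) eqxx ?(eq_sym i) (negPf ii) //.
have E' : ((m - U_(s i))%MM o == (m - U_(s i))%MM (s o)) = (m i == (m (s i)).-1).
  case: oP => ->; rewrite ?sK !(mnmBE, mnm1E) eqxx (negPf ii) subn0 subn1 //.
rewrite E E'; case Hq: (m (s i)) => [|q].
  by rewrite !mul0r.
rewrite eqSS /=; case: eqP => miq; last by rewrite !mul0r mulr0.
rewrite !mul1r; case: oP => ->; rewrite !(mnmDE, mnmBE, mnm1E) ?eqxx ?(eq_sym i) (negPf ii).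
  by rewrite miq add1n subn0 factS natrM.
by rewrite Hq add0n subn1 factS natrM.
Qed.

Definition gauss (p : {mpoly rat[n]}) : rat := \sum_(m <- msupp p) p@_m * gmon m.

Lemma gaussw k p : (msize p <= k)%N ->
  gauss p = \sum_(m : 'X_{1..n < k}) p@_m * gmon m.
Proof.
pose I : subFinType _ := 'X_{1..n < k}.
move=> le_pk; rewrite /gauss (big_mksub I) /=; first last.
  by move=> x /msize_mdeg_lt/leq_trans/(_ le_pk).
  by rewrite msupp_uniq.
rewrite big_rmcond //= => j /memN_msupp_eq0 ->.
by rewrite mul0r.
Qed.

Lemma gauss_is_additive : {morph gauss : p q / p - q}.
Proof.
move=> p q; pose k := maxn (msize (p - q)) (maxn (msize p) (msize q)).
rewrite !(@gaussw k) /k ?leq_maxl //; try by rewrite !leq_max leqnn ?orbT.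
rewrite -sumrB; apply: eq_bigr => m _; by rewrite mcoeffB mulrBl.
Qed.

HB.instance Definition _ := GRing.isZmodMorphism.Build _ _ gauss gauss_is_additive.

Lemma gaussZ c p : gauss (c *: p) = c * gauss p.
Proof.
rewrite (@gaussw (maxn (msize (c *: p)) (msize p))) ?leq_maxl //.
rewrite [in RHS](@gaussw (maxn (msize (c *: p)) (msize p))) ?leq_maxr //.
by rewrite mulr_sumr; apply: eq_bigr => m _; rewrite mcoeffZ mulrA.
Qed.

Lemma gaussX m : gauss 'X_[m] = gmon m.
Proof. by rewrite /gauss msuppX big_seq1 mcoeffX eqxx mul1r. Qed.

Lemma gauss1 : gauss 1 = 1.
Proof.
rewrite -mpolyX0 gaussX /gmon big1 // => k _; rewrite /gfac !mnm0E eqxx mul1r.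
by do 2?case: ifP.
Qed.

Lemma gaussMX i p : gauss ('X_i * p) = gauss (mderiv (s i) p).
Proof.
rewrite [p]mpolyE mulr_sumr [mderiv _ _]raddf_sum !raddf_sum /=.
apply: eq_bigr => m _.
by rewrite -scalerAr mderivZ !gaussZ -mpolyXD gaussX mderivX gaussZ gaussX gmon_step.
Qed.

End Functional.

(** The trace of exponent [n.+1] contracted with the [k]-th trace of [J]: two factors disappear and
    one trace remains. *)
Definition merge_at (n k : nat) (J : seq nat) : seq nat :=
  (n + nth 0%N J k).-1 :: take k J ++ drop k.+1 J.

(** Schwinger-Dyson equations. [Phi J] stands for the mean of the product of the traces with
    exponents in [J]; a distinguished factor of the trace of exponent [n.+1] is contracted either
    with a factor of the same trace, which splits it, or with one of another trace, which merges the
    two. *)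
Definition loop_equation (N : rat) (Phi : seq nat -> rat) :=
  (forall J, Phi (0%N :: J) = N * Phi J) /\
  (forall n J, Phi (n.+1 :: J) = \sum_(a < n) Phi [:: val a, (n - a).-1 & J]
     + \sum_(k < size J) (nth 0%N J k)%:R * Phi (merge_at n k J)).

Lemma sumn_take_drop k J : (k < size J)%N ->
  (nth 0%N J k + (sumn (take k J) + sumn (drop k.+1 J)) = sumn J)%N.
Proof.
move=> kJ; rewrite -[in RHS](cat_take_drop k J) sumn_cat (drop_nth 0%N kJ) /=.
by rewrite addnCA.
Qed.

(** Splitting and merging both lower [sumn J + size J]: the total exponent drops by two and at most
    one trace is added. The cross-multiplied form accommodates functionals that are not
    normalised. *)
Lemma loop_equation_unique N Phi Psi J :
  loop_equation N Phi -> loop_equation N Psi ->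
  Phi [::] * Psi J = Psi [::] * Phi J.
Proof.
move=> [Phi0 PhiS] [Psi0 PsiS].
have [m] := ubnP (sumn J + size J); elim: m J => // m IH [|[|n] J] Hm.
- by rewrite mulrC.
- by rewrite Phi0 Psi0 mulrCA IH 1?mulrCA //; move: Hm => /=; lia.
rewrite PhiS PsiS !mulrDr !mulr_sumr; congr (_ + _); apply: eq_bigr => k _.
  by apply: IH; move: Hm (ltn_ord k) => /=; lia.
rewrite mulrCA [in RHS]mulrCA; have [->|Jk] := eqVneq (nth 0%N J k) 0%N.
  by rewrite !mul0r.
congr (_ * _); apply: IH; have := sumn_take_drop (ltn_ord k).
rewrite /merge_at /= sumn_cat size_cat size_take size_drop ltn_ord.
by move: Hm (ltn_ord k) Jk => /=; lia.
Qed.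

Section Derivation.
Variables (R : comNzRingType) (D : R -> R).
Hypothesis D1 : D 1 = 0.
Hypothesis DM : forall p q, D (p * q) = D p * q + p * D q.

Lemma derivation_prod_eigen (I : Type) (r : seq I) (P : pred I) (F h : I -> R) :
  (forall i, P i -> D (F i) = h i * F i) ->
  D (\prod_(i <- r | P i) F i) =
  (\sum_(i <- r | P i) h i) * \prod_(i <- r | P i) F i.
Proof.
move=> DF; elim: r => [|i r IH]; first by rewrite !big_nil D1 mul0r.
by rewrite !big_cons; case: ifP => // Pi; rewrite DM IH DF //; ring.
Qed.

(** This is the merging term of the loop equations; it serves both power sums and traces. *)
Lemma derivation_power_sums (p : nat -> R) n J :
  (forall k, D (p k) = k%:R * p (n + k).-1) ->
  D (\prod_(k <- J) p k) =
  \sum_(k < size J) (nth 0%N J k)%:R * \prod_(i <- merge_at n k J) p i.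
Proof.
move=> Dp; elim: J => [|k J IH]; first by rewrite big_nil big_ord0 D1.
rewrite big_cons DM Dp IH big_ord_recl /merge_at /= big_cons drop0 mulrA.
congr (_ + _); rewrite mulr_sumr; apply: eq_bigr => i _.
by rewrite !big_cons /=; ring.
Qed.

End Derivation.

Section EigenvalueSide.
Variable N : nat.
Local Notation P := {mpoly rat[N]}.
Local Notation x i := ('X_i : {mpoly rat[N]}).

Definition psum (k : nat) : P := \sum_(i < N) x i ^+ k.
Definition vdm : P :=
  \prod_(p : 'I_N * 'I_N | (p.1 < p.2)%N) (x p.2 - x p.1).
Definition euler_op n (p : P) : P := \sum_(i < N) x i ^+ n * mderiv i p.

Lemma mderiv_var (i j : 'I_N) : mderiv i (x j) = (i == j)%:R.
Proof.
rewrite mderivX mnm1E eq_sym; case: eqP => [->|_]; last by rewrite scale0r.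
by rewrite scale1r -[X in (X - _)%MM]add0m addmK mpolyX0.
Qed.

Lemma mderiv1 n (i : 'I_n) : mderiv i (1 : {mpoly rat[n]}) = 0.
Proof. by rewrite -mpolyC1 mderivC. Qed.

Lemma mderiv_exp n (i : 'I_n) (p : {mpoly rat[n]}) k :
  mderiv i (p ^+ k) = k%:R * p ^+ k.-1 * mderiv i p.
Proof.
elim: k => [|k IH]; first by rewrite expr0 mderiv1 !mul0r.
rewrite exprS mderivM IH; case: k {IH} => [|k]; first by rewrite expr0; ring.
by rewrite /= exprS; ring.
Qed.

Lemma euler_op1 n : euler_op n 1 = 0.
Proof. by rewrite /euler_op big1 // => i _; rewrite mderiv1 mulr0. Qed.

Lemma euler_opM n p q : euler_op n (p * q) = euler_op n p * q + p * euler_op n q.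
Proof.
rewrite /euler_op mulr_suml mulr_sumr -big_split; apply: eq_bigr => i _ /=.
by rewrite mderivM; ring.
Qed.

Lemma euler_op_var n j : euler_op n (x j) = x j ^+ n.
Proof.
rewrite /euler_op (bigD1 j) //= mderiv_var eqxx mulr1 big1 ?addr0 // => i ij.
by rewrite mderiv_var (negPf ij) mulr0.
Qed.

Lemma euler_op_psum n k : euler_op n (psum k) = k%:R * psum (n + k).-1.
Proof.
rewrite /psum mulr_sumr {1}/euler_op.
under eq_bigr => i _ do rewrite raddf_sum mulr_sumr.
rewrite exchange_big; apply: eq_bigr => j _ /=.
rewrite (bigD1 j) //= big1 => [|i ij].
  rewrite mderiv_exp mderiv_var eqxx mulr1 addr0; case: k => [|k].
    by rewrite !mul0r mulr0.
  by rewrite addnS exprD /=; ring.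
by rewrite mderiv_exp mderiv_var (negPf ij) !mulr0.
Qed.

(** The divided difference [(x_i ^ n - x_j ^ n) / (x_i - x_j)] as a polynomial, meaningful on the
    diagonal too. *)
Definition divdiff n (i j : 'I_N) : P := \sum_(c < n) x i ^+ (n.-1 - c) * x j ^+ c.

Lemma divdiffC n i j : divdiff n i j = divdiff n j i.
Proof.
rewrite /divdiff (reindex_inj rev_ord_inj); apply: eq_bigr => c _ /=.
by rewrite mulrC; congr (x _ ^+ _ * x _ ^+ _); have := ltn_ord c; lia.
Qed.

Lemma euler_op_vdm n :
  euler_op n vdm = (\sum_(p : 'I_N * 'I_N | (p.1 < p.2)%N) divdiff n p.2 p.1) * vdm.
Proof.
apply: derivation_prod_eigen; [exact: euler_op1|exact: euler_opM|] => -[i j] /= _.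
transitivity (x j ^+ n - x i ^+ n); last by rewrite subrXX mulrC.
rewrite -!euler_op_var /euler_op -sumrB; apply: eq_bigr => k _.
by rewrite mderivB mulrBr.
Qed.

(** Summing the divided differences over all pairs [(i, j)] gives the products of power sums. The
    diagonal contributes [n x_i ^ (n - 1)]; the rest is twice the sum over [i < j], the logarithmic
    derivative of [vdm] along [euler_op n]. *)
Lemma vdm_loop n :
  \sum_(i < N) n%:R * x i ^+ n.-1 * vdm + 2 * euler_op n vdm =
  (\sum_(a < n) psum a * psum (n - a).-1) * vdm.
Proof.
rewrite euler_op_vdm -mulr_suml mulrA -mulrDl; congr (_ * _).
have -> : \sum_(a < n) psum a * psum (n - a).-1
        = \sum_(p : 'I_N * 'I_N) divdiff n p.2 p.1.
  rewrite -(pair_bigA _ (fun i j => divdiff n j i)) /divdiff /=.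
  under [RHS]eq_bigr => i _ do rewrite exchange_big.
  rewrite [RHS]exchange_big; apply: eq_bigr => a _ /=.
  rewrite /psum mulr_suml; apply: eq_bigr => i _; rewrite mulr_sumr.
  by apply: eq_bigr => j _; rewrite mulrC; congr (x _ ^+ _ * _); lia.
rewrite [RHS](bigID (fun p : 'I_N * 'I_N => p.1 == p.2)) /=; congr (_ + _).
  rewrite (reindex_onto (fun i : 'I_N => (i, i)) fst) /=; last first.
    by case=> i j /= /eqP ->.
  apply: eq_big => [i|i _]; first by rewrite !eqxx.
  rewrite /divdiff (eq_bigr (fun=> x i ^+ n.-1)) => [|c _].
    by rewrite sumr_const card_ord mulr_natl.
  by rewrite -exprD subnK //; have := ltn_ord c; lia.
rewrite [RHS](bigID (fun p : 'I_N * 'I_N => (p.1 < p.2)%N)) /= mulr_natl mulr2n.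
congr (_ + _).
  by apply: eq_bigl => -[i j] /=; rewrite -val_eqE; case: (ltngtP i j).
rewrite [RHS](reindex_inj (h := fun p : 'I_N * 'I_N => (p.2, p.1))) /=; last first.
  by case=> i j [i' j'] [-> ->].
apply: eq_big => [[i j]|[i j] _] /=; last exact: divdiffC.
by rewrite -val_eqE /=; case: (ltngtP i j).
Qed.

Definition eigen_mean (p : P) : rat := gauss id (p * vdm ^+ 2).

(** Integrate by parts in one factor [x_i] of [x_i ^ n.+1]: the derivatives of [x_i ^ n] and of
    [vdm ^ 2] give the splitting term by [vdm_loop], that of the other power sums the merging
    term. *)
Lemma eigen_mean_loop :
  loop_equation N%:R (fun J => eigen_mean (\prod_(k <- J) psum k)).
Proof.
split=> [J|n J].
  have -> : \prod_(k <- 0%N :: J) psum k = N%:R *: \prod_(k <- J) psum k.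
    have E : psum 0 = N%:R.
      by rewrite /psum (eq_bigr (fun=> 1)) ?sumr_const ?card_ord.
    by rewrite big_cons E scaler_nat mulr_natl.
  by rewrite /eigen_mean -scalerAl gaussZ.
pose Q : P := \prod_(k <- J) psum k.
rewrite /eigen_mean big_cons -/Q.
have -> : psum n.+1 * Q * vdm ^+ 2 =
          \sum_(i < N) x i * (x i ^+ n * (Q * vdm ^+ 2)).
  rewrite -mulrA mulr_suml; apply: eq_bigr => i _; rewrite exprS; ring.
rewrite raddf_sum /=; under eq_bigr => i _ do rewrite (@gaussMX _ id) //.
rewrite -raddf_sum /=.
under [X in _ = X + _]eq_bigr => k _ do rewrite !big_cons -/Q.
under [X in _ = _ + X]eq_bigr => k _ do rewrite -gaussZ.
rewrite -!raddf_sum -raddfD; congr (gauss _).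
transitivity ((\sum_(i < N) n%:R * x i ^+ n.-1 * vdm + 2 * euler_op n vdm) * Q * vdm
   + euler_op n Q * vdm ^+ 2).
  rewrite /euler_op mulr_sumr -big_split /= !mulr_suml -big_split /=.
  apply: eq_bigr => i _.
  by rewrite mderivM mderiv_exp mderivM mderiv_exp mderiv_var eqxx expr1 mulr1; ring.
rewrite vdm_loop; congr (_ + _).
  rewrite !mulr_suml; apply: eq_bigr => a _; ring.
rewrite (derivation_power_sums (euler_op1 n) (euler_opM n) _ (euler_op_psum n)).
by rewrite mulr_suml; apply: eq_bigr => k _; rewrite scaler_nat -[RHS]mulr_natl; apply/esym/mulrA.
Qed.

End EigenvalueSide.
End Gauss.

(** * Traces of Gaussian Hermitian matrices *)

Module MatrixModel.
Import ssrcomplements mpoly Gauss.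

Section MatrixSide.
Variable N : nat.
Local Notation I := 'I_N.+1.
Definition nvar := #|{: I * I}|.
Local Notation P := {mpoly rat[nvar]}.

(** Pairing the entry [(a, b)] with [(b, a)] gives the covariance of Hermitian matrices: the mean of
    [M_ab M_cd] is 1 if [a = d] and [b = c], and 0 otherwise. *)
Definition swap_var (k : 'I_nvar) : 'I_nvar :=
  enum_rank ((enum_val k).2, (enum_val k).1).

Lemma swap_varK : involutive swap_var.
Proof. by move=> k; rewrite /swap_var enum_rankK /= -surjective_pairing enum_valK. Qed.

Local Notation gmean := (gauss swap_var).
Definition entry (p : I * I) : P := 'X_(enum_rank p).
Definition dentry (p : I * I) (q : P) : P := mderiv (enum_rank p) q.
Definition gmx : 'M[P]_N.+1 := \matrix_(a, b) entry (a, b).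
Definition trp (k : nat) : P := \tr (gmx ^+ k).

Lemma gmeanMX a b q : gmean (entry (a, b) * q) = gmean (dentry (b, a) q).
Proof. by rewrite /entry (gaussMX swap_varK) /swap_var enum_rankK. Qed.

Lemma dentry_gmx p a b : dentry p (gmx a b) = (p == (a, b))%:R.
Proof.
by rewrite mxE /dentry /entry mderiv_var (inj_eq enum_rank_inj).
Qed.

(** Product rule: the factor at position [k] of [M ^ n] is replaced by the elementary matrix at
    [(c, d)]. *)
Lemma dentry_pow c d n a b :
  dentry (c, d) ((gmx ^+ n) a b) =
  \sum_(k < n) (gmx ^+ k) a c * (gmx ^+ (n - k).-1) d b.
Proof.
elim: n a b => [|n IH] a b.
  rewrite big_ord0 expr0 mxE /dentry; case: (a == b) => /=; last exact: raddf0.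
  exact: mderiv1.
rewrite exprS mxE /dentry raddf_sum /=.
under eq_bigr => e _.
  rewrite mderivM -!/(dentry (c, d) _) IH dentry_gmx mulr_sumr.
  under eq_bigr => k _ do rewrite mulrA.
  over.
rewrite big_split /= exchange_big /= [RHS]big_ord_recl expr0 subn0; congr (_ + _).
  rewrite mxE (bigD1 d) //= xpair_eqE eqxx andbT big1 ?addr0 => [|e ed].
    by rewrite eq_sym.
  by rewrite xpair_eqE (eq_sym d) (negPf ed) andbF mul0r.
apply: eq_bigr => k _; rewrite -mulr_suml; congr (_ * _).
by rewrite exprS [RHS]mxE.
Qed.

Lemma dentry_trp c d k : dentry (c, d) (trp k) = k%:R * (gmx ^+ k.-1) d c.
Proof.
rewrite /trp /mxtrace /dentry raddf_sum /=.
under eq_bigr => a _ do rewrite -/(dentry (c, d) _) dentry_pow.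
rewrite exchange_big /= (eq_bigr (fun=> (gmx ^+ k.-1) d c)) => [|i _].
  by rewrite sumr_const card_ord mulr_natl.
have -> : k.-1 = ((k - i).-1 + i)%N by have := ltn_ord i; lia.
rewrite exprD mxE; apply: eq_bigr => a _; exact: mulrC.
Qed.

Definition trace_op n (q : P) : P :=
  \sum_a \sum_b (gmx ^+ n) b a * dentry (b, a) q.

Lemma trace_op1 n : trace_op n 1 = 0.
Proof.
by rewrite /trace_op big1 // => a _; rewrite big1 // => b _; rewrite /dentry mderiv1 mulr0.
Qed.

Lemma trace_opM n p q : trace_op n (p * q) = trace_op n p * q + p * trace_op n q.
Proof.
rewrite /trace_op mulr_suml mulr_sumr -big_split; apply: eq_bigr => a _ /=.
rewrite mulr_suml mulr_sumr -big_split; apply: eq_bigr => b _ /=.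
by rewrite /dentry mderivM; ring.
Qed.

Lemma trace_op_trp n k : trace_op n (trp k) = k%:R * trp (n + k).-1.
Proof.
rewrite /trace_op; under eq_bigr => a _ do under eq_bigr => b _ do
  rewrite dentry_trp mulrCA.
case: k => [|k]; first by rewrite mul0r big1 // => a _; rewrite big1 // => b _; rewrite mul0r.
rewrite addnS /= /trp /mxtrace mulr_sumr; apply: eq_bigr => a _.
by rewrite addnC exprD mxE mulr_sumr; apply: eq_bigr => b _; congr (_ * _); apply: mulrC.
Qed.

Lemma gmean_loop :
  loop_equation N.+1%:R (fun J => gmean (\prod_(k <- J) trp k)).
Proof.
split=> [J|n J].
  have -> : \prod_(k <- 0%N :: J) trp k = N.+1%:R *: \prod_(k <- J) trp k.
    by rewrite big_cons /trp expr0 mxtrace1 scaler_nat mulr_natl.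
  by rewrite gaussZ.
pose Q : P := \prod_(k <- J) trp k.
rewrite big_cons -/Q.
have -> : trp n.+1 * Q = \sum_a \sum_b entry (a, b) * ((gmx ^+ n) b a * Q).
  rewrite /trp exprS /mxtrace mulr_suml; apply: eq_bigr => a _.
  by rewrite mxE mulr_suml; apply: eq_bigr => b _; rewrite mxE; ring.
rewrite raddf_sum /=; under eq_bigr => a _.
  rewrite raddf_sum /=; under eq_bigr => b _ do rewrite gmeanMX.
  rewrite -raddf_sum; over.
rewrite -raddf_sum /=.
under [X in _ = X + _]eq_bigr => k _ do rewrite !big_cons -/Q.
under [X in _ = _ + X]eq_bigr => k _ do rewrite -gaussZ.
rewrite -!raddf_sum -raddfD; congr (gauss _ _).
transitivity ((\sum_(a < n) trp a * trp (n - a).-1) * Q + trace_op n Q).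
  rewrite /trace_op.
  have -> : \sum_(a < n) trp a * trp (n - a).-1 =
     \sum_a \sum_b dentry (b, a) ((gmx ^+ n) b a).
    under [RHS]eq_bigr => a _ do under eq_bigr => b _ do rewrite dentry_pow.
    under [RHS]eq_bigr => a _ do rewrite exchange_big.
    rewrite [RHS]exchange_big; apply: eq_bigr => k _ /=.
    rewrite /trp /mxtrace mulr_suml exchange_big /=; apply: eq_bigr => b _.
    by rewrite mulr_sumr.
  rewrite mulr_suml -big_split /=; apply: eq_bigr => a _.
  by rewrite mulr_suml -big_split /=; apply: eq_bigr => b _; rewrite /dentry mderivM.
congr (_ + _).
  by rewrite mulr_suml; apply: eq_bigr => a _; ring.
rewrite (derivation_power_sums (trace_op1 n) (trace_opM n) _ (trace_op_trp n)).
by apply: eq_bigr => k _; rewrite scaler_nat -[RHS]mulr_natl.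
Qed.

(** This takes the place of Weyl's integration formula, with the mean of [vdm ^ 2] as the
    proportionality constant. *)
Lemma gmean_eigen_mean J :
  gmean (\prod_(k <- J) trp k) * gauss id (vdm N.+1 ^+ 2) =
  eigen_mean (\prod_(k <- J) psum N.+1 k).
Proof.
have := loop_equation_unique J gmean_loop (@eigen_mean_loop N.+1).
by rewrite !big_nil gauss1 // mul1r /eigen_mean mul1r => ->; rewrite mulrC.
Qed.

End MatrixSide.
End MatrixModel.

(** * Perfect matchings and Wick's formula *)

Section Matchings.
Variable T : finType.
Implicit Types (S : {set T}) (M : {set {set T}}) (e : {set T}).

(** The ground set [S] varies because Wick's recursion removes edges and components occupy only part
    of the half-edges. For [S = setT] this is [perfect_matching] by conversion. *)
Definition matching S M : bool :=
  partition M S && [forall e in M, #|e| == 2%N].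

Lemma matchingP S M :
  reflect [/\ forall e, e \in M -> #|e| = 2%N /\ e \subset S,
              forall h, h \in S -> exists2 e, e \in M & h \in e &
              forall e f h, e \in M -> f \in M -> h \in e -> h \in f -> e = f]
          (matching S M).
Proof.
apply: (iffP andP) => [[/and3P[/eqP cov triv _] /forall_inP M2]|[Msub Mcov Mtriv]].
  split=> [e eM|h|e f h eM fM he hf].
  - by split; [exact/eqP/M2|rewrite -cov; exact: bigcup_sup].
  - by rewrite -cov => /bigcupP.
  - by rewrite -(def_pblock triv eM he) (def_pblock triv fM hf).
split; last by apply/forall_inP => e /Msub[->].
apply/and3P; split.
- rewrite eqEsubset; apply/andP; split; first by apply/bigcupsP => e /Msub[].
  by apply/subsetP => h /Mcov[e eM he]; apply/bigcupP; exists e.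
- apply/trivIsetP => e f eM fM /eqP ef; rewrite -setI_eq0; apply/eqP/setP => h.
  by rewrite !inE; apply/negP => /andP[he hf]; apply: ef; apply: Mtriv he hf.
- by apply/negP => /Msub[]; rewrite cards0.
Qed.

Lemma matching_set0 M : matching set0 M = (M == set0).
Proof.
apply/matchingP/eqP => [[Msub _ _]|->]; last first.
  by split=> [e|h|e f h]; rewrite inE.
apply/setP => e; rewrite inE; apply/negP => /Msub[e2].
by rewrite subset0 => /eqP e0; move: e2; rewrite e0 cards0.
Qed.

Lemma matchingU S1 S2 M1 M2 : matching S1 M1 -> matching S2 M2 ->
  [disjoint S1 & S2] -> matching (S1 :|: S2) (M1 :|: M2).
Proof.
move=> /matchingP[sub1 cov1 triv1] /matchingP[sub2 cov2 triv2] dis.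
have no12 e f h : e \in M1 -> f \in M2 -> h \in e -> h \in f -> e = f.
  move=> /sub1[_ /subsetP eS] /sub2[_ /subsetP fS] /eS h1 /fS h2.
  by move: dis => /disjointFr /(_ h1); rewrite h2.
apply/matchingP; split=> [e|h|e f h]; rewrite !inE.
- by case/orP => [/sub1|/sub2] [-> eS]; split=> //; apply: subset_trans eS _;
    rewrite ?subsetUl ?subsetUr.
- by case/orP => [/cov1|/cov2] [e eM he]; exists e => //; rewrite inE eM ?orbT.
- move=> /orP[e1|e2] /orP[f1|f2] he hf; [exact: triv1 hf|exact: no12 hf| |exact: triv2 hf].
  by apply/esym; apply: no12 hf he.
Qed.

Lemma matching_restrict S M (U : {set T}) : matching S M -> U \subset S ->
  (forall e h, e \in M -> h \in e -> h \in U -> e \subset U) ->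
  matching U [set e in M | e \subset U].
Proof.
move=> /matchingP[sub cov triv] US closed; apply/matchingP; split=> [e|h hU|e f h].
- by rewrite inE => /andP[/sub[-> _] ->].
- have [e eM he] := cov h (subsetP US h hU).
  by exists e => //; rewrite inE eM (closed e h).
- by rewrite !inE => /andP[eM _] /andP[fM _]; apply: triv.
Qed.

Lemma matching_mate S M h : matching S M -> h \in S ->
  exists h', [/\ h' \in S :\ h, [set h; h'] \in M &
    forall h'', h'' != h -> [set h; h''] \in M -> h'' = h'].
Proof.
move=> /matchingP[sub cov triv] /cov[e eM he].
have [e2 eS] := sub e eM.
have /cards1P[h' eh'] : #|e :\ h| == 1%N by apply/eqP; move: e2; rewrite (cardsD1 h) he; lia.
have hh' : h' \in e :\ h by rewrite eh' set11.
have eE : e = [set h; h'] by rewrite -(setD1K he) eh'.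
exists h'; split=> [||h'' nh hM]; last 1 first.
- have : h'' \in e by rewrite (triv _ _ h eM hM) ?set21 ?set22.
  by rewrite eE !inE (negPf nh) => /eqP.
- by move: hh'; rewrite !inE => /andP[-> /(subsetP eS) ->].
- by rewrite -eE.
Qed.

Lemma matching_addE S M h h' : h \in S -> h' \in S :\ h ->
  [set h; h'] \notin M ->
  matching S ([set h; h'] |: M) = matching (S :\: [set h; h']) M.
Proof.
move=> hS h'S eM; have [h'h h'S'] : h' != h /\ h' \in S by apply/andP; rewrite -in_setD1.
have e2 : #|[set h; h']| = 2%N by rewrite cards2 eq_sym h'h.
have eS : [set h; h'] \subset S by rewrite subUset !sub1set hS.
apply/idP/idP => [Hm|Hm].
  have /matchingP[sub cov triv] := Hm.
  have := @matching_restrict S _ (S :\: [set h; h']) Hm (subsetDl _ _).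
  have key e g : e \in [set h; h'] |: M -> g \in e -> g \notin [set h; h'] ->
      e \subset S :\: [set h; h'].
    move=> eM' ge gh; rewrite subsetD (sub e eM').2 -setI_eq0 /=.
    apply/eqP/setP => x; rewrite in_setI in_set0; apply/negP => /andP[xe xh].
    by move: gh; rewrite -(triv e [set h; h'] x) ?ge // !inE eqxx.
  suff -> : [set e in [set h; h'] |: M | e \subset S :\: [set h; h']] = M.
    by apply=> e g eM' ge /setDP[_ gh]; apply: key gh.
  apply/setP => e; rewrite 2!inE in_set1; apply/andP/idP => [[/orP[/eqP ->|//]]|eM'].
    by rewrite subsetD -setI_eq0 setIid -cards_eq0 e2 andbF.
  split; first by rewrite eM' orbT.
  have eM'' : e \in [set h; h'] |: M by rewrite inE eM' orbT.
  have [ee _] := sub e eM''.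
  have /card_gt0P[g ge] : (0 < #|e|)%N by rewrite ee.
  apply: (key e g) => //; apply/negP => gh.
  by move: eM; rewrite -(triv e [set h; h'] g) ?eM' // !inE eqxx.
have -> : S = [set h; h'] :|: (S :\: [set h; h']) by rewrite -[LHS](setID S [set h; h']) (setIidPr eS).
apply: matchingU => //; last by rewrite disjoint_sym -setI_eq0 setIDAC setDIl setDv setI0.
apply/matchingP; split=> [e|x xe|e f x]; rewrite ?in_set1.
- by move=> /eqP ->.
- by exists [set h; h']; rewrite ?set11.
- by move=> /eqP -> /eqP ->.
Qed.

(** Classify the matchings by the partner [h'] of [h] and delete that edge. *)
Lemma matching_sum_step (R : comNzRingType) (w : {set T} -> R) S h : h \in S ->
  \sum_(M | matching S M) \prod_(e in M) w e =
  \sum_(h' in S :\ h) w [set h; h'] *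
     \sum_(M | matching (S :\: [set h; h']) M) \prod_(e in M) w e.
Proof.
move=> hS.
transitivity (\sum_(M | matching S M) \sum_(h' in S :\ h | [set h; h'] \in M) \prod_(e in M) w e).
  apply: eq_bigr => M HM; have [h' [h'S eM uni]] := matching_mate HM hS.
  rewrite (big_pred1 h') // => h''; apply/andP/eqP => [[]|->] //.
  by rewrite !inE => /andP[nh _]; apply: uni.
rewrite (exchange_big_dep (mem (S :\ h))) //=; last by move=> M h' _ /andP[].
apply: eq_bigr => h' h'S; rewrite mulr_sumr.
rewrite (reindex_onto (fun M => [set h; h'] |: M) (fun M => M :\ [set h; h'])) /=; last first.
  by move=> M /and3P[_ _ eM]; rewrite setD1K.
have nosub M : matching (S :\: [set h; h']) M -> [set h; h'] \notin M.
  move=> /matchingP[sub _ _]; apply/negP => /sub[_ /subsetP /(_ h)].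
  by rewrite !inE eqxx => /(_ isT).
apply: eq_big => [M|M].
  have [eM|eM] := boolP ([set h; h'] \in M).
    rewrite [RHS](contraTF (nosub M) eM); apply/negP => /andP[_ /eqP EM].
    by move: eM; rewrite -EM !inE eqxx.
  by rewrite matching_addE // h'S setU11 setU1K // eqxx !andbT.
move=> /andP[_ /eqP EM]; rewrite big_setU1 //.
by rewrite -EM !inE eqxx.
Qed.

End Matchings.

Module Wick.
Import ssrcomplements mpoly Gauss.

Lemma derivation_prod_set (R : comNzRingType) (D : R -> R) (T : finType) (A : {set T})
    (F : T -> R) : D 1 = 0 -> (forall p q, D (p * q) = D p * q + p * D q) ->
  D (\prod_(x in A) F x) = \sum_(y in A) D (F y) * \prod_(x in A :\ y) F x.
Proof.
move=> D1 DM; have [m] := ubnP #|A|; elim: m A => // m IH A Am.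
have [->|/set0Pn[y0 yA]] := eqVneq A set0; first by rewrite !big_set0.
have Em : (#|A :\ y0| < m)%N by move: Am; rewrite (cardsD1 y0) yA.
rewrite (big_setD1 y0) //= DM IH // [in RHS](big_setD1 y0) //=; congr (_ + _).
rewrite mulr_sumr; apply: eq_bigr => y /setD1P[yy0 yA'].
rewrite [in RHS](big_setD1 y0) /=; last by rewrite !inE eq_sym yy0.
by rewrite mulrCA !setDDl setUC.
Qed.

Section Isserlis.
Variables (n : nat) (s : 'I_n -> 'I_n) (T : finType) (l : T -> 'I_n).
Hypothesis sK : involutive s.

(** Quantifying over both ends makes the weight a function of the unordered edge; on a pair it is
    the covariance of the two labelled variables. *)
Definition wick_weight (e : {set T}) : rat :=
  [forall x in e, forall y in e, (x != y) ==> (l y == s (l x))]%:R.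

Lemma wick_weight2 x y : x != y -> wick_weight [set x; y] = (l y == s (l x))%:R.
Proof.
move=> xy; congr (_%:R); congr nat_of_bool; apply/forall_inP/eqP => [H|H a aI].
  have /forall_inP/(_ y (set22 _ _)) := H x (set21 _ _).
  by rewrite xy => /eqP.
apply/forall_inP => b bI; apply/implyP; move: aI bI.
by rewrite !inE => /orP[] /eqP -> /orP[] /eqP ->; rewrite ?eqxx ?H ?sK ?eqxx.
Qed.

(** Integrating by parts in the variable at [h], the derivative selects the partner of [h]: the same
    recursion as [matching_sum_step]. *)
Lemma isserlis (S : {set T}) :
  gauss s (\prod_(h in S) 'X_(l h)) =
  \sum_(M | matching S M) \prod_(e in M) wick_weight e.
Proof.
have [m] := ubnP #|S|; elim: m S => // m IH S Sm.
have [->|/set0Pn[h hS]] := eqVneq S set0.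
  rewrite big_set0 gauss1 //; under eq_bigl do rewrite matching_set0.
  by rewrite big_pred1_eq big_set0.
rewrite (big_setD1 h) //= gaussMX //.
rewrite (derivation_prod_set _ _ (mderiv1 _) (mderivM _)) raddf_sum.
rewrite (matching_sum_step _ hS); apply: eq_bigr => h' /setD1P[h'h h'S].
rewrite mderiv_var -IH; last first.
  move: Sm; rewrite ltnS => /(leq_trans _)-> //; apply: proper_card.
  by rewrite properEneq subsetDl andbT; apply/eqP => E; move: hS; rewrite -E !inE eqxx.
rewrite wick_weight2 1?eq_sym // (eq_sym (l h')) setDDl.
case: (s (l h) == l h'); rewrite ?mul1r // !mul0r raddf0 //.
Qed.

End Isserlis.
End Wick.

(** * Face colourings and connected components *)

Lemma sum_ffun_cons (R : nmodType) (T : finType) n (F : {ffun 'I_n.+1 -> T} -> R) :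
  \sum_g F g = \sum_a \sum_(g : {ffun 'I_n -> T})
    F [ffun i => oapp g a (unlift ord0 i)].
Proof.
rewrite pair_bigA /= (reindex (fun p : T * {ffun 'I_n -> T} =>
  [ffun i => oapp p.2 p.1 (unlift ord0 i)] : {ffun 'I_n.+1 -> T})) //=.
exists (fun g : {ffun 'I_n.+1 -> T} => (g ord0, [ffun i => g (lift ord0 i)])).
  move=> [a g] _ /=; rewrite ffunE unlift_none; congr (_, _).
  by apply/ffunP => i; rewrite !ffunE liftK.
move=> g _; apply/ffunP => i; rewrite ffunE /=.
by case: unliftP => [k ->|->] /=; rewrite ?ffunE.
Qed.

Section TraceExpansion.
Variables (R : comNzRingType) (N : nat) (A : 'M[R]_N.+1).

(** The kernel [K] keeps both ends of the path free, which lets the induction pass; [K a b = A b a]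
    later closes the path to a trace. *)
Lemma sum_open_paths n (K : 'I_N.+1 -> 'I_N.+1 -> R) :
  \sum_(g : {ffun 'I_n.+1 -> 'I_N.+1})
    (\prod_(i < n) A (g (widen_ord (leqnSn n) i)) (g (lift ord0 i))) * K (g ord0) (g ord_max)
  = \sum_a \sum_b (A ^+ n) a b * K a b.
Proof.
elim: n K => [|n IH] K; rewrite sum_ffun_cons; apply: eq_bigr => a _.
  rewrite (bigD1 a) //= expr0 mxE eqxx mul1r [X in _ = _ + X]big1 ?addr0 => [|b ba]; last first.
    by rewrite mxE eq_sym (negPf ba) mul0r.
  rewrite (big_pred1 [ffun=> a]) => [|g]; last first.
    by rewrite /=; apply/esym/eqP/ffunP => -[].
  rewrite big_ord0 mul1r !ffunE unlift_none.
  by have -> : ord_max = ord0 :> 'I_1 by [|apply: val_inj]; rewrite unlift_none.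
transitivity (\sum_(g : {ffun 'I_n.+1 -> 'I_N.+1})
    (\prod_(i < n) A (g (widen_ord (leqnSn n) i)) (g (lift ord0 i))) *
      (A a (g ord0) * K a (g ord_max))).
  apply: eq_bigr => g _; rewrite big_ord_recl !ffunE.
  have -> : widen_ord (leqnSn n.+1) ord0 = ord0 by apply: val_inj.
  have -> : ord_max = lift ord0 ord_max :> 'I_n.+2 by apply: val_inj.
  rewrite unlift_none !liftK /=.
  under eq_bigr => i _.
    rewrite !ffunE liftK.
    have -> : widen_ord (leqnSn n.+1) (lift ord0 i) = lift ord0 (widen_ord (leqnSn n) i).
      by apply: val_inj.
    rewrite liftK /=; over.
  by ring.
rewrite (IH (fun c b => A a c * K a b)) exchange_big; apply: eq_bigr => b _ /=.
rewrite exprS mxE mulr_suml; apply: eq_bigr => c _; ring.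
Qed.

Lemma trace_pow n : \tr (A ^+ n.+1) =
  \sum_(g : {ffun 'I_n.+1 -> 'I_N.+1}) \prod_i A (g i) (g (ordS i)).
Proof.
transitivity (\sum_a \sum_b (A ^+ n) a b * A b a).
  by rewrite exprSr /mxtrace; apply: eq_bigr => a _; rewrite mxE.
rewrite -(sum_open_paths n (fun a b => A b a)); apply: eq_bigr => g _.
rewrite big_ord_recr /=; congr (_ * _).
  apply: eq_bigr => i _; congr (A _ (g _)); apply: val_inj => /=.
  by rewrite modn_small // ltnS.
by congr (A _ (g _)); apply: val_inj; rewrite /= modnn.
Qed.

End TraceExpansion.

(** An invariant function is the same as a free choice of values on the roots of the cycles. *)
Lemma card_invariant_ffun (T C : finType) (c0 : C) (g : T -> T) : injective g ->
  #|[pred f : {ffun T -> C} | [forall x, f (g x) == f x]]| = (#|C| ^ fcard g predT)%N.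
Proof.
move=> ginj; have sym := fconnect_sym ginj.
rewrite -sum1_card.
have invP (f : {ffun T -> C}) : [forall x, f (g x) == f x] -> forall x, f (froot g x) = f x.
  move=> /forallP H x; have /connectP[p gp ->] := connect_root (frel g) x.
  elim: p x gp => //= y p IH x /andP[/eqP <- /IH ->]; exact/eqP.
transitivity (\sum_(p in pffun_on c0 (froots g) (mem C)) 1)%N; last first.
  rewrite sum1_card card_pffun_on; congr (_ ^ _)%N.
  by apply: eq_card => x; rewrite !inE andbT.
rewrite (reindex_onto (fun p : {ffun T -> C} => [ffun x => p (froot g x)])
  (fun f : {ffun T -> C} => [ffun x => if x \in froots g then f x else c0])) /=; last first.
  move=> f; rewrite inE => Hf; apply/ffunP => x; rewrite !ffunE.
  by rewrite -[_ \in _]/(roots _ _) roots_root // invP.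
apply: eq_bigl => p; rewrite inE; apply/andP/pffun_onP => [[_ /eqP pE]|[psub _]].
  split; last by move=> y.
  by apply/subsetP => x; rewrite inE -pE ffunE; case: ifP => // _; rewrite eqxx.
split.
  apply/forallP => x; rewrite !ffunE; apply/eqP; congr (p _); apply/eqP.
  by rewrite root_connect // sym fconnect1.
apply/eqP/ffunP => x; rewrite !ffunE; case: ifP => [/eqP ->//|xr].
apply/esym/eqP/negPn/negP => H.
by have := subsetP psub x H; rewrite xr.
Qed.

Module Colorings.
Import ssrcomplements mpoly Gauss MatrixModel Wick.

Section FaceCount.
Variables (N n j : nat).
Local Notation nu := n.+1.
Local Notation H := (halfedge nu j).
Local Notation C := 'I_N.+1.
Local Notation coloring := {ffun halfedge nu j -> 'I_N.+1}.
Implicit Types (f : coloring) (V U : {set 'I_j}) (M : {set {set halfedge nu j}}) (e : {set halfedge nu j}).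

Definition half_edges V : {set H} := [set h | h.1 \in V].
(** A colour on each half-edge plays the role of a matrix index: around a vertex, consecutive
    colours give the entries [M_(c_i, c_(i+1))] of an expanded trace. *)
Definition label f (h : H) : 'I_(nvar N) := enum_rank (f h, f (ccw_next h)).
Definition edge_weight f (e : {set H}) : rat := wick_weight (@swap_var N) (label f) e.
(** Colourings of part of the half-edges are represented by total functions with the default colour
    [ord0] elsewhere. *)
Definition supported V f : bool := [forall h, (h \notin half_edges V) ==> (f h == ord0)].
Definition color_weight V M : rat :=
  \sum_(f | supported V f) \prod_(e in M) edge_weight f e.
Definition trace_moment (k : nat) : rat := gauss (@swap_var N) (trp N nu ^+ k).

Lemma sum_colorings V :
  \sum_(f | supported V f) \prod_(h in half_edges V) 'X_(label f h) = trp N nu ^+ #|V|.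
Proof.
rewrite -prodr_const.
under eq_bigr => v _ do rewrite /trp trace_pow.
rewrite (big_distr_big [ffun=> ord0]) /=.
rewrite (reindex (fun f : coloring => [ffun v => [ffun i => f (v, i)]]
   : {ffun 'I_j -> {ffun 'I_nu -> C}})) /=; last first.
  exists (fun F : {ffun 'I_j -> {ffun 'I_nu -> C}} => [ffun h : H => F h.1 h.2]) => F _.
    by apply/ffunP => -[v i]; rewrite !ffunE.
  by apply/ffunP => v; apply/ffunP => i; rewrite !ffunE.
apply: eq_big => [f|f _].
  apply/forallP/pffun_onP => [sf|[sF _] [v i]].
    split=> //; apply/subsetP => v; rewrite inE; apply: contraNT => vV.
    apply/eqP/ffunP => i; rewrite !ffunE; apply/eqP.
    by apply: (implyP (sf (v, i))); rewrite inE.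
  apply/implyP; rewrite inE /= => vV.
  have /(_ v) := subsetP sF; rewrite inE ffunE => H.
  have /eqP/ffunP/(_ i) : [ffun i0 => f (v, i0)] == [ffun=> ord0].
    by apply: contraNT vV => /H.
  by rewrite !ffunE => ->.
transitivity (\prod_(v in V) \prod_i ('X_(label f (v, i)) : {mpoly rat[nvar N]})); last first.
  apply: eq_bigr => v _; apply: eq_bigr => i _.
  by rewrite /gmx mxE /entry /label !ffunE.
rewrite pair_big /=; apply: eq_big => [[v i]|[v i] _] //=.
by rewrite inE andbT.
Qed.

Lemma sum_matchings V :
  \sum_(M | matching (half_edges V) M) color_weight V M = trace_moment #|V|.
Proof.
rewrite exchange_big /= /trace_moment -sum_colorings raddf_sum /=.
by apply: eq_bigr => f _; rewrite (isserlis _ (@swap_varK N)).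
Qed.

Definition restrict_coloring U f : coloring :=
  [ffun h => if h.1 \in U then f h else ord0].

Lemma edge_weight_restrict U f e : e \subset half_edges U ->
  edge_weight (restrict_coloring U f) e = edge_weight f e.
Proof.
move=> /subsetP eU; rewrite /edge_weight /wick_weight; congr (_%:R); congr nat_of_bool.
have lE x : x \in e -> label (restrict_coloring U f) x = label f x.
  by move=> /eU; rewrite inE /label /restrict_coloring !ffunE /= => ->.
by apply: eq_forallb_in => x xe; apply: eq_forallb_in => y ye; rewrite !lE.
Qed.

(** Weights are multiplicative over disjoint vertex sets, because a colouring of the union is a pair
    of colourings. *)
Lemma color_weightU U W M1 M2 :
  matching (half_edges U) M1 -> matching (half_edges W) M2 -> [disjoint U & W] ->
  color_weight U M1 * color_weight W M2 = color_weight (U :|: W) (M1 :|: M2).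
Proof.
move=> HM1 HM2 dis.
have [sub1 _ _] := matchingP _ _ HM1; have [sub2 _ _] := matchingP _ _ HM2.
have disM : [disjoint M1 & M2].
  rewrite -setI_eq0; apply/eqP/setP => e; rewrite !inE; apply/negP => /andP[e1 e2].
  have [ee eU] := sub1 e e1; have [_ eW] := sub2 e e2.
  have /card_gt0P[h he] : (0 < #|e|)%N by rewrite ee.
  have := subsetP eU h he; have := subsetP eW h he; rewrite !inE => hW hU.
  by move: dis => /disjointFr /(_ hU); rewrite hW.
have UW v : v \in W -> v \notin U.
  by move=> vW; rewrite (disjointFl dis vW).
rewrite /color_weight big_distrlr /= pair_big /=.
rewrite (reindex_onto (fun f => (restrict_coloring U f, restrict_coloring W f))
  (fun p : coloring * coloring => [ffun h : H => if h.1 \in U then p.1 h else p.2 h])) /=.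
  apply: eq_big => [f|f _]; last first.
    rewrite [RHS](eq_bigl [predU M1 & M2]) => [|e]; last by rewrite !inE.
    rewrite bigU //=; congr (_ * _); apply: eq_bigr => e eM.
      by rewrite edge_weight_restrict //; case: (sub1 e eM).
    by rewrite edge_weight_restrict //; case: (sub2 e eM).
  have -> /= : supported U (restrict_coloring U f) && supported W (restrict_coloring W f).
    by apply/andP; split; apply/forallP => h; apply/implyP; rewrite inE ffunE => /negPf ->.
  apply/eqP/forallP => [fE h|sf].
    apply/implyP; rewrite !inE negb_or -fE !ffunE /= => /andP[/negPf -> /negPf ->].
    by [].
  apply/ffunP => h; rewrite !ffunE; case hU: (h.1 \in U) => //; case hW: (h.1 \in W) => //.
  by apply/esym/eqP; apply: (implyP (sf h)); rewrite !inE hU hW.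
move=> [f1 f2] /andP[/= /forallP s1 /forallP s2]; congr (_, _); apply/ffunP => h.
  rewrite !ffunE; case hU: (h.1 \in U) => //.
  by apply/esym/eqP; apply: (implyP (s1 h)); rewrite inE hU.
rewrite !ffunE; case hW: (h.1 \in W); first by rewrite (negPf (UW _ hW)).
by apply/esym/eqP; apply: (implyP (s2 h)); rewrite inE hW.
Qed.

Lemma ccw_next_inj : injective (@ccw_next nu j).
Proof.
move=> [v i] [v' i'] [-> ii']; congr (_, _).
by apply: ordS_inj; apply: val_inj.
Qed.

Lemma mateE M h h' : matching setT M -> h' != h -> [set h; h'] \in M -> mate M h = h'.
Proof.
move=> HM hh hM; have [g [_ _ uni]] := matching_mate HM (in_setT h).
rewrite (uni h') // /mate; case: pickP => [x /andP[xh xM]|/(_ h')]; last by rewrite hh hM.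
exact: uni.
Qed.

Lemma mateP M h : matching setT M -> mate M h != h /\ [set h; mate M h] \in M.
Proof.
move=> HM; have [g [gh gM _]] := matching_mate HM (in_setT h).
have gh' : g != h by move: gh; rewrite !inE andbT.
by rewrite (mateE HM gh' gM).
Qed.

Lemma face_step_inj M : matching setT M -> injective (face_step M).
Proof.
move=> HM x y /ccw_next_inj mxy.
have [xn xM] := mateP x HM; have [yn yM] := mateP y HM.
rewrite -(mateE HM (h := mate M x) (h' := x)) 1?eq_sym 1?setUC //.
by rewrite mxy (mateE HM (h := mate M y) (h' := y)) 1?eq_sym 1?setUC.
Qed.

Lemma prod_nat_of_bool (I : finType) (A : {set I}) (b : pred I) :
  \prod_(i in A) (b i)%:R = [forall i in A, b i]%:R :> rat.
Proof.
have [/forall_inP H|] := boolP [forall i in A, b i].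
  by rewrite big1 // => i /H ->.
rewrite negb_forall_in => /exists_inP[i iA /negPf bi].
by rewrite (bigD1 i) //= bi mul0r.
Qed.

(** An edge [{x, y}] has weight 1 exactly when [f] takes equal values at [y] and after [x], and at
    [x] and after [y]. Hence the colourings that survive are those constant on the cycles of
    [face_step], with one free colour per face. *)
Lemma color_weight_faces M : matching setT M ->
  color_weight setT M = N.+1%:R ^+ num_faces M.
Proof.
move=> HM; have [sub _ _] := matchingP _ _ HM.
rewrite -natrX -[X in (X ^ _)%N](card_ord N.+1) /num_faces.
rewrite -(card_invariant_ffun ord0 (face_step_inj HM)) -sum1_card natr_sum /color_weight.
rewrite big_mkcond [RHS]big_mkcond /=; apply: eq_bigr => f _.
have -> : supported setT f by apply/forallP => h; rewrite !inE.
rewrite /edge_weight /wick_weight prod_nat_of_bool -[X in _ = X]/(if _ then 1 else 0).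
suff -> : [forall e in M, forall x in e, forall y in e, (x != y) ==>
   (label f y == swap_var (label f x))] = [forall x, f (face_step M x) == f x].
  by rewrite inE; case: ifP.
apply/forall_inP/forallP => [W h|W e eM].
  have [hn hM] := mateP h HM.
  have /forall_inP/(_ h (set21 _ _))/forall_inP/(_ (mate M h) (set22 _ _)) := W _ hM.
  rewrite eq_sym hn /= /swap_var /label enum_rankK /= (inj_eq enum_rank_inj).
  by rewrite xpair_eqE => /andP[].
apply/forall_inP => x xe; apply/forall_inP => y ye; apply/implyP => xy.
have eE : [set x; y] = e.
  by apply/eqP; rewrite eqEcard subUset !sub1set xe ye cards2 xy (sub e eM).1.
have mx : mate M x = y by apply: mateE; rewrite ?eE // eq_sym.
have my : mate M y = x by apply: mateE; rewrite // setUC eE.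
rewrite /swap_var /label enum_rankK /= (inj_eq enum_rank_inj) xpair_eqE.
by have := W x; have := W y; rewrite /face_step mx my eq_sym => -> ->.
Qed.

End FaceCount.
End Colorings.

Import Colorings.

(** * Decomposition into connected components *)

Section Components.
Variables (N n j : nat).
Local Notation nu := n.+1.
Local Notation H := (halfedge nu j).
Implicit Types (V U W : {set 'I_j}) (M : {set {set halfedge nu j}}) (e : {set halfedge nu j}).

Definition component M (v : 'I_j) : {set 'I_j} := [set u | connect (share_edge M) v u].
Definition connected_matching V M : bool :=
  matching (half_edges n V) M &&
  [forall u in V, forall w in V, connect (share_edge M) u w].
Definition sub_matching M U : {set {set H}} := [set e in M | e \subset half_edges n U].

Lemma share_edgeP M u v :
  reflect (exists a b, [set ((u, a) : H); ((v, b) : H)] \in M) (share_edge M u v).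
Proof.
apply: (iffP existsP) => [[a /existsP[b]]|[a [b]]]; first by exists a, b.
by exists a; apply/existsP; exists b.
Qed.

Lemma share_edge_sym M : symmetric (share_edge M).
Proof.
suff imp u v : share_edge M u v -> share_edge M v u by move=> u v; apply/idP/idP; apply: imp.
by move=> /share_edgeP[a [b]]; rewrite setUC => ab; apply/share_edgeP; exists b, a.
Qed.

Lemma connect_share_sym M : connect_sym (share_edge M).
Proof. exact/sym_connect_sym/share_edge_sym. Qed.

Lemma connect_closed M (A : {set 'I_j}) u w :
  (forall x y, share_edge M x y -> x \in A -> y \in A) ->
  connect (share_edge M) u w -> u \in A -> w \in A.
Proof.
move=> clA uw; have /closed_connect cl := intro_closed (@connect_share_sym M) clA.
by rewrite (cl _ _ uw).
Qed.

Lemma share_edge_mem V M x y : matching (half_edges n V) M -> share_edge M x y ->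
  (x \in V) && (y \in V).
Proof.
move=> /matchingP[sub _ _] /share_edgeP[a [b /sub[_ /subsetP eV]]].
by have := eV _ (set21 _ _); have := eV _ (set22 _ _); rewrite !inE /= => -> ->.
Qed.

Lemma edge_share V M e (h g : H) : matching (half_edges n V) M -> e \in M ->
  h \in e -> g \in e -> connect (share_edge M) h.1 g.1.
Proof.
move=> /matchingP[sub _ _] eM he ge; have [->|hg] := eqVneq h g; first exact: connect0.
have eE : [set h; g] = e.
  by apply/eqP; rewrite eqEcard subUset !sub1set he ge cards2 hg (sub e eM).1.
apply: connect1; apply/share_edgeP; exists h.2, g.2.
by rewrite -!surjective_pairing eE.
Qed.

Section Split.
Variables (V : {set 'I_j}) (v : 'I_j).

(** Together with [join_component], a bijection between matchings on [V] and pairs made of a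
    connected matching on the component [U] of [v] and a matching on the remaining vertices. *)
Lemma split_component M : v \in V -> matching (half_edges n V) M ->
  let U := component M v in
  [/\ v \in U, U \subset V, connected_matching U (sub_matching M U),
      matching (half_edges n (V :\: U)) (sub_matching M (V :\: U)) &
      sub_matching M U :|: sub_matching M (V :\: U) = M].
Proof.
move=> vV HM U; have [sub cov triv] := matchingP _ _ HM.
have UP u : (u \in U) = connect (share_edge M) v u by rewrite inE.
clearbody U; have vU : v \in U by rewrite UP connect0.
have UV : U \subset V.
  apply/subsetP => u; rewrite UP => vu; apply: (connect_closed _ vu vV) => x y xy _.
  by case/andP: (share_edge_mem HM xy).
have clU e h : e \in M -> h \in e -> h \in half_edges n U -> e \subset half_edges n U.
  move=> eM he hU; apply/subsetP => g ge; move: hU; rewrite !inE !UP => vh.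
  exact: connect_trans vh (edge_share HM eM he ge).
have clW e h : e \in M -> h \in e -> h \in half_edges n (V :\: U) ->
    e \subset half_edges n (V :\: U).
  move=> eM he hW; apply/subsetP => g ge.
  have gV : g.1 \in V by have := subsetP (sub e eM).2 g ge; rewrite inE.
  move: hW; rewrite !inE gV andbT => /andP[hU _].
  apply: contra hU => gU; have := clU e g eM ge; rewrite inE => /(_ gU)/subsetP/(_ h he).
  by rewrite inE.
have half_sub (A B : {set 'I_j}) : A \subset B -> half_edges n A \subset half_edges n B.
  by move=> /subsetP AB; apply/subsetP => h; rewrite !inE; apply: AB.
have HMU : matching (half_edges n U) (sub_matching M U).
  by apply: matching_restrict HM _ clU; apply: half_sub.
split=> //.
- rewrite /connected_matching HMU /=.
  have vu u : u \in U -> connect (share_edge (sub_matching M U)) v u.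
    rewrite UP => vu.
    suff : u \in [set w in U | connect (share_edge (sub_matching M U)) v w].
      by rewrite inE => /andP[].
    apply: (connect_closed _ vu); last by rewrite inE vU connect0.
    move=> x y /[dup] xy /share_edgeP[a [b eM]]; rewrite !(inE, andbT) => /andP[xU vx].
    have xyM : share_edge (sub_matching M U) x y.
      apply/share_edgeP; exists a, b; rewrite inE eM.
      by apply: (clU _ (x, a)) => //; rewrite ?set21 // !inE.
    rewrite UP in xU; rewrite UP.
    by rewrite (connect_trans xU (connect1 xy)) (connect_trans vx (connect1 xyM)).
  apply/forall_inP => u uU; apply/forall_inP => w wU.
  by apply: connect_trans (vu w wU); rewrite connect_share_sym vu.
- by apply: matching_restrict HM _ clW; apply: half_sub; apply: subsetDl.
- apply/setP => e; rewrite !inE -andb_orr; apply: andb_idr => eM.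
  have [ee eV] := sub e eM.
  have /card_gt0P[h he] : (0 < #|e|)%N by rewrite ee.
  have [hU|hU] := boolP (h.1 \in U); first by rewrite (clU e h) // inE.
  by rewrite (clW e h) ?orbT // !inE; move: (subsetP eV h he); rewrite inE hU => ->.
Qed.

Lemma join_component U M1 M2 : v \in U -> U \subset V ->
  connected_matching U M1 -> matching (half_edges n (V :\: U)) M2 ->
  [/\ matching (half_edges n V) (M1 :|: M2), component (M1 :|: M2) v = U,
      sub_matching (M1 :|: M2) U = M1 & sub_matching (M1 :|: M2) (V :\: U) = M2].
Proof.
move=> vU UV /andP[HM1 /forall_inP con] HM2.
have [sub1 _ _] := matchingP _ _ HM1; have [sub2 _ _] := matchingP _ _ HM2.
have dis : [disjoint half_edges n U & half_edges n (V :\: U)].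
  rewrite -setI_eq0; apply/eqP/setP => h; rewrite !inE.
  by case: (h.1 \in U).
have HV : half_edges n V = half_edges n U :|: half_edges n (V :\: U).
  apply/setP => h; rewrite !inE; case hU: (h.1 \in U) => //=.
  by rewrite (subsetP UV).
have no e : #|e| = 2%N -> e \subset half_edges n U -> e \subset half_edges n (V :\: U) -> False.
  move=> ee /subsetP eU /subsetP eW.
  have /card_gt0P[h he] : (0 < #|e|)%N by rewrite ee.
  by move: dis => /disjointFr /(_ (eU h he)); rewrite (eW h he).
split.
- by rewrite HV; apply: matchingU.
- apply/setP => u; rewrite inE; apply/idP/idP => [vu|uU]; last first.
    have := forall_inP (con v vU) u uU; apply: connect_sub => x y /share_edgeP[a [b ab]].
    by apply: connect1; apply/share_edgeP; exists a, b; rewrite inE ab.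
  apply: (connect_closed _ vu vU) => x y /share_edgeP[a [b]].
  rewrite inE => /orP[/sub1|/sub2] [_ /subsetP eS] xU.
    by have := eS _ (set22 _ _); rewrite inE.
  by have := eS _ (set21 _ _); rewrite !inE xU.
- apply/setP => e; rewrite !inE; apply/andP/idP => [[/orP[//|e2] eU]|e1].
    by case: (no e (sub2 e e2).1 eU (sub2 e e2).2).
  by rewrite e1 (sub1 e e1).2.
- apply/setP => e; rewrite !inE; apply/andP/idP => [[/orP[e1|//] eW]|e2].
    by case: (no e (sub1 e e1).1 (sub1 e e1).2 eW).
  by rewrite e2 orbT (sub2 e e2).2.
Qed.

Definition connected_sum U : rat := \sum_(M | connected_matching U M) color_weight N U M.

Lemma component_sum : v \in V ->
  trace_moment N n #|V| =
  \sum_(U : {set 'I_j} | (v \in U) && (U \subset V))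
     connected_sum U * trace_moment N n #|V :\: U|.
Proof.
move=> vV; rewrite -(sum_matchings N n V).
rewrite (partition_big (fun M => component M v) (fun U => (v \in U) && (U \subset V))) /=; last first.
  by move=> M HM; have [-> ->] := split_component vV HM.
apply: eq_bigr => U /andP[vU UV]; rewrite -(sum_matchings N n (V :\: U)) /connected_sum.
rewrite [RHS]big_distrlr [RHS]pair_big /=.
rewrite [RHS](reindex_onto (fun M => (sub_matching M U, sub_matching M (V :\: U)))
  (fun p : {set {set H}} * {set {set H}} => p.1 :|: p.2)) /=; last first.
  move=> [M1 M2] /andP[/= H1 H2].
  by have [_ _ -> ->] := join_component vU UV H1 H2.
apply: eq_big => [M|M /andP[HM /eqP MU]].
  apply/andP/andP => [[HM /eqP MU]|[/andP[H1 H2] /eqP ME]].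
    by have := split_component vV HM; rewrite MU => -[_ _ -> -> ->].
  by have [] := join_component vU UV H1 H2; rewrite ME => -> ->.
have [_ _ /andP[H1 _] H2 ME] := split_component vV HM; rewrite MU in H1 H2 ME.
rewrite color_weightU // ?ME; last first.
  by rewrite -setI_eq0; apply/eqP/setP => h; rewrite !inE; case: (h \in U).
by congr (color_weight N _ _); rewrite -[LHS](setID V U) (setIidPr UV).
Qed.

End Split.

Lemma sum_subsets_card (V : {set 'I_j}) (v : 'I_j) (F : nat -> rat) : v \in V ->
  \sum_(U : {set 'I_j} | (v \in U) && (U \subset V)) F #|U| =
  \sum_(i < #|V|) ('C(#|V|.-1, i))%:R * F i.+1.
Proof.
move=> vV.
rewrite (reindex_onto (fun B => v |: B) (fun U => U :\ v)) /=; last first.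
  by move=> U /andP[vU _]; rewrite setD1K.
have V1 : #|V :\ v| = #|V|.-1 by rewrite (cardsD1 v V) vV.
transitivity (\sum_(B : {set 'I_j} | B \subset V :\ v) F #|B|.+1).
  apply: eq_big => [B|B]; last first.
    move=> /andP[_ /eqP BE]; rewrite cardsU1.
    by have -> : v \notin B by rewrite -BE !inE eqxx.
  rewrite setU11 subUset sub1set vV /= subsetD1.
  apply/andP/andP => -[BV Bv]; split=> //; last by rewrite setU1K.
  by rewrite -(eqP Bv) !inE eqxx.
rewrite (partition_big (fun B : {set 'I_j} => inord #|B| : 'I_#|V|.-1.+1) xpredT) //=.
have Vs : #|V|.-1.+1 = #|V| by rewrite prednK //; apply/card_gt0P; exists v.
rewrite -[in RHS]Vs; apply: eq_bigr => i _.
rewrite (eq_bigr (fun=> F i.+1)) => [|B /andP[BV /eqP <-]]; last first.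
  by rewrite inordK // ltnS -V1 subset_leq_card.
rewrite sumr_const -[LHS]mulr_natl; congr (_%:R * _).
transitivity 'C(#|V :\ v|, i); last by rewrite V1.
rewrite -cards_draws.
apply: eq_card => B; rewrite !inE; apply: andb_id2l => BV.
by rewrite -val_eqE /= inordK // ltnS -V1 subset_leq_card.
Qed.

(** The recursion over the component of a fixed vertex is triangular, since the term [U = V] has
    coefficient [trace_moment N n 0 = 1]. Any solution [c] of its numerical form is therefore the
    connected sum, and no bijection between vertex sets of equal size is required. *)
Lemma connected_sum_card (c : nat -> rat) (V : {set 'I_j}) :
  (forall k, trace_moment N n k.+1 =
     \sum_(i < k.+1) ('C(k, i))%:R * (c i.+1 * trace_moment N n (k - i))) ->
  V != set0 -> connected_sum V = c #|V|.
Proof.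
move=> cE; have [m] := ubnP #|V|; elim: m V => // m IH V Vm /set0Pn[v vV].
have z0 : trace_moment N n 0 = 1 by rewrite /trace_moment expr0 Gauss.gauss1.
have V0 : #|V| = #|V|.-1.+1 by rewrite prednK //; apply/card_gt0P; exists v.
have := component_sum vV; rewrite [X in trace_moment _ _ X]V0 cE -V0.
have -> : \sum_(i < #|V|) 'C(#|V|.-1, i)%:R * (c i.+1 * trace_moment N n (#|V|.-1 - i)) =
    \sum_(U : {set 'I_j} | (v \in U) && (U \subset V)) c #|U| * trace_moment N n #|V :\: U|.
  transitivity (\sum_(U : {set 'I_j} | (v \in U) && (U \subset V))
     c #|U| * trace_moment N n (#|V| - #|U|)).
    rewrite (sum_subsets_card (fun u => c u * trace_moment N n (#|V| - u)) vV).
    by apply: eq_bigr => i _; congr (_ * (_ * trace_moment _ _ _)); lia.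
  by apply: eq_bigr => U /andP[_ UV]; rewrite cardsD (setIidPr UV).
rewrite (bigD1 V) ?vV ?subxx //= [in RHS](bigD1 V) ?vV ?subxx //= setDv cards0 z0 !mulr1.
rewrite (eq_bigr (fun U => connected_sum U * trace_moment N n #|V :\: U|)).
  by move=> /addIr.
move=> U /andP[/andP[vU UV] UneV]; rewrite IH //; last by apply/set0Pn; exists v.
by rewrite (leq_trans _ (_ : #|V| <= m)%N) // proper_card // properEneq UneV.
Qed.

End Components.

(** * Orthogonal polynomials and the Freud equation *)

Definition fps_inv (F : fieldType) (f : fps F) : fps F :=
  if pselect (exists g, f * g = 1) is left e then projT1 (cid e) else 0.

Lemma mul_fps_inv (F : fieldType) (f : fps F) : fcoef f 0 != 0 -> f * fps_inv f = 1.
Proof.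
move=> f0; rewrite /fps_inv; case: pselect => [e|ne]; first by case: (cid e).
by case: ne; apply: fps_inv_exists.
Qed.

Lemma fps_mulIf (F : fieldType) (f g h : fps F) : fcoef f 0 != 0 -> f * g = f * h -> g = h.
Proof.
move=> /mul_fps_inv fK fgh.
by rewrite -[g]mul1r -[h]mul1r -fK -!(mulrC (fps_inv f)) -!mulrA fgh.
Qed.

Module OrthoPoly.
Section OrthogonalPolynomials.
Import Gauss.
Local Notation A := (fps rat).
Local Notation t := (fpsX rat).

(** The moment of [x ^ k] against [exp (- x ^ 2 / 2 + t x ^ 6)], expanded in [t]. *)
Definition momt (k : nat) : A := Fps (fun j => gmom (k + 6 * j) / (j`!)%:R).

Lemma fcoef_momt k j : fcoef (momt k) j = gmom (k + 6 * j) / (j`!)%:R.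
Proof. by []. Qed.

Lemma gmom_odd k : odd k -> gmom k = 0.
Proof.
have [m] := ubnP k; elim: m k => // m IH [|[|k]] //= km; rewrite negbK => ok.
by rewrite IH ?mulr0 // ltnW.
Qed.

Lemma momt_odd k : odd k -> momt k = 0.
Proof.
move=> ok; apply: fpsP => j; rewrite fcoef_momt gmom_odd ?mul0r //.
by rewrite oddD ok oddM.
Qed.

(** Integration by parts against the weight, whose logarithmic derivative is [- x + 6 t x ^ 5]. *)
Lemma momt_string k : k%:R * momt k.-1 = momt k.+1 - 6 * (t * momt (k + 5)).
Proof.
apply: fpsP => j; rewrite fcoefB !fcoef_natM fcoefXM.
case: j => [|j].
  by rewrite !fcoef_momt !muln0 !addn0 gmomS mulr0 subr0 !fact0 !divr1.
rewrite !fcoef_momt factS natrM.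
have -> : (k + 5 + 6 * j = (k + 6 * j.+1).-1)%N by lia.
have -> : (k.+1 + 6 * j.+1 = (k + 6 * j.+1).+1)%N by lia.
rewrite gmomS; have j1 : j.+1%:R != 0 :> rat by rewrite pnatr_eq0.
have jf : j`!%:R != 0 :> rat by rewrite pnatr_eq0 -lt0n fact_gt0.
case: k => [|k].
  have -> : (0 + 6 * j.+1)%:R = 6 * j.+1%:R :> rat by rewrite add0n natrM.
  rewrite mul0r; move: j1 jf; move: (j.+1%:R) (j`!%:R) (gmom _) => a b g a0 b0; by field; rewrite a0 b0.
have -> : ((k.+1 + 6 * j.+1).-1 = k.+1.-1 + 6 * j.+1)%N by [].
rewrite natrD natrM.
by move: j1 jf; move: (j.+1%:R) (j`!%:R) (gmom _) => a b g a0 b0; field; rewrite a0 b0.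
Qed.

Definition lmom (p : {poly A}) : A := \sum_(i < size p) p`_i * momt i.

Lemma lmomw n (p : {poly A}) : (size p <= n)%N -> lmom p = \sum_(i < n) p`_i * momt i.
Proof.
move=> pn; rewrite /lmom (big_ord_widen n (fun i => p`_i * momt i) pn) big_mkcond.
by apply: eq_bigr => i _; case: ltnP => // /(nth_default 0) ->; rewrite mul0r.
Qed.

Lemma lmom_is_additive : {morph lmom : p q / p - q}.
Proof.
move=> p q; pose n := maxn (size (p - q)) (maxn (size p) (size q)).
rewrite !(@lmomw n) ?leq_max ?leqnn ?orbT // -sumrB.
by apply: eq_bigr => i _; rewrite coefB mulrBl.
Qed.
HB.instance Definition _ := GRing.isZmodMorphism.Build _ _ lmom lmom_is_additive.

Lemma lmomZ c p : lmom (c *: p) = c * lmom p.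
Proof.
rewrite (@lmomw (size p)) ?size_scale_leq // /lmom mulr_sumr.
by apply: eq_bigr => i _; rewrite coefZ mulrA.
Qed.

Lemma lmomXn k : lmom 'X^k = momt k.
Proof.
rewrite /lmom size_polyXn (bigD1 ord_max) //= coefXn eqxx mul1r big1 ?addr0 // => i ik.
by rewrite coefXn -[i == k :> nat]/(i == ord_max) (negPf ik) mul0r.
Qed.

Lemma poly_sumX n (p : {poly A}) : (size p <= n)%N -> p = \sum_(k < n) p`_k *: 'X^k.
Proof.
move=> pn; rewrite -(poly_def n (fun k => p`_k)); apply/polyP => i.
by rewrite coef_poly; case: ltnP => // /(leq_trans pn) /(nth_default 0).
Qed.

Lemma lmomM n m (p q : {poly A}) : (size p <= n)%N -> (size q <= m)%N ->
  lmom (p * q) = \sum_(k < n) \sum_(k' < m) p`_k * momt (k + k') * q`_k'.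
Proof.
move=> pn qm; rewrite {1}(poly_sumX pn) {1}(poly_sumX qm) big_distrlr raddf_sum /=.
apply: eq_bigr => k _; rewrite raddf_sum; apply: eq_bigr => k' _ /=.
by rewrite -scalerAr -scalerAl !lmomZ -exprD lmomXn; ring.
Qed.

Lemma lmom_string p : lmom p^`() = lmom ('X * p) - 6 * (t * lmom ('X^5 * p)).
Proof.
rewrite (poly_sumX (leqnn (size p))); set n := size p.
rewrite ['X * _]mulr_sumr ['X^5 * _]mulr_sumr [_^`()]raddf_sum !raddf_sum /= !mulr_sumr -sumrB.
apply: eq_bigr => k _ /=.
rewrite derivZ derivXn -!scalerAr !lmomZ raddfMn /= !lmomXn -exprS -exprD !lmomXn.
by rewrite -[momt _ *+ _]mulr_natl momt_string addnC; ring.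
Qed.

Definition op_step (pq : {poly A} * {poly A}) : {poly A} * {poly A} :=
  ('X * pq.1 - (lmom ('X^((size pq.1).-1) * pq.1) * fps_inv (lmom ('X^((size pq.2).-1) * pq.2))) *: pq.2,
   pq.1).

(* [op_step] reads the degrees off the two polynomials it is given; the start
   [(1, 0)] makes the first coefficient [r_0] harmless. *)
Definition op (n : nat) : {poly A} := (iter n op_step (1, 0)).1.

Definition opn (n : nat) : A := lmom ('X^n * op n).
Definition opr (n : nat) : A := if n is m.+1 then opn n * fps_inv (opn m) else 0.

Lemma op_size n : size (op n) = n.+1 /\ lead_coef (op n) = 1.
Proof.
have [m] := ubnP n; elim: m n => // m IH n nm.
case: n nm => [_|n nm]; first by rewrite /op /= size_poly1 lead_coef1.
have [s1 l1] := IH n nm.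
have mon : op n \is monic by apply/monicP.
rewrite /op iterS /= -/(op n); set c := (_ * fps_inv _).
set q := (iter n _ _).2.
have sq : (size (c *: q) < size ('X * op n)%R)%N.
  apply: leq_ltn_trans (size_scale_leq _ _) _.
  rewrite size_monicM ?monicX ?monic_neq0 // size_polyX s1 /=.
  rewrite {}/q; case: n nm {s1 l1 mon c} => [|n] nm; first by rewrite size_poly0.
  by rewrite iterS /= -/(op n) (IH n _).1 // ltnW.
rewrite size_polyDl ?size_polyN // lead_coefDl ?size_polyN //.
rewrite size_monicM ?monicX ?monic_neq0 // size_polyX s1; split=> //.
by rewrite lead_coef_Mmonic // lead_coefX.
Qed.

Lemma op0 : op 0 = 1. Proof. by []. Qed.

Lemma opS n : op n.+1 = 'X * op n - opr n *: op n.-1.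
Proof.
case: n => [|n]; first by rewrite /op /= scaler0 scale0r.
have E : iter n.+1 op_step (1, 0) = (op n.+1, op n) by rewrite [LHS]surjective_pairing.
by rewrite -[op n.+2]/((op_step (iter n.+1 op_step (1, 0))).1) E /op_step !(op_size _).1.
Qed.

Lemma mulX_op n : 'X * op n = op n.+1 + opr n *: op n.-1.
Proof. by rewrite opS subrK. Qed.

(** The weight is even. Hence the three-term recurrence has no diagonal term, and orthogonality of
    [op n.+1] to [x ^ n] comes for free. *)
Lemma op_parity n k : odd (k + n) -> lmom ('X^k * op n) = 0.
Proof.
have [m] := ubnP n; elim: m n k => // m IH [|n] k nm ok.
  by rewrite op0 mulr1 lmomXn momt_odd // -[k]addn0.
rewrite opS mulrBr mulrA -exprSr raddfB /= -scalerAr lmomZ.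
rewrite (_ : lmom ('X^(k.+1) * op n) = 0); last by apply: IH; rewrite ?addSnnS.
case: n nm ok => [|n] nm ok; first by rewrite /opr mul0r subr0.
rewrite (IH n) ?mulr0 ?subr0 //; first by rewrite ltnW.
by move: ok; rewrite !addnS /= negbK.
Qed.

Definition op_orth n := forall k, (k < n)%N -> lmom ('X^k * op n) = 0.

Lemma op_orth_coef n (q : {poly A}) : op_orth n -> (size q <= n.+1)%N ->
  lmom (q * op n) = q`_n * opn n.
Proof.
move=> orth qn; rewrite {1}(poly_sumX qn) mulr_suml raddf_sum big_ord_recr /=.
rewrite -scalerAl lmomZ big1 ?add0r // => k _.
by rewrite /= -scalerAl lmomZ orth ?mulr0.
Qed.

Lemma op_string n : op_orth n -> op_orth n.+1 ->
  n.+1%:R * opn n = opn n.+1 - 6 * (t * lmom ('X^5 * (op n.+1 * op n))).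
Proof.
move=> orth orthS; have := lmom_string (op n.+1 * op n).
rewrite derivM raddfD /= [op n.+1 * (op n)^`()]mulrC.
have [s0 l0] := op_size n; have [s1 l1] := op_size n.+1.
have d0 : op n != 0 by rewrite -size_poly_eq0 s0.
have d1 : op n.+1 != 0 by rewrite -size_poly_eq0 s1.
rewrite (op_orth_coef (q := (op n)^`()) orthS); last first.
  by rewrite ltnW // (leq_trans (lt_size_deriv d0)) ?s0.
rewrite (op_orth_coef (q := (op n.+1)^`()) orth); last by rewrite -ltnS -s1 lt_size_deriv.
rewrite !coef_deriv.
have -> : (op n)`_n.+2 = 0 by rewrite nth_default // s0.
have -> : (op n.+1)`_n.+1 = 1 by move: l1; rewrite lead_coefE s1.
rewrite mul0rn mul0r addr0 => ->.
have -> : 'X * (op n.+1 * op n) = ('X * op n) * op n.+1 by ring.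
rewrite (op_orth_coef orthS); last first.
  by rewrite mulrC size_mulX // s0.
by rewrite coefXM /=; move: l0; rewrite lead_coefE s0 /= => ->; rewrite mul1r.
Qed.

(** Orthogonality requires division by earlier norms [opn]. Their constant terms are nonzero by
    [op_string] at [t = 0], which itself uses orthogonality; hence the joint induction. The values
    [n!] are the Hermite norms. *)
Lemma op_orthP n : op_orth n /\ fcoef (opn n) 0 = n`!%:R.
Proof.
have [m] := ubnP n; elim: m n => // m IH [|n] nm.
  split=> [k //|]; rewrite /opn op0 mulr1 lmomXn fcoef_momt.
  by rewrite /= fact0 divr1.
have [orth h0] := IH n nm.
have orthS : op_orth n.+1.
  move=> k; rewrite ltnS leq_eqVlt => /orP[/eqP ->|kn].
    by apply: op_parity; rewrite addnS addnn /= odd_double.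
  rewrite opS mulrBr mulrA -exprSr raddfB /= -scalerAr lmomZ.
  case: n nm orth h0 kn => [//|n] nm orth h0; rewrite ltnS leq_eqVlt => /orP[/eqP ->|kn].
    have [_ h1] := IH n (ltnW nm).
    rewrite -/(opn n.+1) -/(opn n) /opr -mulrA (mulrC (fps_inv _)) mul_fps_inv ?mulr1 ?subrr //.
    by rewrite h1 pnatr_eq0 -lt0n fact_gt0.
  rewrite orth ?ltnS // (IH n (ltnW nm)).1 // ?mulr0 ?subr0 //.
split=> //.
have := congr1 (fun f => fcoef f 0) (op_string orth orthS).
rewrite fcoefB !fcoef_natM fcoefXM mulr0 subr0 h0 => <-.
by rewrite factS natrM.
Qed.

Lemma opn_neq0 n : fcoef (opn n) 0 != 0.
Proof. by rewrite (op_orthP n).2 pnatr_eq0 -lt0n fact_gt0. Qed.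

Lemma opnS n : opn n.+1 = opr n.+1 * opn n.
Proof. by rewrite /opr -mulrA (mulrC (fps_inv _)) mul_fps_inv ?mulr1 ?opn_neq0. Qed.

Lemma lmom_opM n m : lmom (op n * op m) = if n == m then opn n else 0.
Proof.
wlog nm : n m / (n <= m)%N.
  move=> W; case: (leqP n m) => [/W //|/ltnW/W]; rewrite mulrC eq_sym => ->.
  by case: eqP => // ->.
have [s0 l0] := op_size n.
rewrite (op_orth_coef (op_orthP m).1) ?s0 //; case: eqP => [<-|/eqP nm'].
  by move: l0; rewrite lead_coefE s0 /= => ->; rewrite mul1r.
by rewrite nth_default ?mul0r // s0 ltn_neqAle nm'.
Qed.

Definition opA k n m : A := lmom ('X^k * (op n * op m)).

Lemma opAS k n m : opA k.+1 n m = opA k n.+1 m + opr n * opA k n.-1 m.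
Proof.
rewrite /opA exprSr -mulrA ['X * _]mulrA mulX_op mulrDl mulrDr raddfD /=.
by rewrite -scalerAl -scalerAr lmomZ.
Qed.

Lemma opA0 n m : opA 0 n m = if n == m then opn n else 0.
Proof. by rewrite /opA expr0 mul1r lmom_opM. Qed.

(** The ten lattice paths of five steps up or down with net displacement one, each weighted by the
    recurrence coefficients of its descents; the common factor [r2] is taken out. *)
Definition freud_sum (r0 r1 r2 r3 r4 : A) : A :=
  r0 * r1 + r1 * r1 + 2 * (r1 * r2) + r2 * r2 + r1 * r3 + 2 * (r2 * r3) + r3 * r3 + r3 * r4.

Lemma opA5 n : opA 5 n.+3 n.+2 =
  opr n.+3 * freud_sum (opr n.+1) (opr n.+2) (opr n.+3) (opr n.+4) (opr n.+4.+1) * opn n.+2.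
Proof.
move: opr opAS => r rS; rewrite !rS /= !opA0 !eqSS eqxx.
have -> : (n.+2.+4 == n) = false by lia.
have -> : (n.+4 == n) = false by lia.
have -> : (n.+2 == n) = false by lia.
have -> : (n == n.+2) = false by lia.
have -> : (n.-1 == n.+1) = false by lia.
have -> : (n.-2 == n.+2) = false by lia.
by rewrite /freud_sum; ring.
Qed.

(** [op_string] divided by the norm [opn n.+2]. Starting at index 3 keeps all five indices positive;
    only large indices are used below. *)
Lemma freud_equation n :
  opr n.+3 = n.+3%:R + 6 * (t * (opr n.+3 *
    freud_sum (opr n.+1) (opr n.+2) (opr n.+3) (opr n.+4) (opr n.+4.+1))).
Proof.
apply: (@fps_mulIf _ (opn n.+2)); first exact: opn_neq0.
have := op_string (op_orthP n.+2).1 (op_orthP n.+3).1.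
rewrite -/(opA 5 n.+3 n.+2) opA5 (opnS n.+2).
move: (opn _) (opr n.+3) (freud_sum _ _ _ _ _) => h r S E.
by rewrite mulrDr [_ * n.+3%:R]mulrC E; ring.
Qed.

(** The unitriangular matrix of coefficients of the orthogonal polynomials diagonalises the Hankel
    form. *)
Lemma det_hankel N : \det (\matrix_(i < N, k < N) momt (i + k)) = \prod_(i < N) opn i.
Proof.
set Hm := matrix_of_fun _ _.
pose C : 'M[A]_N := \matrix_(i, k) (op i)`_k.
have CHC : C *m Hm *m C^T = diag_mx (\row_i opn i).
  apply/matrixP => i m; rewrite !mxE.
  transitivity (lmom (op i * op m)); last first.
    by rewrite lmom_opM -val_eqE; case: eqP => // _; rewrite mulr0n.
  rewrite (lmomM (n := N) (m := N)) ?(op_size _).1 // exchange_big.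
  apply: eq_bigr => k' _; rewrite !mxE mulr_suml; apply: eq_bigr => k _.
  by rewrite !mxE.
have detC : \det C = 1.
  rewrite det_trig; last first.
    apply/is_trig_mxP => i k ik; rewrite mxE nth_default // (op_size i).1.
    exact: ik.
  rewrite big1 // => i _; rewrite mxE; have [si li] := op_size i.
  by move: li; rewrite lead_coefE si.
have := congr1 determinant CHC; rewrite !det_mulmx det_tr detC mul1r mulr1 det_diag => ->.
by apply: eq_bigr => i _; rewrite mxE.
Qed.

End OrthogonalPolynomials.
End OrthoPoly.
Import OrthoPoly.

Arguments opr : simpl never.

(** * The matrix integral as a Hankel determinant *)

Module HankelModel.
Import fingroup perm ssrcomplements mpoly Gauss MatrixModel.

Lemma fcoef0_prod (R : comNzRingType) (I : Type) (r : seq I) (P : pred I) (F : I -> fps R) :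
  fcoef (\prod_(i <- r | P i) F i) 0 = \prod_(i <- r | P i) fcoef (F i) 0.
Proof. by elim/big_rec2: _ => [|i x y _ <-]; rewrite ?fcoef1 ?fcoefM0. Qed.

Lemma theta_momt k : theta (momt k) = fpsX rat * momt (k + 6).
Proof.
apply: fpsP => -[|j]; rewrite fcoefXM {1}/fcoef /= ?mul0r // !fcoef_momt factS natrM.
have -> : (k + 6 + 6 * j = k + 6 * j.+1)%N by lia.
have j1 : j.+1%:R != 0 :> rat by rewrite pnatr_eq0.
by rewrite invfM mulrCA mulVKf.
Qed.

Section Eigenvalues.
Variable N : nat.
Local Notation P := {mpoly rat[N]}.

(** The mean of [q exp (t p_6)] over independent Gaussian eigenvalues, expanded in [t]. *)
Definition lmpoly (q : P) : fps rat :=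
  Fps (fun j => gauss id (psum N 6 ^+ j * q) / (j`!)%:R).

Lemma lmpoly_is_additive : {morph lmpoly : p q / p - q}.
Proof. by move=> p q; apply: fpsP => j; rewrite fcoefB /lmpoly /fcoef mulrBr raddfB mulrBl. Qed.
HB.instance Definition _ := GRing.isZmodMorphism.Build _ _ lmpoly lmpoly_is_additive.

Lemma lmpoly_coef q j : fcoef (lmpoly q) j = gauss id (psum N 6 ^+ j * q) / (j`!)%:R.
Proof. by []. Qed.

Lemma lmpoly_step q j :
  j.+1%:R * fcoef (lmpoly q) j.+1 = fcoef (lmpoly (psum N 6 * q)) j.
Proof.
rewrite !lmpoly_coef exprSr -mulrA factS natrM.
by rewrite mulrCA invfM mulVKf // pnatr_eq0.
Qed.

(** The weight factorises over the eigenvalues. The proof compares coefficients through [theta],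
    which on both sides amounts to [t] times the sum over all ways of raising one exponent by
    six. *)
Lemma lmpoly_monom (m : 'X_{1..N}) : lmpoly 'X_[m] = \prod_(i < N) momt (m i).
Proof.
apply: fpsP => j; elim: j m => [|j IH] m.
  rewrite lmpoly_coef expr0 mul1r fact0 divr1 fcoef0_prod gaussX.
  apply: eq_bigr => i _; rewrite fcoef_momt fact0 divr1 muln0 addn0.
  by rewrite /gfac eqxx.
have j1 : j.+1%:R != 0 :> rat by rewrite pnatr_eq0.
apply: (mulfI j1); rewrite lmpoly_step.
have -> : psum N 6 * 'X_[m] = \sum_(i < N) 'X_[(m + U_(i) *+ 6)%MM].
  by rewrite mulr_suml; apply: eq_bigr => i _; rewrite mpolyXD mpolyXn mulrC.
rewrite raddf_sum fcoef_sum.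
transitivity (fcoef (theta (\prod_(i in [set: 'I_N]) momt (m i))) j.+1); last first.
  rewrite {1}/fcoef /=; congr (_ * fcoef _ _).
  by apply: eq_bigl => i; rewrite inE.
rewrite (Wick.derivation_prod_set _ _ (theta1 _) (@thetaM _)) fcoef_sum.
apply: eq_big => [i|i _]; first by rewrite inE.
rewrite IH theta_momt -mulrA fcoefXM; congr (fcoef _ _).
rewrite (bigD1 i) //= mnmDE mulmnE mnm1E eqxx mul1n; congr (_ * _).
apply: eq_big => [k|k ki]; first by rewrite !inE andbT.
by rewrite mnmDE mulmnE mnm1E eq_sym (negPf ki) addn0.
Qed.

Lemma vdm_det : vdm N = \sum_(s : 'S_N) (-1) ^+ s * 'X_[[multinom val (s i) | i < N]].
Proof.
transitivity (\det (Vandermonde N (\row_i ('X_i : P)))).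
  rewrite det_Vandermonde pair_big_dep /=; apply: eq_bigr => -[i k] _ /=.
  by rewrite !mxE.
rewrite -det_tr; apply: eq_bigr => s _; congr (_ * _).
by rewrite mpolyXE_id; apply: eq_bigr => i _; rewrite !mxE mnmE.
Qed.

(** Heine's formula: in the product of the two expanded determinants, the term of [(s, s')] depends
    only on [s^-1 * s'], so the Hankel determinant appears [N!] times. *)
Lemma lmpoly_vdm : lmpoly (vdm N ^+ 2) = N`!%:R * \prod_(i < N) opn i.
Proof.
rewrite -det_hankel expr2 !vdm_det big_distrlr raddf_sum /=.
rewrite -(card_Sn N) -sum1_card natr_sum mulr_suml.
apply: eq_bigr => s _; rewrite mul1r raddf_sum /determinant /=.
rewrite [RHS](reindex_inj (mulgI s^-1)%g); apply: eq_bigr => s' _.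
have -> : (-1) ^+ s * 'X_[[multinom val (s i) | i < N]] *
     ((-1) ^+ s' * 'X_[[multinom val (s' i) | i < N]]) =
   (-1) ^+ (s^-1 * s')%g *
     'X_[[multinom val (s i) | i < N] + [multinom val (s' i) | i < N]] :> P.
  by rewrite mpolyXD odd_permM odd_permV signr_addb mulrACA.
have sgn (b : bool) (q : P) : lmpoly ((-1) ^+ b * q) = (-1) ^+ b * lmpoly q.
  by case: b; rewrite ?expr1 ?expr0 ?mul1r // !mulN1r raddfN.
rewrite sgn lmpoly_monom; congr (_ * _).
rewrite (reindex_inj (@perm_inj _ s^-1%g)); apply: eq_bigr => i _.
by rewrite mxE mnmDE !mnmE permKV permM.
Qed.

End Eigenvalues.
End HankelModel.

(** * The Toda equation *)

Module Toda.
Import ssrcomplements mpoly Gauss MatrixModel Colorings HankelModel.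

(* [partition_fps N] belongs to matrices of size [N.+1]. *)
Definition partition_fps (N : nat) : fps rat :=
  Fps (fun j => trace_moment N 5 j / (j`!)%:R).

Lemma partition_fps0 N : fcoef (partition_fps N) 0 = 1.
Proof. by rewrite /partition_fps /fcoef /trace_moment expr0 gauss1 fact0 divr1. Qed.

Lemma partition_fps_hankel N : exists2 c : rat, c != 0 &
  N.+1`!%:R * \prod_(i < N.+1) opn i = fpsC c * partition_fps N.
Proof.
pose c := gauss id (vdm N.+1 ^+ 2).
have E : N.+1`!%:R * \prod_(i < N.+1) opn i = fpsC c * partition_fps N.
  rewrite -lmpoly_vdm; apply: fpsP => j.
  rewrite fcoefCM lmpoly_coef {1}/fcoef /= [RHS]mulrA; congr (_ / _).
  have := gmean_eigen_mean N (nseq j 6).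
  by rewrite /eigen_mean !big_nseq !iter_mulr_1 /trace_moment mulrC => ->.
exists c => //; apply/eqP => c0.
have := congr1 (fun f => fcoef f 0) E; rewrite fcoefCM c0 mul0r fcoef_natM.
rewrite fcoef0_prod => /eqP; apply/negP.
rewrite mulf_neq0 ?pnatr_eq0 -?lt0n ?fact_gt0 //.
by apply/prodf_neq0 => i _; apply: opn_neq0.
Qed.

Definition tau (N : nat) : fps rat := theta (partition_fps N) * fps_inv (partition_fps N).

Lemma tauE N : theta (partition_fps N) = tau N * partition_fps N.
Proof.
by rewrite /tau -mulrA (mulrC (fps_inv _)) mul_fps_inv ?mulr1 // partition_fps0 oner_neq0.
Qed.

Lemma tau_opn_prod N :
  theta (\prod_(i < N.+1) opn i) = tau N * \prod_(i < N.+1) opn i.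
Proof.
have [c c0 E] := partition_fps_hankel N.
have fN : fcoef (N.+1`!%:R : fps rat) 0 != 0.
  by rewrite fcoef_nat /= pnatr_eq0 -lt0n fact_gt0.
apply: (fps_mulIf fN); rewrite mulrCA E.
transitivity (theta (N.+1`!%:R * \prod_(i < N.+1) opn i)).
  by rewrite thetaM theta_nat mul0r add0r.
by rewrite E thetaM thetaC mul0r add0r tauE mulrCA.
Qed.

Lemma tau_opn N : theta (opn N.+1) = (tau N.+1 - tau N) * opn N.+1.
Proof.
have := tau_opn_prod N.+1; rewrite big_ord_recr /= thetaM tau_opn_prod.
move: (\prod_(i < N.+1) opn i) (tau_opn_prod N) (fcoef0_prod (index_enum 'I_N.+1) xpredT (fun i => opn i)).
move=> G _ G0 E.
have Gn0 : fcoef G 0 != 0.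
  by rewrite G0; apply/prodf_neq0 => i _; apply: opn_neq0.
apply: (fps_mulIf Gn0).
have -> : G * theta (opn N.+1) = tau N * G * opn N.+1 + G * theta (opn N.+1) - tau N * G * opn N.+1.
  by ring.
by rewrite E; ring.
Qed.

(** The logarithmic derivative of the norm [opn N.+1] is a first difference of [tau]; a recurrence
    coefficient is a quotient of consecutive norms, so it gives a second difference. The central
    index [N.+1] of [tau] belongs to size [N.+2], the index of [opr]. *)
Lemma toda_equation N :
  (tau N.+2 + tau N - 2 * tau N.+1) * opr N.+2 = theta (opr N.+2).
Proof.
apply: (fps_mulIf (opn_neq0 N.+1)).
have := tau_opn N.+1; rewrite opnS thetaM tau_opn.
move: (opn N.+1) (opr N.+2) => h r E.
have -> : h * theta r = theta r * h + r * ((tau N.+1 - tau N) * h) - r * ((tau N.+1 - tau N) * h) by ring.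
by rewrite E; ring.
Qed.

End Toda.
Import Toda.

(** * Polynomiality in the size of the matrices *)

Section EventualEvaluation.
Local Notation Q := (fps {poly rat}).
Implicit Types (F G : nat -> fps rat) (f g : Q).

(* [f] is the family of power series [F N] with coefficients viewed as
   polynomials in [N]; agreement is required only for large [N]. *)
Definition interpolates F f := forall j, exists N0, forall N, (N0 <= N)%N ->
  fcoef (F N) j = (fcoef f j).[N%:R].

Lemma interpolates_bound F f j : interpolates F f -> exists N0, forall N i,
  (N0 <= N)%N -> (i <= j)%N -> fcoef (F N) i = (fcoef f i).[N%:R].
Proof.
move=> Ff; elim: j => [|j [N1 H1]].
  by have [N0 H] := Ff 0%N; exists N0 => N i NN; rewrite leqn0 => /eqP ->; exact: H.
have [N2 H2] := Ff j.+1; exists (maxn N1 N2) => N i; rewrite geq_max => /andP[NN1 NN2].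
by rewrite leq_eqVlt => /orP[/eqP ->|]; [exact: H2|exact: H1].
Qed.

Lemma poly_eq_large (p q : {poly rat}) N0 :
  (forall N, (N0 <= N)%N -> p.[N%:R] = q.[N%:R]) -> p = q.
Proof.
move=> H; apply/eqP; rewrite -subr_eq0; apply/eqP.
apply: (@roots_geq_poly_eq0 _ _ [seq (N0 + i)%:R | i <- iota 0 (size (p - q)%R)]).
- by apply/allP => x /mapP[i _ ->]; rewrite /root hornerD hornerN H ?leq_addr // subrr.
- rewrite map_inj_uniq ?iota_uniq // => i k /eqP; rewrite eqr_nat => /eqP.
  exact: addnI.
- by rewrite size_map size_iota.
Qed.

(** A polynomial is determined by its values at large integers. Recurrences in [N] thus turn into
    identities between series over [{poly rat}]. *)
Lemma interpolates_uniq F f g : interpolates F f -> interpolates F g -> f = g.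
Proof.
move=> Ff Fg; apply: fpsP => j; have [N1 H1] := Ff j; have [N2 H2] := Fg j.
apply: (@poly_eq_large _ _ (maxn N1 N2)) => N; rewrite geq_max => /andP[NN1 NN2].
by rewrite -H1 // -H2.
Qed.

Lemma eq_interpolates F G f : (forall N, F N = G N) -> interpolates F f -> interpolates G f.
Proof. by move=> FG Ff j; have [N0 H] := Ff j; exists N0 => N /H; rewrite FG. Qed.

Lemma interpolatesD F G f g : interpolates F f -> interpolates G g ->
  interpolates (fun N => F N + G N) (f + g).
Proof.
move=> Ff Gg j; have [N1 H1] := Ff j; have [N2 H2] := Gg j.
exists (maxn N1 N2) => N; rewrite geq_max => /andP[NN1 NN2].
by rewrite !fcoefD hornerD H1 // H2.
Qed.

Lemma interpolatesN F f : interpolates F f -> interpolates (fun N => - F N) (- f).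
Proof.
move=> Ff j; have [N1 H1] := Ff j; exists N1 => N NN.
by rewrite !fcoefN hornerN H1.
Qed.

Lemma interpolatesM F G f g : interpolates F f -> interpolates G g ->
  interpolates (fun N => F N * G N) (f * g).
Proof.
move=> Ff Gg j; have [N1 H1] := interpolates_bound j Ff.
have [N2 H2] := interpolates_bound j Gg.
exists (maxn N1 N2) => N; rewrite geq_max => /andP[NN1 NN2].
rewrite !fcoefM horner_sum; apply: eq_bigr => i _.
have ij : (i <= j)%N by rewrite -ltnS.
by rewrite hornerM H1 // H2 // leq_subr.
Qed.

Lemma interpolates_natr n : interpolates (fun=> n%:R) n%:R.
Proof.
move=> j; exists 0%N => N _; rewrite !fcoef_nat; case: ifP => _; last by rewrite horner0.
by rewrite -polyC_natr hornerC.
Qed.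

Lemma interpolates_fpsX : interpolates (fun=> fpsX rat) (fpsX {poly rat}).
Proof.
move=> j; exists 0%N => N _; rewrite /fpsX /fcoef.
by rewrite -polyC_natr hornerC.
Qed.

Lemma interpolates_theta F f : interpolates F f ->
  interpolates (fun N => theta (F N)) (theta f).
Proof.
move=> Ff j; have [N0 H] := Ff j; exists N0 => N NN.
by rewrite {1}/fcoef /= H // {2}/fcoef /= hornerM -polyC_natr hornerC.
Qed.

Definition fps_shift (c : rat) f : Q := Fps (fun j => fcoef f j \Po ('X + c%:P)).

Lemma fps_shift_coef c f j : fcoef (fps_shift c f) j = fcoef f j \Po ('X + c%:P).
Proof. by []. Qed.

Lemma fps_shiftD c f g : fps_shift c (f + g) = fps_shift c f + fps_shift c g.
Proof. by apply: fpsP => j; rewrite fcoefD !fps_shift_coef fcoefD comp_polyD. Qed.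

Lemma fps_shiftN c f : fps_shift c (- f) = - fps_shift c f.
Proof. by apply: fpsP => j; rewrite fcoefN !fps_shift_coef fcoefN raddfN. Qed.

Lemma fps_shiftM c f g : fps_shift c (f * g) = fps_shift c f * fps_shift c g.
Proof.
apply: fpsP => j; rewrite fcoefM fps_shift_coef fcoefM raddf_sum; apply: eq_bigr => i _.
by rewrite /= comp_polyM.
Qed.

Lemma fps_shift_nat c n : fps_shift c n%:R = n%:R.
Proof.
apply: fpsP => j; rewrite fps_shift_coef !fcoef_nat; case: ifP => _; last by rewrite comp_poly0.
by rewrite -polyC_natr comp_polyC.
Qed.

Lemma fps_shift_fpsX c : fps_shift c (fpsX _) = fpsX _.
Proof. by apply: fpsP => j; rewrite fps_shift_coef /fpsX /fcoef -polyC_natr comp_polyC. Qed.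

Lemma fps_shift_theta c f : fps_shift c (theta f) = theta (fps_shift c f).
Proof.
apply: fpsP => j; rewrite fps_shift_coef /theta {1 3}/fcoef fps_shift_coef.
by rewrite comp_polyM -polyC_natr comp_polyC.
Qed.

Lemma fps_shift_comp c d f : fps_shift c (fps_shift d f) = fps_shift (c + d) f.
Proof.
apply: fpsP => j; rewrite !fps_shift_coef -comp_polyA; congr (_ \Po _).
by rewrite comp_polyD comp_polyX comp_polyC polyCD; ring.
Qed.

Lemma fps_shift0 f : fps_shift 0 f = f.
Proof. by apply: fpsP => j; rewrite fps_shift_coef addr0 comp_polyXr. Qed.

Lemma interpolates_shift F f s : interpolates F f ->
  interpolates (fun N => F (N + s)%N) (fps_shift s%:R f).
Proof.
move=> Ff j; have [N0 H] := Ff j; exists N0 => N NN.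
rewrite H; last by rewrite (leq_trans NN) // leq_addr.
by rewrite fps_shift_coef horner_comp !hornerE natrD.
Qed.

End EventualEvaluation.

Section DegreeBound.
Implicit Types (f g : fps {poly rat}).

Definition deg_bound d f := forall j, (size (fcoef f j) <= 2 * j + d + 1)%N.

Lemma size_polyM_leq (p q : {poly rat}) a b :
  (size p <= a.+1)%N -> (size q <= b.+1)%N -> (size (p * q)%R <= (a + b).+1)%N.
Proof.
move=> pa qb; apply: leq_trans (size_polyMleq _ _) _.
by move: pa qb; lia.
Qed.

End DegreeBound.

(** Polynomiality with its degree bound, but only for coefficients below [t ^ k]: the induction for
    [opr] gains one power of [t] at a time. *)
Definition evp d k (F : nat -> fps rat) := forall j, (j < k)%N ->
  exists p : {poly rat}, (size p <= 2 * j + d + 1)%N /\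
    exists N0, forall N, (N0 <= N)%N -> fcoef (F N) j = p.[N%:R].

Lemma evpD d k F G : evp d k F -> evp d k G -> evp d k (fun N => F N + G N).
Proof.
move=> HF HG j jk; have [p [sp [N1 H1]]] := HF j jk; have [q [sq [N2 H2]]] := HG j jk.
exists (p + q); split; first by rewrite (leq_trans (size_polyD _ _)) // geq_max sp.
exists (maxn N1 N2) => N; rewrite geq_max => /andP[NN1 NN2].
by rewrite fcoefD hornerD H1 // H2.
Qed.

Lemma eventually_sum n (F : nat -> nat -> rat) (p : nat -> {poly rat}) :
  (forall i, (i < n)%N -> exists N0, forall N, (N0 <= N)%N -> F N i = (p i).[N%:R]) ->
  exists N0, forall N, (N0 <= N)%N -> \sum_(i < n) F N i = (\sum_(i < n) p i).[N%:R].
Proof.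
elim: n => [|n IH] H; first by exists 0%N => N _; rewrite !big_ord0 horner0.
have [|N1 H1] := IH; first by move=> i /ltnW; apply: H.
have [N2 H2] := H n (ltnSn n).
exists (maxn N1 N2) => N; rewrite geq_max => /andP[NN1 NN2].
by rewrite !big_ord_recr /= hornerD H1 // H2.
Qed.

Lemma evpM d e k F G : evp d k F -> evp e k G -> evp (d + e)%N k (fun N => F N * G N).
Proof.
move=> HF HG j jk.
have /choice[p Hp] : forall i, exists p : {poly rat}, (i < k)%N ->
    (size p <= 2 * i + d + 1)%N /\
    exists N0, forall N, (N0 <= N)%N -> fcoef (F N) i = p.[N%:R].
  by move=> i; have [/HF [p' Hp']|_] := ltnP i k; [exists p'|exists 0].
have /choice[q Hq] : forall i, exists p : {poly rat}, (i < k)%N ->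
    (size p <= 2 * i + e + 1)%N /\
    exists N0, forall N, (N0 <= N)%N -> fcoef (G N) i = p.[N%:R].
  by move=> i; have [/HG [p' Hp']|_] := ltnP i k; [exists p'|exists 0].
exists (\sum_(i < j.+1) p i * q (j - i)%N); split.
  apply: (leq_trans (size_sum _ _ _)); apply/bigmax_leqP => i _.
  have ij : (i <= j)%N by rewrite -ltnS.
  have [sp _] := Hp i (leq_ltn_trans ij jk).
  have [sq _] := Hq (j - i)%N (leq_ltn_trans (leq_subr _ _) jk).
  have -> : (2 * j + (d + e) + 1 = (2 * i + d + (2 * (j - i) + e)).+1)%N by move: ij; lia.
  by apply: size_polyM_leq; rewrite -[leqRHS]addn1.
apply: (@eventually_sum j.+1 (fun N i => fcoef (F N) i * fcoef (G N) (j - i)%N)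
   (fun i => p i * q (j - i)%N)) => i; rewrite ltnS => ij.
have [_ [N1 H1]] := Hp i (leq_ltn_trans ij jk).
have [_ [N2 H2]] := Hq (j - i)%N (leq_ltn_trans (leq_subr _ _) jk).
exists (maxn N1 N2) => N; rewrite geq_max => /andP[NN1 NN2].
by rewrite hornerM H1 // H2.
Qed.

Lemma evp_nat n k : evp 0 k (fun=> n%:R).
Proof.
move=> j _; exists (if j == 0%N then n%:R else 0); split.
  case: ifP => _; last by rewrite size_poly0.
  by rewrite -polyC_natr (leq_trans (size_polyC_leq1 _)) // addn1.
exists 0%N => N _; rewrite fcoef_nat; case: ifP => _; last by rewrite horner0.
by rewrite -polyC_natr hornerC.
Qed.

Lemma evp_natM n d k F : evp d k F -> evp d k (fun N => n%:R * F N).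
Proof. by move=> HF; apply: (@evpM 0 d k (fun=> n%:R) F) => //; apply: evp_nat. Qed.

Lemma evp_shift d k F s : evp d k F -> evp d k (fun N => F (N + s)%N).
Proof.
move=> HF j jk; have [p [sp [N1 H1]]] := HF j jk.
exists (p \Po ('X + s%:R%:P)); split; first by rewrite size_comp_poly2 // size_XaddC.
exists N1 => N NN; rewrite H1; last by rewrite (leq_trans NN) // leq_addr.
by rewrite horner_comp !hornerE natrD.
Qed.

Lemma evp_unshift d k F s : evp d k (fun N => F (N + s)%N) -> evp d k F.
Proof.
move=> HF j jk; have [p [sp [N1 H1]]] := HF j jk.
exists (p \Po ('X - s%:R%:P)); split; first by rewrite size_comp_poly2 // size_XsubC.
exists (N1 + s)%N => N NN.
have sN : (s <= N)%N by apply: leq_trans NN; apply: leq_addl.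
rewrite -{1}(subnK sN) H1; last by rewrite leq_subRL // addnC.
by rewrite horner_comp !hornerE natrB.
Qed.

(** In the Freud equation the nonlinear term carries a factor [t], so lower coefficients determine
    the next one. That term has degree offset 3, and the factor [t] absorbs two of it, which
    restores offset 1. *)
Lemma opr_evp k : evp 1 k opr.
Proof.
elim: k => [|k IH] j; first by [].
rewrite ltnS => jk; apply: (@evp_unshift 1 j.+1 opr 3) => //.
have IH2 s : evp 1 k (fun N => opr (N + s)) by apply: evp_shift.
have S2 : evp 2 k (fun n => freud_sum (opr (n + 1)) (opr (n + 2)) (opr (n + 3))
    (opr (n + 4)) (opr (n + 5))).
  rewrite /freud_sum; do 7?[apply: evpD]; try exact: (evpM (IH2 _) (IH2 _)).
    by apply: evp_natM; exact: (evpM (IH2 _) (IH2 _)).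
  by apply: evp_natM; exact: (evpM (IH2 _) (IH2 _)).
have S3 := evp_natM 6 (evpM (IH2 3%N) S2).
move=> [|i] ij.
  exists ('X + 3%:R%:P); split; first by rewrite size_XaddC.
  exists 0%N => N _; rewrite !addn3 freud_equation fcoefD fcoef_nat /=.
  by rewrite fcoef_natM fcoefXM mulr0 addr0 hornerD hornerX hornerC -natrD addn3.
have ik : (i < k)%N by move: ij jk; lia.
have [p [sp [N0 H0]]] := S3 i ik.
exists p; split; first by apply: leq_trans sp _; lia.
exists N0 => N NN; rewrite addn3 freud_equation fcoefD fcoef_nat /= add0r.
rewrite fcoef_natM fcoefXM -H0 // fcoef_natM.
by rewrite !(addnS, addn0).
Qed.

Lemma rho_exists : exists rho : fps {poly rat}, deg_bound 1 rho /\ interpolates opr rho.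
Proof.
have /choice[p Hp] : forall j, exists p : {poly rat}, (size p <= 2 * j + 1 + 1)%N /\
    exists N0, forall N, (N0 <= N)%N -> fcoef (opr N) j = p.[N%:R].
  by move=> j; apply: (opr_evp (ltnSn j)).
by exists (Fps p); split=> j; have [] := Hp j.
Qed.

Definition freud_sumP (f : fps {poly rat}) : fps {poly rat} :=
  let s c := fps_shift c f in
  s (-2) * s (-1) + s (-1) * s (-1) + 2 * (s (-1) * s 0) + s 0 * s 0 + s (-1) * s 1
  + 2 * (s 0 * s 1) + s 1 * s 1 + s 1 * s 2.

Lemma freud_polynomial (rho : fps {poly rat}) : interpolates opr rho ->
  rho = fpsC 'X + 6 * (fpsX _ * (rho * freud_sumP rho)).
Proof.
move=> Hr; have sh s := interpolates_shift s Hr.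
have H3 := sh 3%N.
have E : interpolates (fun N => opr (N + 3))
  (fpsC ('X + 3%:P) + 6 * (fpsX _ * (fps_shift 3 rho *
   (fps_shift 1 rho * fps_shift 2 rho + fps_shift 2 rho * fps_shift 2 rho
    + 2 * (fps_shift 2 rho * fps_shift 3 rho) + fps_shift 3 rho * fps_shift 3 rho
    + fps_shift 2 rho * fps_shift 4 rho + 2 * (fps_shift 3 rho * fps_shift 4 rho)
    + fps_shift 4 rho * fps_shift 4 rho + fps_shift 4 rho * fps_shift 5 rho)))).
  apply: (@eq_interpolates (fun N => (N + 3)%:R + 6 * (fpsX rat * (opr (N + 3) *
    freud_sum (opr (N + 1)) (opr (N + 2)) (opr (N + 3)) (opr (N + 4)) (opr (N + 5)))))).
    by move=> N; rewrite !(addnS, addn0) [RHS]freud_equation.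
  apply: interpolatesD.
    move=> j; exists 0%N => N _; rewrite fcoef_nat {1}/fcoef /=.
    by case: ifP => _; rewrite ?horner0 // hornerD hornerX hornerC natrD.
  apply: (interpolatesM (interpolates_natr 6)); apply: (interpolatesM interpolates_fpsX).
  apply: interpolatesM => //; rewrite /freud_sum.
  do 7?[apply: interpolatesD]; try exact: (interpolatesM (sh _) (sh _)).
    exact: (interpolatesM (interpolates_natr 2) (interpolatesM (sh _) (sh _))).
  exact: (interpolatesM (interpolates_natr 2) (interpolatesM (sh _) (sh _))).
(* Shifting back centres the equation at [rho]. *)
have := congr1 (fps_shift (-3)) (interpolates_uniq H3 E).
rewrite !(fps_shiftD, fps_shiftM, fps_shift_nat, fps_shift_fpsX, fps_shift_comp).
rewrite addNr fps_shift0 /freud_sumP fps_shift0 => {1}->.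
congr (_ + _).
  apply: fpsP => j; rewrite fps_shift_coef /fcoef /=; case: ifP => _; last by rewrite comp_poly0.
  by rewrite comp_polyD comp_polyX comp_polyC -addrA -polyCD addNr addr0.
Qed.

(** * Expansion at large matrix size *)

Module LargeSize.
Section Expansion.
Implicit Types (f g : fps {poly rat}) (p q : {poly rat}).

(** The reversed polynomial: [p x = x ^ D * revp D p (1 / (2 x))] when the degree of [p] is at most
    [D]. *)
Definition revp (D : nat) p : {poly rat} := \poly_(n < D.+1) (p`_(D - n) * 2 ^+ n).

Lemma coef_revp D p n : (revp D p)`_n = if (n <= D)%N then p`_(D - n) * 2 ^+ n else 0.
Proof. by rewrite coef_poly ltnS. Qed.

Lemma revp_is_additive D : {morph revp D : p q / p - q}.
Proof.
move=> p q; apply/polyP => n; rewrite coefB !coef_revp.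
by case: ifP => _; rewrite ?coefB ?subr0 ?mulrBl.
Qed.
HB.instance Definition _ D := GRing.isZmodMorphism.Build _ _ (revp D) (revp_is_additive D).

Lemma revpZ D c p : revp D (c *: p) = c *: revp D p.
Proof.
by apply/polyP => n; rewrite coefZ !coef_revp; case: ifP => _; rewrite ?coefZ ?mulr0 ?mulrA.
Qed.

Lemma revpXn D k : (k <= D)%N -> revp D 'X^k = 2 ^+ (D - k) *: 'X^(D - k).
Proof.
move=> kD; apply/polyP => n; rewrite coef_revp coefZ !coefXn; case: leqP => nD.
  rewrite (_ : (D - n == k)%N = (n == D - k)%N); last by apply/eqP/eqP; lia.
  by case: eqP => [->|_]; rewrite ?mul0r ?mulr0 // mulrC.
by case: eqP => [nE|_]; rewrite ?mulr0 //; move: nD; rewrite nE; lia.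
Qed.

Lemma polyE_wide n p : (size p <= n)%N -> p = \sum_(k < n) p`_k *: 'X^k.
Proof.
move=> pn; rewrite -(poly_def n (fun k => p`_k)); apply/polyP => i.
by rewrite coef_poly; case: ltnP => // /(leq_trans pn) /(nth_default 0).
Qed.

Lemma revpM D E p q : (size p <= D.+1)%N -> (size q <= E.+1)%N ->
  revp (D + E) (p * q) = revp D p * revp E q.
Proof.
move=> pD qE; rewrite (polyE_wide pD) (polyE_wide qE) !raddf_sum /= !big_distrlr.
rewrite raddf_sum; apply: eq_bigr => k _ /=; rewrite raddf_sum; apply: eq_bigr => l _ /=.
rewrite -scalerAl -scalerAr -exprD !revpZ -scalerAl -scalerAr; congr (_ *: (_ *: _)).
have kD : (k <= D)%N by rewrite -ltnS.
have lE : (l <= E)%N by rewrite -ltnS.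
rewrite !revpXn ?leq_add // -scalerAl -scalerAr scalerA -!exprD.
by have -> : (D + E - (k + l) = D - k + (E - l))%N by lia.
Qed.

(* [V d f n] collects the coefficients of [x ^ (2 j + d - n)] in the
   coefficient of [t ^ j], i.e. the contributions of order [n] below the leading
   one.  The factor [2 ^ n] makes all closed forms below integral in [2 u]. *)
Definition V (d : nat) f : fps (fps rat) :=
  Fps (fun n => Fps (fun j => (revp (2 * j + d) (fcoef f j))`_n)).

Lemma V_coef d f n j : fcoef (fcoef (V d f) n) j = (revp (2 * j + d) (fcoef f j))`_n.
Proof. by []. Qed.

Lemma deg_boundM d e f g : deg_bound d f -> deg_bound e g -> deg_bound (d + e)%N (f * g).
Proof.
move=> fd ge j; rewrite fcoefM; apply: (leq_trans (size_sum _ _ _)).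
apply/bigmax_leqP => i _; have ij : (i <= j)%N by rewrite -ltnS.
have -> : (2 * j + (d + e) + 1 = (2 * i + d + (2 * (j - i) + e)).+1)%N by move: ij; lia.
by apply: size_polyM_leq; rewrite -[leqRHS]addn1; [exact: fd|exact: ge].
Qed.

Lemma deg_boundD d f g : deg_bound d f -> deg_bound d g -> deg_bound d (f + g).
Proof.
by move=> fd gd j; rewrite fcoefD (leq_trans (size_polyD _ _)) // geq_max fd gd.
Qed.

Lemma deg_bound_natM d n f : deg_bound d f -> deg_bound d (n%:R * f).
Proof.
move=> fd j; rewrite fcoef_natM -polyC_natr mul_polyC.
exact: leq_trans (size_scale_leq _ _) (fd j).
Qed.

Lemma deg_bound_shift d c f : deg_bound d f -> deg_bound d (fps_shift c f).
Proof. by move=> fd j; rewrite fps_shift_coef size_comp_poly2 ?size_XaddC. Qed.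

Lemma VD d f g : V d (f + g) = V d f + V d g.
Proof.
apply: fpsP => n; apply: fpsP => j; rewrite !(fcoefD, V_coef).
by rewrite raddfD coefD.
Qed.

Lemma V_natM d m f : V d (m%:R * f) = m%:R * V d f.
Proof.
apply: fpsP => n; apply: fpsP => j; rewrite !(fcoef_natM, V_coef).
by rewrite -polyC_natr mul_polyC revpZ coefZ.
Qed.

Lemma VM d e f g : deg_bound d f -> deg_bound e g -> V (d + e)%N (f * g) = V d f * V e g.
Proof.
move=> fd ge; apply: fpsP => n; apply: fpsP => j; rewrite V_coef !fcoefM.
rewrite raddf_sum coef_sum fcoef_sum.
under [RHS]eq_bigr => i _ do rewrite fcoefM.
rewrite [RHS]exchange_big /=; apply: eq_bigr => a _.
have aj : (a <= j)%N by rewrite -ltnS.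
have -> : (2 * j + (d + e) = 2 * a + d + (2 * (j - a) + e))%N by move: aj; lia.
by rewrite revpM ?coefM // -[leqRHS]addn1; [exact: fd|exact: ge].
Qed.

Lemma V_theta d f n : fcoef (V d (theta f)) n = theta (fcoef (V d f) n).
Proof.
apply: fpsP => j; rewrite V_coef /theta {1}/fcoef [RHS]/fcoef V_coef.
by rewrite -polyC_natr mul_polyC revpZ coefZ.
Qed.

Lemma V_fpsX d f n : fcoef (V d (fpsX _ * f)) n = fpsX _ * fcoef (V (d + 2) f) n.
Proof.
apply: fpsP => -[|j]; rewrite V_coef !fcoefXM; first by rewrite raddf0 coef0.
by rewrite V_coef; congr (revp _ _)`_n; lia.
Qed.

(** Replacing [x] by [x + c] in [x ^ (2 j + d - m)] gives this binomial coefficient in front of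
    [c ^ k], so order [m] feeds order [m + k]. *)
Definition binom_op (d m k : nat) (h : fps rat) : fps rat :=
  Fps (fun j => ('C(2 * j + d - m, k))%:R * fcoef h j).

Lemma comp_polyXaddC_coef p c i n : (size p <= n)%N ->
  (p \Po ('X + c%:P))`_i = \sum_(k < n) p`_k * (('C(k, i))%:R * c ^+ (k - i)).
Proof.
move=> pn; rewrite {1}(polyE_wide pn) raddf_sum coef_sum; apply: eq_bigr => k _ /=.
rewrite comp_polyZ coefZ comp_Xn_poly addrC exprDn coef_sum; congr (_ * _).
have [ik|ki] := leqP i k; last first.
  rewrite bin_small // mul0r big1 // => l _.
  rewrite coefMn -polyC_exp coefCM coefXn; have lk := ltn_ord l.
  by case: eqP => [il|_]; rewrite ?mulr0 ?mul0rn //; move: lk; rewrite -il; lia.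
have ik' : (i < k.+1)%N by [].
rewrite (bigD1 (Ordinal ik')) //= big1 ?addr0 => [|l li].
  by rewrite coefMn -polyC_exp coefCM coefXn eqxx mulr1 mulr_natl.
rewrite coefMn -polyC_exp coefCM coefXn; case: eqP => [il|_]; last by rewrite mulr0 mul0rn.
by move: li; rewrite -val_eqE /= -il eqxx.
Qed.

Lemma V_shift d c f n : deg_bound d f ->
  fcoef (V d (fps_shift c f)) n =
  \sum_(m < n.+1) fpsC ((2 * c) ^+ (n - m)) * binom_op d m (n - m) (fcoef (V d f) m).
Proof.
move=> fd; apply: fpsP => j; rewrite fcoef_sum V_coef coef_revp.
set D := (2 * j + d)%N; have sD : (size (fcoef f j) <= D.+1)%N by rewrite -addn1 fd.
under [RHS]eq_bigr => m _.
  rewrite fcoefCM {1}/fcoef /= V_coef -/D coef_revp; over.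
case: leqP => nD; last first.
  rewrite big1 // => m _; case: ifP => [mD|_]; last by rewrite !mulr0.
  by rewrite bin_small ?mul0r ?mulr0 //; have := ltn_ord m; lia.
rewrite fps_shift_coef (comp_polyXaddC_coef _ _ sD) mulr_suml.
rewrite (reindex_inj rev_ord_inj) /=.
rewrite -!(big_mkord xpredT (fun m => (fcoef f j)`_(D.+1 - m.+1) *
  ('C(D.+1 - m.+1, D - n)%:R * c ^+ (D.+1 - m.+1 - (D - n))) * 2 ^+ n)).
rewrite (big_cat_nat _ (n := n.+1)) //= [X in _ + X]big_nat [X in _ + X]big1 ?addr0 => [|m /andP[nm mD]].
  rewrite big_mkord; apply: eq_bigr => m _; have mn : (m <= n)%N by rewrite -ltnS.
  rewrite subSS (leq_trans mn nD).
  have -> : (D - m - (D - n) = n - m)%N by lia.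
  have -> : 'C(D - m, D - n) = 'C(D - m, n - m).
    by rewrite -bin_sub; [congr 'C(_, _); lia|lia].
  have -> : 2 ^+ n = 2 ^+ (n - m) * 2 ^+ m :> rat by rewrite -exprD subnK.
  by rewrite exprMn; ring.
by rewrite bin_small ?mul0r ?mulr0 ?mul0r //; lia.
Qed.

Lemma binom_op_coef d m k h j :
  fcoef (binom_op d m k h) j = ('C(2 * j + d - m, k))%:R * fcoef h j.
Proof. by []. Qed.

Lemma theta_coef (R : comNzRingType) (f : fps R) n : fcoef (theta f) n = n%:R * fcoef f n.
Proof. by []. Qed.

Lemma binom_op0 d m h : binom_op d m 0 h = h.
Proof. by apply: fpsP => j; rewrite /binom_op /fcoef /= bin0 mul1r. Qed.

(** [(k + 1) C(y, k + 1) = (y - k) C(y, k)] with [y = 2 j + d - m], where multiplication by [j] is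
    [theta]. Where [y] would be negative, the coefficient of [V d f] vanishes. *)
Lemma binom_opS d m k f :
  k.+1%:R * binom_op d m k.+1 (fcoef (V d f) m) =
  2 * theta (binom_op d m k (fcoef (V d f) m))
   + (fpsC (d%:R - m%:R - k%:R)) * binom_op d m k (fcoef (V d f) m).
Proof.
apply: fpsP => j; rewrite fcoefD !fcoef_natM fcoefCM theta_coef !binom_op_coef V_coef coef_revp.
case: leqP => mD; last by rewrite !mulr0 addr0.
rewrite !mulrA -!mulrDl; congr (_ * _).
have E : k.+1%:R * 'C(2 * j + d - m, k.+1)%:R =
    (2 * j%:R + (d%:R - m%:R - k%:R)) * ('C(2 * j + d - m, k))%:R :> rat.
  rewrite -natrM mul_bin_left natrM.
  have [kD|kD] := leqP k (2 * j + d - m); last by rewrite bin_small // !mulr0.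
  rewrite natrB // natrB // natrD natrM; ring.
by rewrite E; ring.
Qed.

End Expansion.
End LargeSize.
Import LargeSize.

(** * The three leading orders *)

Definition delta (f : fps rat) : fps rat := 2 * theta f.

Lemma deltaD f g : delta (f + g) = delta f + delta g.
Proof. by rewrite /delta thetaD mulrDr. Qed.
Lemma deltaN f : delta (- f) = - delta f.
Proof. by rewrite /delta thetaN mulrN. Qed.
Lemma deltaM f g : delta (f * g) = delta f * g + f * delta g.
Proof. by rewrite /delta thetaM; ring. Qed.
Lemma deltaX f n : delta (f ^+ n.+1) = n.+1%:R * f ^+ n * delta f.
Proof. by rewrite /delta thetaX; ring. Qed.
Lemma delta_nat n : delta n%:R = 0.
Proof. by rewrite /delta theta_nat mulr0. Qed.
Lemma delta1 : delta 1 = 0. Proof. exact: (delta_nat 1). Qed.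
Definition deltaE := (deltaD, deltaN, deltaM, deltaX, delta_nat, delta1).

Lemma natr_mulI n (f g : fps rat) : n.+1%:R * f = n.+1%:R * g -> f = g.
Proof. by apply: fps_mulIf; rewrite fcoef_nat pnatr_eq0. Qed.

Section Parametrization.
Variables (z w : fps rat).
Hypothesis zE : z = 15 * (fpsX rat * (2 + z) ^+ 3).
Hypothesis zw : z * w = w - 1.

Lemma z0 : fcoef z 0 = 0.
Proof. by rewrite zE fcoef_natM fcoefXM mulr0. Qed.

Lemma one_sub_z_w : (1 - z) * w = 1.
Proof. by rewrite mulrBl zw; ring. Qed.

(** Implicit differentiation gives [2 (1 - z) theta z = z (2 + z)]. Here and below, [ring: zw]
    computes modulo [z w = w - 1]. *)
Lemma delta_z : delta z = z * (2 + z) * w.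
Proof.
have nz : fcoef ((2 + z) * (1 - z)) 0 != 0.
  by rewrite fcoefM0 fcoefD fcoefB fcoef_nat fcoef1 z0.
apply: (fps_mulIf nz).
have -> : (2 + z) * (1 - z) * (z * (2 + z) * w) = z * (2 + z) ^+ 2 by ring: zw.
have E : theta z = z + 45 * (fpsX rat * (2 + z) ^+ 2) * theta z.
  transitivity (theta (15 * (fpsX rat * (2 + z) ^+ 3))); first by rewrite -zE.
  rewrite [X in _ = X + _]zE.
  by rewrite thetaM (theta_nat _ 15) thetaM theta_fpsX thetaX thetaD (theta_nat _ 2) /=; ring.
have E2 : (2 + z) * theta z = (2 + z) * z + 3 * z * theta z.
  rewrite [X in X = _](_ : _ = (2 + z) * (z + 45 * (fpsX rat * (2 + z) ^+ 2) * theta z)).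
    by rewrite [X in 3 * X]zE; ring.
  by rewrite -E.
have E3 : 2 * (1 - z) * theta z = (2 + z) * z.
  transitivity ((2 + z) * theta z - 3 * z * theta z); first by ring.
  by rewrite E2; ring.
rewrite /delta; transitivity ((2 + z) * (2 * (1 - z) * theta z)); first by ring.
by rewrite E3; ring.
Qed.

Lemma delta_w : delta w = z * (2 + z) * w ^+ 3.
Proof.
have := congr1 delta zw; rewrite !deltaE delta_z subr0 => H.
have E : (1 - z) * delta w = z * (2 + z) * w ^+ 2.
  have -> : (1 - z) * delta w = delta w - (z * (2 + z) * w * w + z * delta w) + z * (2 + z) * w ^+ 2 by ring.
  by rewrite H; ring.
have -> : delta w = (1 - z) * w * delta w by rewrite one_sub_z_w mul1r.
have -> : (1 - z) * w * delta w = w * ((1 - z) * delta w) by ring.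
by rewrite E; ring.
Qed.

End Parametrization.

Lemma fcoefM_1 (R : comNzRingType) (f g : fps R) :
  fcoef (f * g) 1 = fcoef f 0 * fcoef g 1 + fcoef f 1 * fcoef g 0.
Proof. by rewrite fcoefM !big_ord_recl big_ord0 addr0. Qed.

Lemma fcoefM_2 (R : comNzRingType) (f g : fps R) :
  fcoef (f * g) 2 = fcoef f 0 * fcoef g 2 + fcoef f 1 * fcoef g 1 + fcoef f 2 * fcoef g 0.
Proof. by rewrite fcoefM !big_ord_recl big_ord0 addr0 !addrA. Qed.

Lemma fcoefM_3 (R : comNzRingType) (f g : fps R) :
  fcoef (f * g) 3 = fcoef f 0 * fcoef g 3 + fcoef f 1 * fcoef g 2 + fcoef f 2 * fcoef g 1
    + fcoef f 3 * fcoef g 0.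
Proof. by rewrite fcoefM !big_ord_recl big_ord0 addr0 !addrA. Qed.

Lemma fcoefM_4 (R : comNzRingType) (f g : fps R) :
  fcoef (f * g) 4 = fcoef f 0 * fcoef g 4 + fcoef f 1 * fcoef g 3 + fcoef f 2 * fcoef g 2
    + fcoef f 3 * fcoef g 1 + fcoef f 4 * fcoef g 0.
Proof. by rewrite fcoefM !big_ord_recl big_ord0 addr0 !addrA. Qed.

Lemma fpsC_N2 : fpsC (-2 : rat) = -2. Proof. by rewrite rmorphN /= (rmorph_nat (@fpsC _) 2). Qed.
Lemma fpsC_N1 : fpsC (-1 : rat) = -1. Proof. by rewrite rmorphN rmorph1. Qed.
Lemma fpsC_0 : fpsC (0 : rat) = 0. Proof. exact: rmorph0. Qed.
Lemma fpsC_1 : fpsC (1 : rat) = 1. Proof. exact: rmorph1. Qed.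
Lemma fpsC_2 : fpsC (2 : rat) = 2. Proof. exact: (rmorph_nat (@fpsC _) 2). Qed.
Definition fpsC_E := (fpsC_N2, fpsC_N1, fpsC_0, fpsC_1, fpsC_2).

Definition freud_quad (Y : rat -> fps (fps rat)) : fps (fps rat) :=
  Y (-2) * Y (-1) + Y (-1) * Y (-1) + 2 * (Y (-1) * Y 0) + Y 0 * Y 0 + Y (-1) * Y 1
    + 2 * (Y 0 * Y 1) + Y 1 * Y 1 + Y 1 * Y 2.

Definition freud_form (Y : rat -> fps (fps rat)) : fps (fps rat) := Y 0 * freud_quad Y.

Section FreudForm.
Variables (Y : rat -> fps (fps rat)) (a0 a1 a2 a3 a4 b1 b2 b3 b4 c1 c2 : fps rat).

(** If [K] gives the coefficient of [Y c * Y d] as a function of the two shifts, the quadratic form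
    is a sum of eight values of [K]. It is invariant under negation of all shifts, so monomials of
    odd total degree in the shifts cancel. *)
Lemma freud_quadE n (K : fps rat -> fps rat -> fps rat) :
  (forall c d, fcoef (Y c * Y d) n = K (fpsC c) (fpsC d)) ->
  fcoef (freud_quad Y) n =
    K (-2) (-1) + K (-1) (-1) + 2 * K (-1) 0 + K 0 0 + K (-1) 1 + 2 * K 0 1 + K 1 1 + K 1 2.
Proof. by move=> E; rewrite /freud_quad !fcoefD !fcoef_natM !E !fpsC_E. Qed.

Hypothesis Y0 : forall s, fcoef (Y s) 0 = a0.

Lemma freud_quad0 : fcoef (freud_quad Y) 0 = 10 * a0 ^+ 2.
Proof.
rewrite (freud_quadE (K := fun _ _ => a0 * a0)); first by ring.
by move=> c d; rewrite fcoefM0 !Y0.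
Qed.

Lemma freud_form0 : fcoef (freud_form Y) 0 = 10 * a0 ^+ 3.
Proof. by rewrite /freud_form fcoefM0 Y0 freud_quad0; ring. Qed.

Lemma freud_form1 : (forall s, fcoef (Y s) 1 = fpsC s * b1 + a1) ->
  fcoef (freud_form Y) 1 = 30 * a0 ^+ 2 * a1.
Proof.
move=> Y1; rewrite /freud_form fcoefM_1 freud_quad0 Y0 Y1 fpsC_0.
rewrite (freud_quadE (K := fun s t => a0 * (t * b1 + a1) + (s * b1 + a1) * a0)); first by ring.
by move=> c d; rewrite fcoefM_1 !Y1 !Y0.
Qed.

Hypothesis Y1 : forall s, fcoef (Y s) 1 = fpsC s * b1.

Lemma freud_quad1 : fcoef (freud_quad Y) 1 = 0.
Proof.
rewrite (freud_quadE (K := fun s t => a0 * (t * b1) + s * b1 * a0)); first by ring.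
by move=> c d; rewrite fcoefM_1 !Y1 !Y0.
Qed.

Hypothesis Y2 : forall s, fcoef (Y s) 2 = fpsC s ^+ 2 * b2 + a2.

Lemma freud_quad2 :
  fcoef (freud_quad Y) 2 = 20 * a0 * a2 + 5 * b1 ^+ 2 + 20 * a0 * b2.
Proof.
rewrite (freud_quadE (K := fun s t => a0 * (t ^+ 2 * b2 + a2) + s * b1 * (t * b1)
   + (s ^+ 2 * b2 + a2) * a0)); first by ring.
by move=> c d; rewrite fcoefM_2 !Y2 !Y1 !Y0.
Qed.

Lemma freud_form2 :
  fcoef (freud_form Y) 2 = 30 * a0 ^+ 2 * a2 + (5 * a0 * b1 ^+ 2 + 20 * a0 ^+ 2 * b2).
Proof.
rewrite /freud_form fcoefM_2 freud_quad0 freud_quad1 freud_quad2 Y0 Y1 Y2 fpsC_0.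
by ring.
Qed.

Lemma freud_quad3 :
  (forall s, fcoef (Y s) 3 = fpsC s ^+ 3 * b3 + fpsC s * c1 + a3) ->
  fcoef (freud_quad Y) 3 = 20 * a0 * a3.
Proof.
move=> Y3; rewrite (freud_quadE (K := fun s t => a0 * (t ^+ 3 * b3 + t * c1 + a3)
   + s * b1 * (t ^+ 2 * b2 + a2) + (s ^+ 2 * b2 + a2) * (t * b1)
   + (s ^+ 3 * b3 + s * c1 + a3) * a0)); first by ring.
by move=> c d; rewrite fcoefM_3 !Y3 !Y2 !Y1 !Y0.
Qed.

Lemma freud_form3 :
  (forall s, fcoef (Y s) 3 = fpsC s ^+ 3 * b3 + fpsC s * c1 + a3) ->
  fcoef (freud_form Y) 3 = 30 * a0 ^+ 2 * a3.
Proof.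
move=> Y3; rewrite /freud_form fcoefM_3 freud_quad0 freud_quad1 freud_quad2.
by rewrite (freud_quad3 Y3) Y0 Y1 Y2 Y3 fpsC_0; ring.
Qed.

(** The new unknown [a4] enters linearly, with coefficient [30 a0 ^ 2], the derivative of
    [10 a0 ^ 3]; everything else comes from lower orders. *)
Lemma freud_form4 :
  (forall s, fcoef (Y s) 3 = fpsC s ^+ 3 * b3 + fpsC s * c1) ->
  (forall s, fcoef (Y s) 4 = fpsC s ^+ 4 * b4 + fpsC s ^+ 2 * c2 + a4) ->
  fcoef (freud_form Y) 4 = 30 * a0 ^+ 2 * a4
   + (a0 * (44 * b4 * a0 + 20 * c2 * a0 + 22 * b3 * b1 + 10 * c1 * b1 + 11 * b2 ^+ 2
            + 20 * b2 * a2 + 10 * a2 ^+ 2)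
      + a2 * (20 * a0 * a2 + 5 * b1 ^+ 2 + 20 * a0 * b2)).
Proof.
move=> Y3 Y4; rewrite /freud_form fcoefM_4 freud_quad0 freud_quad1 freud_quad2.
rewrite (freud_quadE (n := 4) (K := fun s t => a0 * (t ^+ 4 * b4 + t ^+ 2 * c2 + a4)
   + s * b1 * (t ^+ 3 * b3 + t * c1) + (s ^+ 2 * b2 + a2) * (t ^+ 2 * b2 + a2)
   + (s ^+ 3 * b3 + s * c1) * (t * b1) + (s ^+ 4 * b4 + s ^+ 2 * c2 + a4) * a0)).
  by rewrite Y0 Y1 Y2 Y3 Y4 fpsC_0; ring.
by move=> c d; rewrite fcoefM_4 !Y4 !Y3 !Y2 !Y1 !Y0.
Qed.
End FreudForm.

Section Orders.
Variable rho : fps {poly rat}.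
Hypothesis rho_deg : deg_bound 1 rho.
Hypothesis rhoE : rho = fpsC 'X + 6 * (fpsX _ * (rho * freud_sumP rho)).

Definition ord (n : nat) : fps rat := 2 * fcoef (V 1 rho) n.
Definition shifted (c : rat) : fps (fps rat) := 2 * V 1 (fps_shift c rho).
(** What order [m] of [rho] contributes to order [m + k] of the shifted series, as the coefficient
    of [c ^ k]. *)
Definition dord (m k : nat) : fps rat := 2 ^+ k * (2 * binom_op 1 m k (fcoef (V 1 rho) m)).

Lemma dord0 m : dord m 0 = ord m.
Proof. by rewrite /dord binom_op0 expr0 mul1r. Qed.

Lemma dordS m k :
  k.+1%:R * dord m k.+1 = 2 * (delta (dord m k) + fpsC (1 - m%:R - k%:R) * dord m k).
Proof.
have E := binom_opS 1 m k rho.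
rewrite /dord /delta thetaM thetaX (theta_nat _ 2) mulr0 mul0r add0r thetaM (theta_nat _ 2) mul0r add0r.
rewrite exprS; move: E; move: (binom_op _ _ k.+1 _) (binom_op _ _ k _) (2 ^+ k) => a b c E.
have -> : k.+1%:R * (2 * c * (2 * a)) = 4 * c * (k.+1%:R * a) by ring.
by rewrite E; ring.
Qed.

Lemma shifted_coef c n :
  fcoef (shifted c) n = \sum_(m < n.+1) fpsC (c ^+ (n - m)) * dord m (n - m).
Proof.
rewrite /shifted fcoef_natM V_shift // mulr_sumr; apply: eq_bigr => m _.
have -> : fpsC ((2 * c) ^+ (n - m)) = 2 ^+ (n - m) * fpsC (c ^+ (n - m)).
  by rewrite exprMn rmorphM rmorphXn /= (rmorph_nat (@fpsC _) 2).
by rewrite /dord; ring.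
Qed.

(** The Freud equation times four: [shifted] carries a factor 2, so the cubic form carries 8, and
    [4 * 6 = 3 * 8]. *)
Lemma V_freud n :
  2 * ord n = (if n == 0%N then 4 else 0) + 3 * (fpsX rat * fcoef (freud_form shifted) n).
Proof.
have sh c := deg_bound_shift c rho_deg.
have shM c d := deg_boundM (sh c) (sh d).
have VMs c d : 4 * V 2 (fps_shift c rho * fps_shift d rho) = shifted c * shifted d.
  by rewrite (VM (sh c) (sh d)) /shifted; ring.
have S2 : deg_bound 2 (freud_sumP rho).
  rewrite /freud_sumP; do 7?[apply: deg_boundD]; try exact: shM.
    by apply: deg_bound_natM; exact: shM.
  by apply: deg_bound_natM; exact: shM.
have VS : 4 * V 2 (freud_sumP rho) =
   shifted (-2) * shifted (-1) + shifted (-1) * shifted (-1)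
    + 2 * (shifted (-1) * shifted 0) + shifted 0 * shifted 0 + shifted (-1) * shifted 1
    + 2 * (shifted 0 * shifted 1) + shifted 1 * shifted 1 + shifted 1 * shifted 2.
  rewrite /freud_sumP !VD !V_natM -!VMs.
  move: (V _ _) (V _ _) (V _ _) (V _ _) (V _ _) (V _ _) (V _ _) (V _ _).
  by move=> a1 a2 a3 a4 a5 a6 a7 a8; ring.
rewrite /freud_form /freud_quad -VS /ord [X in _ * (_ * fcoef X _) = _](congr1 (V 1) rhoE) VD V_natM fcoefD fcoef_natM V_fpsX (VM rho_deg S2).
have -> : shifted 0 = 2 * V 1 rho by rewrite /shifted fps_shift0.
have -> : fcoef (V 1 (fpsC 'X)) n = (n == 0%N)%:R.
  apply: fpsP => j; rewrite V_coef coef_revp fcoef_nat.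
  case: j => [|j]; last by rewrite /fcoef /= coef0 mul0r if_same.
  by case: n => [|[|n]] //; rewrite /fcoef /= coefX /= ?mulr1 ?mul0r.
rewrite (_ : 2 * V 1 rho * (4 * V 2 (freud_sumP rho)) = 8%:R * (V 1 rho * V 2 (freud_sumP rho))); last by ring.
rewrite fcoef_natM.
by case: n => [|n] /=; ring.
Qed.

Lemma shifted_coefE c :
  [/\ fcoef (shifted c) 0 = ord 0,
      fcoef (shifted c) 1 = fpsC c * dord 0 1 + ord 1,
      fcoef (shifted c) 2 = fpsC c ^+ 2 * dord 0 2 + fpsC c * dord 1 1 + ord 2,
      fcoef (shifted c) 3 = fpsC c ^+ 3 * dord 0 3 + fpsC c ^+ 2 * dord 1 2
         + fpsC c * dord 2 1 + ord 3 &
      fcoef (shifted c) 4 = fpsC c ^+ 4 * dord 0 4 + fpsC c ^+ 3 * dord 1 3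
         + fpsC c ^+ 2 * dord 2 2 + fpsC c * dord 3 1 + ord 4].
Proof.
by split; rewrite shifted_coef !big_ord_recl big_ord0 addr0 /= ?subn0 ?rmorphXn ?expr1 /=
  ?expr0 ?rmorph1 ?mul1r ?dord0 ?addrA.
Qed.

Variables z w : fps rat.
Hypothesis ord0E : ord 0 = 2 + z.
Hypothesis wE : (1 - z) * w = 1.

(** The leading order [R] satisfies [R = 1 + 60 t R ^ 3], with [60 = 6 * 10] from the ten terms of
    the Freud sum. Setting [2 R = 2 + z] gives [15 = 2 * 60 / 8]. *)
Lemma order0 : z = 15 * (fpsX rat * (2 + z) ^+ 3).
Proof.
apply: (@natr_mulI 1); have := V_freud 0; rewrite (@freud_form0 _ (2 + z)) => [H|c].
  have -> : 2 * z = 2 * (2 + z) - 4 by ring.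
  by rewrite ord0E /= in H; rewrite H; ring.
by have [-> _ _ _ _] := shifted_coefE c; rewrite ord0E.
Qed.

Lemma zw : z * w = w - 1.
Proof.
have -> : z * w = w - (1 - z) * w by ring.
by rewrite wE.
Qed.

Lemma orderS n : (0 < n)%N ->
  10 * (2 + z) ^+ 3 * ord n = z * fcoef (freud_form shifted) n.
Proof.
case: n => // n _; have := V_freud n.+1.
move: (fcoef _ n.+1) => X /= H.
have -> : 10 * (2 + z) ^+ 3 * ord n.+1 = 5 * (2 + z) ^+ 3 * (2 * ord n.+1) by ring.
by rewrite H [X in _ = X * _]order0; ring.
Qed.

(** Each order solves the same linear equation with its own source [K]. Collecting [X] leaves
    [(2 + z) - 3 z = 2 (1 - z)], which is where the powers of [w] originate. *)
Lemma solve_order (X Y K : fps rat) :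
  10 * (2 + z) ^+ 3 * X = z * (30 * (2 + z) ^+ 2 * X + K) ->
  20 * (1 - z) * (2 + z) ^+ 2 * Y = z * K -> X = Y.
Proof.
move=> HX HY; have nz : fcoef (20 * (1 - z) * (2 + z) ^+ 2) 0 != 0.
  by rewrite expr2 !fcoefM0 (fcoefB 1 z) (fcoefD 2 z) (z0 order0) !fcoef_nat fcoef1.
apply: (fps_mulIf nz); rewrite HY.
transitivity (10 * (2 + z) ^+ 3 * X - z * 30 * (2 + z) ^+ 2 * X); first by ring.
by rewrite HX; ring.
Qed.

Lemma shifted0E c : fcoef (shifted c) 0 = 2 + z.
Proof. by have [-> _ _ _ _] := shifted_coefE c; rewrite ord0E. Qed.

Lemma order1 : ord 1 = 0.
Proof.
apply: (@solve_order _ _ 0); last by ring.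
rewrite orderS // (@freud_form1 _ (2 + z) (ord 1) (dord 0 1)) ?addr0 //.
- exact: shifted0E.
- by move=> c; have [_ -> _ _ _] := shifted_coefE c.
Qed.

Lemma dord_1 k : dord 1 k = 0.
Proof.
have r1 : fcoef (V 1 rho) 1 = 0.
  by apply: (@natr_mulI 1); rewrite mulr0 -/(ord 1) order1.
rewrite /dord (_ : binom_op _ _ _ _ = 0) ?mulr0 //.
by apply: fpsP => j; rewrite binom_op_coef r1 mulr0.
Qed.

Lemma delta_ordz : delta z = z * (2 + z) * w. Proof. exact: delta_z order0 zw. Qed.
Lemma delta_ordw : delta w = z * (2 + z) * w ^+ 3. Proof. exact: delta_w order0 zw. Qed.

Ltac solve_delta := rewrite !deltaE ?delta_ordz ?delta_ordw; ring: zw.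

Lemma dord_01 : dord 0 1 = 2 * (2 + z) * w.
Proof.
apply: (@natr_mulI 0); rewrite dordS dord0 ord0E !subr0 fpsC_1.
by solve_delta.
Qed.

Lemma dord_02 : dord 0 2 = 6 * z * (2 + z) * w ^+ 3.
Proof.
apply: (@natr_mulI 1); rewrite dordS dord_01 !subr0 subrr fpsC_0.
by solve_delta.
Qed.

Lemma dord_03 : dord 0 3 = 4 * z * (2 + z) * (1 + 8 * z) * w ^+ 5.
Proof.
apply: (@natr_mulI 2); rewrite dordS dord_02 !subr0.
rewrite (_ : (1 - 2%:R : rat) = -1) // fpsC_N1.
by solve_delta.
Qed.

Lemma dord_04 : dord 0 4 = 30 * z ^+ 2 * (2 + z) * (2 + 7 * z) * w ^+ 7.
Proof.
apply: (@natr_mulI 3); rewrite dordS dord_03 !subr0.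
rewrite (_ : (1 - 3%:R : rat) = -2) // fpsC_N2.
by solve_delta.
Qed.

Lemma shifted1E c : fcoef (shifted c) 1 = fpsC c * dord 0 1.
Proof. by have [_ -> _ _ _] := shifted_coefE c; rewrite order1 addr0. Qed.

Lemma shifted2E c : fcoef (shifted c) 2 = fpsC c ^+ 2 * dord 0 2 + ord 2.
Proof. by have [_ _ -> _ _] := shifted_coefE c; rewrite dord_1 mulr0 addr0. Qed.

Lemma shifted3E c : fcoef (shifted c) 3 =
  fpsC c ^+ 3 * dord 0 3 + fpsC c * dord 2 1 + ord 3.
Proof. by have [_ _ _ -> _] := shifted_coefE c; rewrite dord_1 mulr0 addr0. Qed.

Lemma order2 : ord 2 = z * (2 + z) * (1 + 5 * z) * w ^+ 4.
Proof.
apply: (@solve_order _ _ (5 * (2 + z) * dord 0 1 ^+ 2 + 20 * (2 + z) ^+ 2 * dord 0 2)).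
  by rewrite orderS // (freud_form2 shifted0E shifted1E shifted2E).
by rewrite dord_01 dord_02; ring: zw.
Qed.

(** As for order 1, the symmetry of the form under negation of the shifts leaves no source. *)
Lemma order3 : ord 3 = 0.
Proof.
apply: (@solve_order _ _ 0); last by ring.
by rewrite orderS // (freud_form3 shifted0E shifted1E shifted2E shifted3E) addr0.
Qed.

Lemma dord_21 : dord 2 1 = 2 * z * (2 + z) * (1 + 25 * z + 46 * z ^+ 2) * w ^+ 6.
Proof.
apply: (@natr_mulI 0); rewrite dordS dord0 order2 subr0.
rewrite (_ : (1 - 2%:R : rat) = -1) // fpsC_N1.
by solve_delta.
Qed.

Lemma dord_22 :
  dord 2 2 = 6 * z ^+ 2 * (2 + z) * (22 + 187 * z + 223 * z ^+ 2) * w ^+ 8.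
Proof.
apply: (@natr_mulI 1); rewrite dordS dord_21.
rewrite (_ : (1 - 2%:R - 1%:R : rat) = -2) // fpsC_N2.
by solve_delta.
Qed.

(** The closed form is verified against the linear equation of [solve_order]. The factor 10 clears
    denominators; numerals are cut at 1000 to stay small. *)
Lemma order4 : 10 * ord 4 =
  z ^+ 2 * (2 + z) * (118 + (4 * 1000 + 11) * z + (13 * 1000 + 764) * z ^+ 2 + (8 * 1000 + 567) * z ^+ 3) * w ^+ 9.
Proof.
have r3 : fcoef (V 1 rho) 3 = 0.
  by apply: (@natr_mulI 1); rewrite mulr0 -/(ord 3) order3.
have d31 : dord 3 1 = 0.
  rewrite /dord (_ : binom_op _ _ _ _ = 0) ?mulr0 //.
  by apply: fpsP => j; rewrite binom_op_coef r3 mulr0.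
have S3 c : fcoef (shifted c) 3 = fpsC c ^+ 3 * dord 0 3 + fpsC c * dord 2 1.
  by rewrite shifted3E order3 addr0.
have S4 c : fcoef (shifted c) 4 = fpsC c ^+ 4 * dord 0 4 + fpsC c ^+ 2 * dord 2 2 + ord 4.
  by have [_ _ _ _ ->] := shifted_coefE c; rewrite dord_1 d31 !mulr0 !addr0.
have := orderS (isT : (0 < 4)%N).
rewrite (freud_form4 shifted0E shifted1E shifted2E S3 S4).
set K := (X in _ = _ * (_ + X)) => H.
apply: (@solve_order _ _ (10 * K)).
  transitivity (10 * (10 * (2 + z) ^+ 3 * ord 4)); first by ring.
  by rewrite H; ring.
rewrite /K dord_01 dord_02 dord_03 dord_04 order2 dord_21 dord_22.
by ring: zw.
Qed.

End Orders.

(** * Counting connected graphs by faces *)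

Definition face_poly (j : nat) : {poly rat} :=
  \sum_(M : {set {set halfedge 6 j}} | perfect_matching M && connected_graph M)
    'X^(num_faces M).

Lemma card_perfect_matching j (M : {set {set halfedge 6 j}}) :
  perfect_matching M -> #|M| = (3 * j)%N.
Proof.
move=> /andP[part /forall_inP M2].
have := card_uniform_partition (fun e eM => eqP (M2 e eM)) part.
by rewrite cardsT card_prod !card_ord; lia.
Qed.

(** With [j] vertices and [3 j] edges, genus [g] means [2 j + 2 - 2 g] faces; the bound on [g] keeps
    the subtraction from truncating. *)
Lemma num_graphs_face_poly g j : (2 * g <= 2 * j + 2)%N ->
  (num_graphs g 6 j)%:R = (face_poly j)`_(2 * j + 2 - 2 * g) :> rat.
Proof.
move=> gj; rewrite /face_poly coef_sum /num_graphs -sum1_card natr_sum.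
rewrite big_mkcond [RHS]big_mkcond /=; apply: eq_bigr => M _.
rewrite inE coefXn; case: (boolP (perfect_matching M)) => //= Mp.
case: (connected_graph M) => //=; rewrite /has_genus /euler_char (card_perfect_matching Mp).
rewrite (_ : (_ == _) = (2 * j + 2 - 2 * g == num_faces M)%N); first by case: eqP.
by apply/eqP/eqP; lia.
Qed.

Lemma num_faces_gt0 j (M : {set {set halfedge 6 j.+1}}) :
  perfect_matching M -> (0 < num_faces M)%N.
Proof.
move=> Mp; apply/card_gt0P; exists (froot (face_step M) (ord0, ord0)).
rewrite inE andbT; apply: roots_root.
exact: fconnect_sym (face_step_inj (Mp : matching setT M)).
Qed.

(** One vertex and three edges would leave no face in genus 2. This case is separate because the
    fourth order is informative only from [j = 2] on. *)
Lemma num_graphs_1_2 : num_graphs 2 6 1 = 0%N.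
Proof.
apply/eqP; rewrite cards_eq0; apply/eqP/setP => M; rewrite !inE.
apply/negP => /and3P[Mp _]; rewrite /has_genus /euler_char (card_perfect_matching Mp).
by have := num_faces_gt0 Mp; move: (num_faces M) => F; lia.
Qed.

(** The relation [theta Z = tau Z], read at [t ^ (k + 1)], is the recursion over the component of a
    vertex with [c k = (k - 1)! [t ^ k] tau], so [connected_sum_card] applies. *)
Lemma face_poly_tau N j : (0 < j)%N ->
  (face_poly j).[N.+1%:R] = (j.-1`!)%:R * fcoef (tau N) j.
Proof.
case: j => // j _; pose c k := (k.-1`!)%:R * fcoef (tau N) k.
have cE k : trace_moment N 5 k.+1 =
     \sum_(i < k.+1) ('C(k, i))%:R * (c i.+1 * trace_moment N 5 (k - i)).
  have := congr1 (fun f => fcoef f k.+1) (tauE N).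
  rewrite theta_coef fcoefM big_ord_recl /= {1}/tau fcoefM0 theta_coef !mul0r add0r.
  have F n : fcoef (partition_fps N) n = trace_moment N 5 n / (n`!)%:R by [].
  have nz n : (n`!)%:R != 0 :> rat by rewrite pnatr_eq0 -lt0n fact_gt0.
  rewrite F => H; have k1 : k.+1%:R != 0 :> rat by rewrite pnatr_eq0.
  have -> : trace_moment N 5 k.+1 = (k`!)%:R * (k.+1%:R * (trace_moment N 5 k.+1 / (k.+1)`!%:R)).
    rewrite factS natrM; move: (nz k) k1 (trace_moment _ _ _).
    by move: (k`!%:R) (k.+1%:R) => a b a0 b0 x; field; rewrite a0 b0.
  rewrite H mulr_sumr; apply: eq_bigr => i _; rewrite /bump /= add1n subSS F /c /=.
  have ik : (i <= k)%N by rewrite -ltnS.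
  rewrite -(bin_fact ik) !natrM; move: (nz (k - i)%N) (trace_moment _ _ _).
  by move: ((k - i)`!%:R) => a a0 x; field.
have := connected_sum_card (j := j.+1) (V := setT) cE.
rewrite -card_gt0 cardsT card_ord => /(_ isT) E; rewrite -[RHS]/(c j.+1) -E.
rewrite /connected_sum /face_poly horner_sum.
have hT : half_edges 5 [set: 'I_j.+1] = setT by apply/setP => h; rewrite !inE.
apply: eq_big => [M|M /andP[Mp _]].
  rewrite /connected_matching hT; congr (_ && _).
  by apply: eq_forallb => u; rewrite inE; apply: eq_forallb => v; rewrite inE.
by rewrite color_weight_faces // hornerXn.
Qed.

Definition tau_poly : fps {poly rat} :=
  Fps (fun j => if j is j'.+1 then (j'`!)%:R^-1 *: face_poly j else 0).

Lemma tau_poly_eval N j : fcoef (tau N) j = (fcoef tau_poly j).[N.+1%:R].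
Proof.
rewrite {2}/fcoef /tau_poly; case: j => [|j].
  by rewrite horner0 /tau fcoefM0 theta_coef !mul0r.
by rewrite hornerZ face_poly_tau // mulKf // pnatr_eq0 -lt0n fact_gt0.
Qed.

Lemma interpolates_tau : interpolates tau (fps_shift 1 tau_poly).
Proof.
move=> j; exists 0%N => N _; rewrite tau_poly_eval fps_shift_coef horner_comp.
by rewrite hornerD hornerX hornerC -natr1.
Qed.

Definition sigma : fps {poly rat} :=
  fps_shift 1 tau_poly + fps_shift (-1) tau_poly - 2 * tau_poly.

(** The offset between the index of [tau] and the matrix size cancels: the second difference is
    centred at the argument of [rho]. *)
Lemma toda_polynomial rho : interpolates opr rho -> sigma * rho = theta rho.
Proof.
move=> Hr; have Ht s := interpolates_shift s interpolates_tau.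
have L : interpolates (fun N => theta (opr (N + 2)))
   ((fps_shift 2 (fps_shift 1 tau_poly) + fps_shift 0 (fps_shift 1 tau_poly)
     - 2 * fps_shift 1 (fps_shift 1 tau_poly)) * fps_shift 2 rho).
  apply: (@eq_interpolates (fun N => (tau (N + 2) + tau (N + 0) - 2 * tau (N + 1)) * opr (N + 2))).
    by move=> N; rewrite !(addnS, addn0) toda_equation.
  apply: interpolatesM; last exact: (interpolates_shift 2 Hr).
  apply: interpolatesD; first by apply: interpolatesD; exact: Ht.
  by apply: interpolatesN; apply: (interpolatesM (interpolates_natr 2)); exact: Ht.
have := congr1 (fps_shift (-2))
  (interpolates_uniq L (interpolates_theta (interpolates_shift 2 Hr))).
rewrite !(fps_shiftD, fps_shiftN, fps_shiftM, fps_shift_nat, fps_shift_theta, fps_shift_comp).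
rewrite addNr fps_shift0 /sigma -[in RHS]fps_shift_theta.
by rewrite !add0r (_ : -2 + 1 = -1 :> rat) // !fps_shift0.
Qed.

Definition second_diff (p : {poly rat}) : {poly rat} :=
  (p \Po ('X + 1%:P)) + (p \Po ('X + (-1)%:P)) - 2 * p.

Lemma sigma_coef j : fcoef sigma j = second_diff (fcoef tau_poly j).
Proof. by rewrite /sigma !(fcoefD, fcoefN, fcoef_natM, fps_shift_coef). Qed.

Lemma second_diff_coef (p : {poly rat}) i m : (size p <= i + m)%N ->
  (second_diff p)`_i =
  \sum_(l < m) p`_(i + l) * ('C(i + l, i)%:R * (1 + (-1) ^+ l)) - 2 * p`_i.
Proof.
move=> sp; rewrite /second_diff !(coefD, coefN) !(comp_polyXaddC_coef _ _ sp).
rewrite -big_split big_split_ord /= big1 ?add0r => [|k _].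
  congr (_ - _); last by rewrite -polyC_natr coefCM.
  apply: eq_bigr => l _; rewrite addKn expr1n; ring.
by rewrite bin_small //= !mul0r mulr0 addr0.
Qed.

Lemma bin2_rat n : 2 * ('C(n.+2, 2))%:R = n.+2%:R * n.+1%:R :> rat.
Proof. by rewrite -!natrM; congr (_%:R); rewrite -mul_bin_diag bin1 mulnC. Qed.

Lemma bin4_rat n :
  24 * ('C(n.+4, 4))%:R = n.+4%:R * n.+3%:R * n.+2%:R * n.+1%:R :> rat.
Proof.
have E k m : k.+1%:R * ('C(m.+1, k.+1))%:R = m.+1%:R * ('C(m, k))%:R :> rat.
  by rewrite -!natrM mul_bin_diag.
transitivity (3 * 2 * (4 * ('C(n.+4, 4))%:R) : rat); first by ring.
rewrite (E 3 n.+3); transitivity (n.+4%:R * 2 * (3 * ('C(n.+3, 3))%:R) : rat); first by ring.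
rewrite (E 2 n.+2); transitivity (n.+4%:R * n.+3%:R * (2 * ('C(n.+2, 2))%:R) : rat); first by ring.
by rewrite bin2_rat; ring.
Qed.

Lemma bin6_rat n : 720 * ('C(n.+4.+2, 6))%:R =
  n.+4.+2%:R * n.+4.+1%:R * n.+4%:R * n.+3%:R * n.+2%:R * n.+1%:R :> rat.
Proof.
have E k m : k.+1%:R * ('C(m.+1, k.+1))%:R = m.+1%:R * ('C(m, k))%:R :> rat.
  by rewrite -!natrM mul_bin_diag.
transitivity (24 * 5 * (6 * ('C(n.+4.+2, 6))%:R) : rat); first by ring.
rewrite (E 5 n.+4.+1); transitivity (n.+4.+2%:R * 24 * (5 * ('C(n.+4.+1, 5))%:R) : rat); first by ring.
rewrite (E 4 n.+4); transitivity (n.+4.+2%:R * n.+4.+1%:R * (24 * ('C(n.+4, 4))%:R) : rat); first by ring.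
by rewrite bin4_rat; ring.
Qed.

Lemma second_diff_lead (p : {poly rat}) n : (size p <= n.+3)%N ->
  (second_diff p)`_n = n.+2%:R * n.+1%:R * p`_n.+2.
Proof.
move=> sp; rewrite (@second_diff_coef _ _ 3) ?addn3 //.
rewrite !big_ord_recl big_ord0 /= /bump /= !addn0 !add1n !addn1 !addn2 binn expr0 expr1.
rewrite -(bin2_rat n) -(bin_sub (n := n.+2) (m := 2)) // subSS subSS subn0.
by ring.
Qed.

(** Taylor expansion: the second difference is [p'' + p'''' / 12 + p'''''' / 360 + ...], and the
    size bound cuts it off. *)
Lemma second_diff_sub (p : {poly rat}) n : (size p <= n.+4.+1)%N ->
  (second_diff p)`_n = n.+2%:R * n.+1%:R * p`_n.+2
    + n.+4%:R * n.+3%:R * n.+2%:R * n.+1%:R / 12 * p`_n.+4.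
Proof.
move=> sp; rewrite (@second_diff_coef _ _ 5) ?addnS ?addn0 //.
rewrite !big_ord_recl big_ord0 /= /bump /= !addnS !addn0 binn expr0 expr1.
rewrite -(bin2_rat n) -(bin4_rat n) -(bin_sub (n := n.+2) (m := 2)) // -(bin_sub (n := n.+4) (m := 4)) //.
by rewrite !subSS !subn0; field.
Qed.

Lemma second_diff_subsub (p : {poly rat}) n : (size p <= n.+4.+3)%N ->
  (second_diff p)`_n = n.+2%:R * n.+1%:R * p`_n.+2
    + n.+4%:R * n.+3%:R * n.+2%:R * n.+1%:R / 12 * p`_n.+4
    + n.+4.+2%:R * n.+4.+1%:R * n.+4%:R * n.+3%:R * n.+2%:R * n.+1%:R / 360 * p`_n.+4.+2.
Proof.
move=> sp; rewrite (@second_diff_coef _ _ 7) ?addnS ?addn0 //.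
rewrite !big_ord_recl big_ord0 /= /bump /= !addnS !addn0 binn expr0 expr1.
rewrite -(bin2_rat n) -(bin4_rat n) -(bin6_rat n) -(bin_sub (n := n.+2) (m := 2)) //.
rewrite -(bin_sub (n := n.+4) (m := 4)) // -(bin_sub (n := n.+4.+2) (m := 6)) //.
by rewrite !subSS !subn0; field.
Qed.

Lemma size_second_diff (p : {poly rat}) s : (size (second_diff p) <= s)%N -> (size p <= s.+2)%N.
Proof.
move=> ss; rewrite leqNgt; apply/negP => sp.
have [n En] : exists n, size p = n.+3.
  by case: (size p) sp => [|[|[|n]]] // _; exists n.
have := @second_diff_lead p n; rewrite En => /(_ (leqnn _)).
rewrite nth_default; last by apply: leq_trans ss _; move: sp; rewrite En !ltnS.
move=> /esym/eqP; rewrite !mulf_eq0 !pnatr_eq0 /=.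
have -> : p`_n.+2 = lead_coef p by rewrite lead_coefE En.
by rewrite lead_coef_eq0 -size_poly_eq0 En.
Qed.

Section SigmaOrders.
Variable rho : fps {poly rat}.
Hypothesis rho_deg : deg_bound 1 rho.
Hypothesis rhoE : rho = fpsC 'X + 6 * (fpsX _ * (rho * freud_sumP rho)).
Hypothesis todaE : sigma * rho = theta rho.

Lemma rho_coef0 : fcoef rho 0 = 'X.
Proof. by rewrite rhoE fcoefD fcoef_natM fcoefXM mulr0 addr0. Qed.

(** The constant coefficient of [rho] is [X], so [sigma * rho = theta rho] determines [X] times each
    coefficient of [sigma] from the preceding ones. *)
Lemma sigma_deg : deg_bound 0 sigma.
Proof.
move=> j; have [m] := ubnP j; elim: m j => // m IH j jm.
have := congr1 (fun f => fcoef f j) todaE; rewrite fcoefM big_ord_recr /= subnn rho_coef0 theta_coef => E.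
have E2 : fcoef sigma j * 'X =
    j%:R * fcoef rho j - \sum_(i < j) fcoef sigma i * fcoef rho (j - i).
  by rewrite -E addrAC subrr add0r.
have [->|nz] := eqVneq (fcoef sigma j) 0; first by rewrite size_poly0.
suff : (size (fcoef sigma j * 'X)%R <= (2 * j + 1).+1)%N.
  by rewrite size_mulX // ltnS addn0.
rewrite E2 (leq_trans (size_polyD _ _)) // geq_max size_polyN; apply/andP; split.
  rewrite -polyC_natr mul_polyC (leq_trans (size_scale_leq _ _)) //.
  by rewrite (leq_trans (rho_deg j)) // addn1.
apply: (leq_trans (size_sum _ _ _)); apply/bigmax_leqP => i _.
have -> : ((2 * j + 1).+1 = (2 * i + 0 + (2 * (j - i) + 1)).+1)%N by have := ltn_ord i; lia.
apply: size_polyM_leq; rewrite -[leqRHS]addn1; last exact: rho_deg.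
by apply: IH; rewrite (leq_trans (ltn_ord i)).
Qed.

(** For the face polynomials this says that a connected graph has at most [2 j + 2] faces, i.e. that
    no genus is negative; it is obtained here without topology. *)
Lemma tau_poly_deg j : (size (fcoef tau_poly j) <= 2 * j + 3)%N.
Proof.
have := sigma_deg j; rewrite sigma_coef => /size_second_diff sz.
by apply: leq_trans sz _; lia.
Qed.

Definition sord (n : nat) : fps rat := fcoef (V 0 sigma) n.

Lemma sord_toda n : \sum_(i < n.+1) 2 * sord i * ord rho (n - i) = delta (ord rho n).
Proof.
rewrite /delta /ord thetaM (theta_nat _ 2) mul0r add0r -V_theta -todaE.
rewrite (VM sigma_deg rho_deg) fcoefM !mulr_sumr; apply: eq_bigr => i _.
by rewrite /sord; ring.
Qed.

Variables z w : fps rat.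
Hypothesis ord0E : ord rho 0 = 2 + z.
Hypothesis wE : (1 - z) * w = 1.

Let z_w := zw wE.
Let o1 := order1 rho_deg rhoE ord0E.
Let o2 := order2 rho_deg rhoE ord0E wE.
Let o3 := order3 rho_deg rhoE ord0E.
Let o4 := order4 rho_deg rhoE ord0E wE.
Let d_z := delta_ordz rho_deg rhoE ord0E wE.
Let d_w := delta_ordw rho_deg rhoE ord0E wE.

Lemma fcoef_z0 : fcoef z 0 = 0.
Proof. exact: z0 (order0 rho_deg rhoE ord0E). Qed.

Lemma mul_2z_I (f g : fps rat) : (2 + z) * f = (2 + z) * g -> f = g.
Proof. by apply: fps_mulIf; rewrite (fcoefD 2 z) fcoef_z0 fcoef_nat. Qed.

Lemma sord0 : 2 * sord 0 = z * w.
Proof.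
apply: mul_2z_I; have := sord_toda 0; rewrite big_ord_recl big_ord0 /= ord0E => E.
rewrite mulrC -[LHS]addr0 E !deltaE d_z; ring: z_w.
Qed.

Lemma sord2 : 2 * sord 2 = z * (2 + z) * (1 + 13 * z + 10 * z ^+ 2) * w ^+ 6.
Proof.
apply: mul_2z_I; have := sord_toda 2; rewrite !big_ord_recl big_ord0 /= /bump /=.
rewrite ?subn0 ?subnn ord0E o1 o2 sord0 => E.
transitivity (delta (z * (2 + z) * (1 + 5 * z) * w ^+ 4)
   - z * w * (z * (2 + z) * (1 + 5 * z) * w ^+ 4)); first by rewrite -E; ring.
by rewrite !deltaE d_z d_w; ring: z_w.
Qed.

(** The coefficients stay variables so that [ring] differentiates without expanding numerals. *)
Lemma delta_quintic (k0 k1 k2 k3 : nat) :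
  delta (z ^+ 2 * (2 + z) * (k0%:R + k1%:R * z + k2%:R * z ^+ 2 + k3%:R * z ^+ 3) * w ^+ 9) =
  z ^+ 2 * (2 + z) * w ^+ 9 * (((4 + 3 * z) * w + 9 * z * (2 + z) * w ^+ 2)
      * (k0%:R + k1%:R * z + k2%:R * z ^+ 2 + k3%:R * z ^+ 3)
    + (k1%:R + 2 * k2%:R * z + 3 * k3%:R * z ^+ 2) * (z * (2 + z) * w)).
Proof. by rewrite !deltaE d_z d_w; ring. Qed.

Lemma sord4 : 20 * sord 4 = z ^+ 2 * (2 + z) * (226 + (12 * 1000 + 689) * z + (78 * 1000 + 552) * z ^+ 2
  + (111 * 1000 + 905) * z ^+ 3 + (34 * 1000 + 768) * z ^+ 4) * w ^+ 11.
Proof.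
apply: mul_2z_I; have := sord_toda 4; rewrite !big_ord_recl big_ord0 /= /bump /=.
rewrite ?subn0 ?subnn ord0E o1 o3 => E.
have E4 : (2 + z) * (20 * sord 4) =
    delta (10 * ord rho 4) - 2 * sord 0 * (10 * ord rho 4) - 10 * (2 * sord 2) * ord rho 2.
  rewrite (_ : delta (10 * _) = 10 * delta (ord rho 4)); last by rewrite !deltaE; ring.
  by rewrite -E; ring.
rewrite E4 o4 o2 sord0 sord2.
have := delta_quintic 118 (4 * 1000 + 11) (13 * 1000 + 764) (8 * 1000 + 567).
by rewrite !natrD !natrM => ->; ring: z_w.
Qed.

End SigmaOrders.

(** * Coefficient extraction *)

Section Lagrange.
Variables z w : fps rat.
Hypothesis zE : z = 15 * (fpsX rat * (2 + z) ^+ 3).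
Hypothesis z_w : z * w = w - 1.

Let z_0 : fcoef z 0 = 0 := z0 zE.

(** The value 0 for [j < a], instead of the binomial with truncated subtraction, makes Pascal's rule
    hold at the boundary. *)
Definition binB (n j a : nat) : rat := if (a <= j)%N then ('C(n, j - a))%:R else 0.

Lemma binB_pascal n j a : binB n.+1 j a = binB n j a + binB n j a.+1.
Proof.
rewrite /binB; case: (ltngtP a j) => [aj|aj|->]; rewrite ?addr0 //.
  by rewrite subnS; case: (j - a)%N (subn_gt0 a j) => [|m]; rewrite aj //= binS natrD.
by rewrite subnn !bin0.
Qed.

Lemma fcoef_zM_lt a (f : fps rat) j : (j < a)%N -> fcoef (z ^+ a * f) j = 0.
Proof.
move=> ja; apply: (@fcoefM_lt _ _ _ a 0) => // [i ia|]; last by rewrite addn0.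
exact: fcoefX_lt.
Qed.

Lemma fcoef_w0 : fcoef w 0 = 1.
Proof.
have := congr1 (fun f => fcoef f 0) z_w.
by rewrite fcoefM0 z_0 mul0r fcoefB fcoef1 => /esym/eqP; rewrite subr_eq0 => /eqP.
Qed.

(** With [z = 2 y] one has [y = 60 t (1 + y) ^ 3], and [(2 + z) w] is twice the Lagrange factor
    [1 / (1 - 180 t (1 + y) ^ 2)]. Induction on [j] replaces residues: one factor [z] is substituted
    by [15 t (2 + z) ^ 3], and the expanded cube matches three steps of Pascal's rule. *)
Lemma lagrange_base a j :
  fcoef (z ^+ a * (2 + z) * w) j = 2 ^+ a.+1 * 60 ^+ j * binB (3 * j) j a.
Proof.
elim: j a => [|j IH] a.
  case: a => [|a]; last by rewrite -mulrA fcoef_zM_lt // /binB ltn0 mulr0.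
  rewrite expr0 mul1r fcoefM0 (fcoefD 2 z) fcoef_nat z_0 fcoef_w0 /binB /=.
  by rewrite bin0 expr1 expr0; ring.
have step b : fcoef (z ^+ b.+1 * (2 + z) * w) j.+1 =
    2 ^+ b.+2 * 60 ^+ j.+1 * binB (3 * j.+1) j.+1 b.+1.
  have -> : z ^+ b.+1 * (2 + z) * w = 15 * (fpsX rat *
     (8 * (z ^+ b * (2 + z) * w) + 12 * (z ^+ b.+1 * (2 + z) * w)
      + 6 * (z ^+ b.+2 * (2 + z) * w) + z ^+ b.+3 * (2 + z) * w)).
    rewrite exprSr; move: (fpsX rat) zE => t zE'.
    transitivity (z ^+ b * (15 * (t * (2 + z) ^+ 3)) * (2 + z) * w); first by rewrite -zE'.
    by rewrite !exprS; ring.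
  rewrite fcoef_natM fcoefXM !fcoefD !fcoef_natM !IH.
  have B c : binB (3 * j.+1) j.+1 c.+1 = binB (3 * j).+3 j c.
    by rewrite /binB ltnS subSS; congr (if _ then ('C(_, _))%:R else _); lia.
  by rewrite B !binB_pascal !exprS; ring.
case: a => [|a]; last exact: step.
(* For [a = 0] there is no factor [z] to substitute. Instead [2 + z = (1 - z) (2 + z) w], and its
   [delta] is the case [a = 1]. *)
have E : delta (z ^+ 0 * (2 + z) * w - z ^+ 1 * (2 + z) * w) = z ^+ 1 * (2 + z) * w.
  rewrite (_ : _ - _ = 2 + z); last by rewrite expr0 expr1; ring: z_w.
  by rewrite deltaD (delta_nat 2) add0r (delta_z zE z_w) expr1.
have := congr1 (fun f => fcoef f j.+1) E.
rewrite /delta fcoef_natM theta_coef fcoefB step => H.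
have nz : 2 * j.+1%:R != 0 :> rat by rewrite mulf_neq0 // pnatr_eq0.
apply: (mulfI nz).
have -> : 2 * j.+1%:R * fcoef (z ^+ 0 * (2 + z) * w) j.+1 =
   2 * (j.+1%:R * (fcoef (z ^+ 0 * (2 + z) * w) j.+1 - 2 ^+ 2 * 60 ^+ j.+1 * binB (3 * j.+1) j.+1 1))
   + 2 * j.+1%:R * (2 ^+ 2 * 60 ^+ j.+1 * binB (3 * j.+1) j.+1 1) by ring.
rewrite H /binB /= subn0 subn1 /=.
have C1 : j.+1%:R * ('C(3 * j.+1, j.+1))%:R = (2 * j%:R + 3) * ('C(3 * j.+1, j))%:R :> rat.
  rewrite -natrM mul_bin_left natrM; congr (_ * _).
  have -> : (3 * j.+1 - j = 2 * j + 3)%N by lia.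
  by rewrite natrD natrM.
have -> : 2 * j.+1%:R * (2 ^+ 1 * 60 ^+ j.+1 * ('C(3 * j.+1, j.+1))%:R) =
   4 * 60 ^+ j.+1 * (j.+1%:R * ('C(3 * j.+1, j.+1))%:R) :> rat by ring.
by rewrite C1 -[j.+1%:R]natr1; ring.
Qed.

Lemma lagrange_binomial a b j : fcoef (z ^+ a * (2 + z) ^+ b.+1 * w) j =
  2 ^+ (a + b).+1 * 60 ^+ j * binB (3 * j + b) j a.
Proof.
elim: b a => [|b IH] a; first by rewrite expr1 lagrange_base !addn0.
have -> : z ^+ a * (2 + z) ^+ b.+2 * w =
   2 * (z ^+ a * (2 + z) ^+ b.+1 * w) + z ^+ a.+1 * (2 + z) ^+ b.+1 * w.
  by rewrite !exprS; ring.
by rewrite fcoefD fcoef_natM !IH !addnS addSn binB_pascal !exprS; ring.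
Qed.

(** The coefficient of [y ^ m] in [(1 + y) ^ N / (1 - 2 y) ^ c]. The predecessor gives the right
    values for [c = 0]: 1 at [k = 0] and 0 beyond. *)
Definition conv_sum (N m c : nat) : nat :=
  \sum_(k < m.+1) 2 ^ k * 'C((k + c).-1, k) * 'C(N, m - k).

Lemma conv_sumS N m c :
  conv_sum N m.+1 c.+1 = (conv_sum N m.+1 c + 2 * conv_sum N m c.+1)%N.
Proof.
rewrite /conv_sum big_ord_recl [in RHS]big_ord_recl -addnA /=; congr (_ + _)%N.
  by rewrite !bin0.
rewrite big_distrr -big_split /=; apply: eq_bigr => k _.
by rewrite /bump /= !add1n subSS !addnS /= binS expnS mulnDr mulnDl !mulnA.
Qed.

Lemma conv_sum0 N c : conv_sum N 0 c = 1%N.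
Proof. by rewrite /conv_sum big_ord1 !bin0. Qed.

Lemma conv_sum_c0 N m : conv_sum N m 0 = 'C(N, m).
Proof.
rewrite /conv_sum big_ord_recl big1 ?addn0 => [|k _]; first by rewrite bin0 subn0 !mul1n.
by rewrite addn0 bin_small ?muln0 //= ltnSn.
Qed.

(** One factor [w] belongs to the Lagrange factor, hence [c.+1] against [c]. Since [w = 1 + z w], a
    double induction on [c] and [j - a] follows the recursion [conv_sumS]. *)
Lemma lagrange_power a b c j : (a <= j)%N ->
  fcoef (z ^+ a * (2 + z) ^+ b.+1 * w ^+ c.+1) j =
  2 ^+ (a + b).+1 * 60 ^+ j * (conv_sum (3 * j + b) (j - a) c)%:R.
Proof.
elim: c a => [|c IHc] a aj.
  by rewrite expr1 lagrange_binomial /binB aj conv_sum_c0.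
have split_w a' : z ^+ a' * (2 + z) ^+ b.+1 * w ^+ c.+2 =
    z ^+ a' * (2 + z) ^+ b.+1 * w ^+ c.+1 + z ^+ a'.+1 * (2 + z) ^+ b.+1 * w ^+ c.+2.
  transitivity (z ^+ a' * (2 + z) ^+ b.+1 * w ^+ c.+1 * (1 + (w - 1))); first by rewrite !exprS; ring.
  by rewrite -z_w !exprS; ring.
have [m] := ubnP (j - a); elim: m a aj => // m IHm a aj am.
rewrite split_w fcoefD IHc //.
have [aj'|ja] := ltnP a j; last first.
  have -> : a = j by apply/eqP; rewrite eqn_leq aj.
  by rewrite -[z ^+ j.+1 * _ * _]mulrA fcoef_zM_lt // addr0 subnn !conv_sum0.
rewrite IHm //; last by lia.
have -> : (j - a = (j - a.+1).+1)%N by lia.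
by rewrite conv_sumS natrD natrM addSn !exprS; ring.
Qed.

Lemma lagrange_zero a b c j : (j < a)%N -> fcoef (z ^+ a * (2 + z) ^+ b * w ^+ c) j = 0.
Proof. by move=> ja; rewrite -mulrA fcoef_zM_lt. Qed.

(** Formally the case [b = -1] of [lagrange_binomial], reached by downward induction on [a] through
    [2 + z]. *)
Lemma lagrange_neg j a : (0 < j)%N ->
  fcoef (z ^+ a * w) j = 2 ^+ a * 60 ^+ j * binB (3 * j).-1 j a.
Proof.
move=> j0; have [m] := ubnP (j.+1 - a); elim: m a => // m IH a am.
have [ja|aj] := ltnP j a; first by rewrite fcoef_zM_lt // /binB leqNgt ja mulr0.
have := lagrange_base a j.
have -> : z ^+ a * (2 + z) * w = 2 * (z ^+ a * w) + z ^+ a.+1 * w by rewrite exprS; ring.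
rewrite fcoefD fcoef_natM (IH a.+1); last by lia.
have -> : (3 * j = (3 * j).-1.+1)%N by lia.
rewrite binB_pascal /= => H; apply: (@mulfI _ 2) => //.
by rewrite -[LHS](addrK (2 ^+ a.+1 * 60 ^+ j * binB (3 * j).-1 j a.+1)) H exprS; ring.
Qed.

End Lagrange.

(** * Rational identities behind the counts in genus 1 and 2 *)

Section RationalIdentities.
Variables z w : fps rat.
Hypothesis zE : z = 15 * (fpsX rat * (2 + z) ^+ 3).
Hypothesis z_w : z * w = w - 1.

Let d_z := delta_z zE z_w.
Let d_w := delta_w zE z_w.

Lemma delta_shape a c (p q : fps rat) : delta p = q * (z * (2 + z) * w) ->
  delta (z ^+ a.+1 * (2 + z) * w ^+ c.+1 * p) =
  z ^+ a.+1 * (2 + z) * w ^+ c.+1 *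
   ((a.+1%:R * (2 + z) * w + z * w + c.+1%:R * z * (2 + z) * w ^+ 2) * p
    + q * (z * (2 + z) * w)).
Proof.
move=> dp; rewrite !deltaM deltaD (delta_nat 2) !deltaX d_z d_w dp !exprS.
by move: (z ^+ a) (w ^+ c) => x y; ring.
Qed.

Lemma delta_poly8 k0 k1 k2 k3 k4 k5 k6 k7 k8 :
  (forall k, k \in [:: k0; k1; k2; k3; k4; k5; k6; k7; k8] -> delta k = 0) ->
  delta (k0 + k1 * z + k2 * z ^+ 2 + k3 * z ^+ 3 + k4 * z ^+ 4 + k5 * z ^+ 5
    + k6 * z ^+ 6 + k7 * z ^+ 7 + k8 * z ^+ 8) =
  (k1 + 2 * k2 * z + 3 * k3 * z ^+ 2 + 4 * k4 * z ^+ 3 + 5 * k5 * z ^+ 4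
    + 6 * k6 * z ^+ 5 + 7 * k7 * z ^+ 6 + 8 * k8 * z ^+ 7) * (z * (2 + z) * w).
Proof.
move=> dk; have dM k n : delta k = 0 -> delta (k * z ^+ n.+1) = n.+1%:R * k * z ^+ n * (z * (2 + z) * w).
  by move=> k0'; rewrite deltaM k0' deltaX d_z; ring.
rewrite 8!deltaD -[in delta (k1 * z)](expr1 z) !dM ?dk ?inE ?eqxx ?orbT //.
by move: (z * (2 + z) * w) => y; ring.
Qed.

(* All the series below have this shape.  The coefficients are natural numbers, so
   that [delta] can be computed once for all of them; they are cut into two digits
   in base 4000 because large unary literals are intractable. *)
Definition quasi (a c h0 l0 h1 l1 h2 l2 h3 l3 h4 l4 h5 l5 h6 l6 h7 l7 h8 l8 : nat) : fps rat :=
  z ^+ a * (2 + z) * w ^+ c *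
    ((h0%:R * 4000 + l0%:R)
     + (h1%:R * 4000 + l1%:R) * z
     + (h2%:R * 4000 + l2%:R) * z ^+ 2
     + (h3%:R * 4000 + l3%:R) * z ^+ 3
     + (h4%:R * 4000 + l4%:R) * z ^+ 4
     + (h5%:R * 4000 + l5%:R) * z ^+ 5
     + (h6%:R * 4000 + l6%:R) * z ^+ 6
     + (h7%:R * 4000 + l7%:R) * z ^+ 7
     + (h8%:R * 4000 + l8%:R) * z ^+ 8).

Lemma delta_quasi a c h0 l0 h1 l1 h2 l2 h3 l3 h4 l4 h5 l5 h6 l6 h7 l7 h8 l8 :
  delta (quasi a.+1 c.+1 h0 l0 h1 l1 h2 l2 h3 l3 h4 l4 h5 l5 h6 l6 h7 l7 h8 l8) =
  z ^+ a.+1 * (2 + z) * w ^+ c.+1 *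
   ((a.+1%:R * (2 + z) * w + z * w + c.+1%:R * z * (2 + z) * w ^+ 2) *
    ((h0%:R * 4000 + l0%:R)
     + (h1%:R * 4000 + l1%:R) * z
     + (h2%:R * 4000 + l2%:R) * z ^+ 2
     + (h3%:R * 4000 + l3%:R) * z ^+ 3
     + (h4%:R * 4000 + l4%:R) * z ^+ 4
     + (h5%:R * 4000 + l5%:R) * z ^+ 5
     + (h6%:R * 4000 + l6%:R) * z ^+ 6
     + (h7%:R * 4000 + l7%:R) * z ^+ 7
     + (h8%:R * 4000 + l8%:R) * z ^+ 8)
    + ((h1%:R * 4000 + l1%:R)
     + 2 * (h2%:R * 4000 + l2%:R) * z
     + 3 * (h3%:R * 4000 + l3%:R) * z ^+ 2
     + 4 * (h4%:R * 4000 + l4%:R) * z ^+ 3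
     + 5 * (h5%:R * 4000 + l5%:R) * z ^+ 4
     + 6 * (h6%:R * 4000 + l6%:R) * z ^+ 5
     + 7 * (h7%:R * 4000 + l7%:R) * z ^+ 6
     + 8 * (h8%:R * 4000 + l8%:R) * z ^+ 7)
      * (z * (2 + z) * w)).
Proof.
apply: delta_shape; apply: delta_poly8 => k.
have dk h l : delta (h%:R * 4000 + l%:R) = 0.
  by rewrite deltaD deltaM !delta_nat; ring.
by rewrite !inE; do 8!(case/orP => [/eqP ->|]; first exact: dk); move=> /eqP ->; apply: dk.
Qed.

Ltac quasi_ring := rewrite ?delta_quasi /quasi; ring: z_w.

Lemma delta_zw : delta (z * w) = quasi 1 3 0 1 0 0 0 0 0 0 0 0 0 0 0 0 0 0 0 0.
Proof. by rewrite deltaM d_z d_w; quasi_ring. Qed.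

Lemma delta_zw1 :
  delta (quasi 1 3 0 1 0 0 0 0 0 0 0 0 0 0 0 0 0 0 0 0) =
  quasi 1 5 0 2 0 6 0 1 0 0 0 0 0 0 0 0 0 0 0 0.
Proof. by quasi_ring. Qed.

Lemma delta_Y1 :
  delta (quasi 1 4 0 4 0 4 0 1 0 0 0 0 0 0 0 0 0 0 0 0) =
  quasi 1 6 0 8 0 48 0 42 0 10 0 0 0 0 0 0 0 0 0 0.
Proof. by quasi_ring. Qed.

Lemma delta_Y1d :
  delta (quasi 1 6 0 8 0 48 0 42 0 10 0 0 0 0 0 0 0 0 0 0) =
  quasi 1 8 0 16 0 288 0 812 0 644 0 174 0 10 0 0 0 0 0 0.
Proof. by quasi_ring. Qed.

Lemma delta_X1 :
  delta (quasi 1 6 0 2 0 32 0 38 0 0 0 0 0 0 0 0 0 0 0 0) =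
  quasi 1 8 0 4 0 152 0 588 0 476 0 76 0 0 0 0 0 0 0 0.
Proof. by quasi_ring. Qed.

Lemma delta_X :
  delta (quasi 1 6 0 4 0 58 0 58 0 0 0 0 0 0 0 0 0 0 0 0) =
  quasi 1 8 0 8 0 280 0 1002 0 754 0 116 0 0 0 0 0 0 0 0.
Proof. by quasi_ring. Qed.

Lemma delta_Xd :
  delta (quasi 1 8 0 8 0 280 0 1002 0 754 0 116 0 0 0 0 0 0 0 0) =
  quasi 1 10 0 16 0 1248 2 2260 5 1460 3 2970 0 3654 0 232 0 0 0 0.
Proof. by quasi_ring. Qed.

Lemma delta_X2 :
  delta (quasi 2 11 0 318 6 207 49 56 88 2255 34 3584 0 0 0 0 0 0 0 0) =
  quasi 2 13 0 1272 37 3920 513 3132 1859 1063 2306 3934 1036 203 139 2336 0 0 0 0.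
Proof. by quasi_ring. Qed.

Lemma delta_Y2 :
  delta (quasi 2 9 0 742 1 2735 2 3748 1 2251 0 984 0 0 0 0 0 0 0 0) =
  quasi 2 11 0 2968 13 1024 51 2196 68 405 36 2314 7 3545 0 1968 0 0 0 0.
Proof. by quasi_ring. Qed.

Lemma delta_Y2d :
  delta (quasi 2 11 0 2968 13 1024 51 2196 68 405 36 2314 7 3545 0 1968 0 0 0 0) =
  quasi 2 13 2 3872 95 472 683 1792 1753 942 1974 234 1072 2993 280 1464 31 155 0 3936.
Proof. by quasi_ring. Qed.

Variables s2 s4 : fps rat.
Hypothesis s2E : 2 * s2 = z * (2 + z) * (1 + 13 * z + 10 * z ^+ 2) * w ^+ 6.
Hypothesis s4E : 20 * s4 = z ^+ 2 * (2 + z) * (226 + (12 * 1000 + 689) * z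
  + (78 * 1000 + 552) * z ^+ 2 + (111 * 1000 + 905) * z ^+ 3
  + (34 * 1000 + 768) * z ^+ 4) * w ^+ 11.

(** With [z w = 2 s0], subtracting [delta (delta - 1) (2 s0)] cancels genus 0: the coefficient of
    [t ^ j] in [X] is [24 * 2 j (2 j - 1)] times that of genus 1. The operator [3 delta + 2] clears
    [3 j + 1], and [Y] is the series whose coefficients are the claimed convolution sums. *)
Lemma genus1_identity :
  let X := 6 * s2 - delta (delta (z * w) - z * w) in
  let Y := z ^+ 1 * (2 + z) ^+ 3 * w ^+ 4 in
  3 * delta X + 2 * X = 2 * delta (delta Y - Y).
Proof.
move=> X Y.
have -> : X = quasi 1 6 0 2 0 32 0 38 0 0 0 0 0 0 0 0 0 0 0 0.
  rewrite /X deltaD deltaN delta_zw delta_zw1.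
  rewrite (_ : 6 * s2 = 3 * (2 * s2)); last by ring.
  by rewrite s2E; quasi_ring.
have -> : Y = quasi 1 4 0 4 0 4 0 1 0 0 0 0 0 0 0 0 0 0 0 0 by rewrite /Y; quasi_ring.
rewrite deltaD deltaN delta_Y1 delta_Y1d delta_X1.
by quasi_ring.
Qed.

(** The constants of the theorem rescaled: by [lagrange_power], [z ^ a] brings a factor
    [2 ^ (a + 1)], so that [742 = 2 * 371], [11748 = 23496 / 2], [6251 = 25004 / 4] and
    [984 = 7872 / 8] all yield the common factor 16. *)
Definition genus2_rhs : fps rat :=
  742 * (z ^+ 2 * (2 + z) ^+ 1 * w ^+ 9) + (6 * 1000 + 735) * (z ^+ 3 * (2 + z) ^+ 1 * w ^+ 9)
  + (11 * 1000 + 748) * (z ^+ 4 * (2 + z) ^+ 1 * w ^+ 9)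
  + (6 * 1000 + 251) * (z ^+ 5 * (2 + z) ^+ 1 * w ^+ 9)
  + 984 * (z ^+ 6 * (2 + z) ^+ 1 * w ^+ 9).

(** The factor 10 in [X] leaves just what genera 0 and 1 contribute to [30 s4], up to
    [(delta - 2) (delta - 3)]. Thus [Z] isolates genus 2, with coefficients
    [480 (2 j - 2) (2 j - 3)] times those of [tau_poly]. *)
Lemma genus2_identity :
  let X := 10 * s2 - delta (delta (z * w) - z * w) in
  let Z := 30 * s4 - (delta (delta X) - 5 * delta X + 6 * X) in
  let Y := genus2_rhs in
  2 * (3 * delta Z + 2 * Z) = 3 * (delta (delta Y) - 5 * delta Y + 6 * Y).
Proof.
move=> X Z Y.
have XE : X = quasi 1 6 0 4 0 58 0 58 0 0 0 0 0 0 0 0 0 0 0 0.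
  rewrite /X deltaD deltaN delta_zw delta_zw1.
  rewrite (_ : 10 * s2 = 5 * (2 * s2)); last by ring.
  by rewrite s2E; quasi_ring.
have Z2 : 2 * Z = quasi 2 11 0 318 6 207 49 56 88 2255 34 3584 0 0 0 0 0 0 0 0.
  rewrite /Z XE delta_X delta_Xd.
  transitivity (3 * (20 * s4) - 2 * (quasi 1 10 0 16 0 1248 2 2260 5 1460 3 2970 0 3654 0 232 0 0 0 0
    - 5 * quasi 1 8 0 8 0 280 0 1002 0 754 0 116 0 0 0 0 0 0 0 0 + 6 * quasi 1 6 0 4 0 58 0 58 0 0 0 0 0 0 0 0 0 0 0 0)); first by ring.
  by rewrite s4E; quasi_ring.
have -> : Y = quasi 2 9 0 742 1 2735 2 3748 1 2251 0 984 0 0 0 0 0 0 0 0.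
  by rewrite /Y /genus2_rhs; quasi_ring.
rewrite delta_Y2 delta_Y2d.
have -> : 2 * (3 * delta Z + 2 * Z) = 3 * delta (2 * Z) + 2 * (2 * Z).
  by rewrite deltaM (delta_nat 2); ring.
by rewrite Z2 delta_X2; quasi_ring.
Qed.

End RationalIdentities.

(** * The numbers of connected graphs of genus 0, 1 and 2 *)

Lemma genus_expansion : exists z w : fps rat,
  [/\ z = 15 * (fpsX rat * (2 + z) ^+ 3), z * w = w - 1, 2 * sord 0 = z * w,
      2 * sord 2 = z * (2 + z) * (1 + 13 * z + 10 * z ^+ 2) * w ^+ 6 &
      20 * sord 4 = z ^+ 2 * (2 + z) * (226 + (12 * 1000 + 689) * z
        + (78 * 1000 + 552) * z ^+ 2 + (111 * 1000 + 905) * z ^+ 3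
        + (34 * 1000 + 768) * z ^+ 4) * w ^+ 11].
Proof.
have [rho [rho_deg Hr]] := rho_exists.
have rhoE := freud_polynomial Hr; have todaE := toda_polynomial Hr.
have [z ord0E] : exists z : fps rat, ord rho 0 = 2 + z by exists (ord rho 0 - 2); ring.
have zE := order0 rho_deg rhoE ord0E.
have [w wE] : exists w : fps rat, (1 - z) * w = 1.
  by apply: fps_inv_exists; rewrite (fcoefB 1 z) (z0 zE) fcoef1.
exists z, w; split.
- exact: zE.
- exact: zw wE.
- by have := sord0 rho_deg rhoE todaE ord0E wE.
- by have := sord2 rho_deg rhoE todaE ord0E wE.
- by have := sord4 rho_deg rhoE todaE ord0E wE.
Qed.

Lemma tau_poly_size j : (size (fcoef tau_poly j) <= 2 * j + 3)%N.
Proof.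
have [rho [rho_deg Hr]] := rho_exists.
exact: tau_poly_deg rho_deg (freud_polynomial Hr) (toda_polynomial Hr) j.
Qed.

Definition genus_coef (g j : nat) : rat := (fcoef tau_poly j)`_(2 * j + 2 - 2 * g).

Lemma num_graphs_coef g j : (0 < j)%N -> (2 * g <= 2 * j + 2)%N ->
  (num_graphs g 6 j)%:R = (j.-1)`!%:R * genus_coef g j.
Proof.
case: j => // j _ gj; rewrite num_graphs_face_poly // /genus_coef /tau_poly /fcoef coefZ mulrA.
by rewrite mulfV ?mul1r // pnatr_eq0 -lt0n fact_gt0.
Qed.

Lemma sord_coef n j : (n <= 2 * j)%N ->
  fcoef (sord n) j = (second_diff (fcoef tau_poly j))`_(2 * j - n) * 2 ^+ n.
Proof. by move=> nj; rewrite /sord V_coef addn0 coef_revp nj sigma_coef. Qed.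

Lemma sord0_coef j :
  fcoef (sord 0) j = (2 * j%:R + 2) * (2 * j%:R + 1) * genus_coef 0 j.
Proof.
rewrite sord_coef // subn0 expr0 mulr1 second_diff_lead; last first.
  by apply: leq_trans (tau_poly_size j) _; rewrite addn3.
rewrite /genus_coef (_ : (2 * j + 2 - 2 * 0 = (2 * j).+2)%N); last by lia.
by rewrite -[(2 * j).+2]addn2 -[(2 * j).+1]addn1 !(natrD _ (2 * j)) natrM; ring.
Qed.

Lemma sord2_coef j : (0 < j)%N ->
  fcoef (sord 2) j = 4 * (2 * j%:R * (2 * j%:R - 1) * genus_coef 1 j
    + (2 * j%:R + 2) * (2 * j%:R + 1) * (2 * j%:R) * (2 * j%:R - 1) / 12 * genus_coef 0 j).
Proof.
case: j => // i _; rewrite sord_coef; last by lia.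
have -> : (2 * i.+1 - 2 = 2 * i)%N by lia.
rewrite second_diff_sub; last by apply: leq_trans (tau_poly_size _) _; lia.
rewrite /genus_coef.
have -> : (2 * i.+1 + 2 - 2 * 1 = (2 * i).+2)%N by lia.
have -> : (2 * i.+1 + 2 - 2 * 0 = (2 * i).+4)%N by lia.
rewrite -[(2 * i).+4]addn4 -[(2 * i).+3]addn3 -[(2 * i).+2]addn2 -[(2 * i).+1]addn1.
by rewrite !(natrD _ (2 * i)) natrM -(natr1 i); field.
Qed.

Lemma sord4_coef j : (1 < j)%N ->
  fcoef (sord 4) j = 16 * ((2 * j%:R - 2) * (2 * j%:R - 3) * genus_coef 2 j
    + (2 * j%:R) * (2 * j%:R - 1) * (2 * j%:R - 2) * (2 * j%:R - 3) / 12 * genus_coef 1 j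
    + (2 * j%:R + 2) * (2 * j%:R + 1) * (2 * j%:R) * (2 * j%:R - 1)
        * (2 * j%:R - 2) * (2 * j%:R - 3) / 360 * genus_coef 0 j).
Proof.
case: j => [//|[//|i]] _; rewrite sord_coef; last by lia.
have -> : (2 * i.+2 - 4 = 2 * i)%N by lia.
rewrite second_diff_subsub; last by apply: leq_trans (tau_poly_size _) _; lia.
rewrite /genus_coef.
have -> : (2 * i.+2 + 2 - 2 * 2 = (2 * i).+2)%N by lia.
have -> : (2 * i.+2 + 2 - 2 * 1 = (2 * i).+4)%N by lia.
have -> : (2 * i.+2 + 2 - 2 * 0 = (2 * i).+4.+2)%N by lia.
have -> : (2 * i).+4.+2 = (2 * i + 6)%N by lia.
have -> : (2 * i).+4.+1 = (2 * i + 5)%N by lia.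
rewrite -[(2 * i).+4]addn4 -[(2 * i).+3]addn3 -[(2 * i).+2]addn2 -[(2 * i).+1]addn1.
by rewrite -[i.+2]addn2 !(natrD _ (2 * i)) (natrD _ i) natrM; field.
Qed.

Lemma fcoef_delta f j : fcoef (delta f) j = 2 * j%:R * fcoef f j.
Proof. by rewrite /delta fcoef_natM theta_coef mulrA. Qed.

(** The coefficient of [z w] is a binomial [C(3 j - 1, j - 1)]; the second difference adds the
    factors [(2 j + 2) (2 j + 1)] that complete [(2 j + 2)!]. *)
Lemma num_graphs0 j : (0 < j)%N ->
  (num_graphs 0 6 j * (2 * j + 2)`! = 60 ^ j * (3 * j - 1)`!)%N.
Proof.
move=> j0; have [z [w [zE z_w s0 _ _]]] := genus_expansion.
have := congr1 (fun f => fcoef f j) s0; rewrite fcoef_natM sord0_coef.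
have := lagrange_neg zE z_w 1 j0; rewrite expr1 => ->; rewrite /binB j0.
set B := 'C(_, _); move=> H; apply/eqP; rewrite -(eqr_nat rat); apply/eqP.
rewrite !natrM natrX num_graphs_coef // addn2 !factS !natrM -![_.+1%:R]natr1 natrM.
have BF : ((3 * j - 1)`! = B * ((j - 1)`! * (2 * j)`!))%N.
  have -> : (2 * j = (3 * j).-1 - (j - 1))%N by lia.
  by rewrite bin_fact subn1 //; lia.
rewrite BF !natrM -subn1; apply: (@mulfI _ 2) => //.
transitivity ((j - 1)`!%:R * (2 * j)`!%:R *
  (2 * ((2 * j%:R + 2) * (2 * j%:R + 1) * genus_coef 0 j))); first by ring.
by rewrite H; ring.
Qed.

Lemma genus1_solve (x p S A B : rat) : 1 <= x ->
  3 * (2 * x * (6 * (4 * (2 * x * (2 * x - 1) * B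
      + (2 * x + 2) * (2 * x + 1) * (2 * x) * (2 * x - 1) / 12 * A))
    - 2 * x * (2 * x * (2 * ((2 * x + 2) * (2 * x + 1) * A))
      - 2 * ((2 * x + 2) * (2 * x + 1) * A))))
  + 2 * (6 * (4 * (2 * x * (2 * x - 1) * B
      + (2 * x + 2) * (2 * x + 1) * (2 * x) * (2 * x - 1) / 12 * A))
    - 2 * x * (2 * x * (2 * ((2 * x + 2) * (2 * x + 1) * A))
      - 2 * ((2 * x + 2) * (2 * x + 1) * A))) =
  2 * (2 * x * (2 * x * (16 * (60 * p) * S) - 16 * (60 * p) * S)) ->
  (3 * x + 1) * B = 40 * p * S.
Proof.
move=> x1 H; have nz : 48 * (2 * x * (2 * x - 1)) != 0 :> rat.
  by rewrite !mulf_neq0 //; lra.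
apply: (mulfI nz); apply/eqP; rewrite -subr_eq0; apply/eqP.
by move/eqP: H; rewrite -subr_eq0 => /eqP <-; field.
Qed.

Lemma num_graphs1 j : (0 < j)%N ->
  ((3 * j + 1) * num_graphs 1 6 j
   = 40 * (j - 1)`! * 60 ^ (j - 1) * conv_sum (2 + 3 * j) (j - 1) 3 )%N.
Proof.
move=> j0; have [z [w [zE z_w s0 s2 s4]]] := genus_expansion.
have := congr1 (fun f => fcoef f j) (genus1_identity zE z_w s2).
rewrite -s0 !(fcoef_delta, fcoefD, fcoefN, fcoef_natM).
rewrite (@lagrange_power z w zE z_w 1 2 3 j j0) sord0_coef sord2_coef //.
have -> : (3 * j + 2 = 2 + 3 * j)%N by lia.
set S := conv_sum _ _ _; set B := genus_coef 1 j; set A := genus_coef 0 j => H.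
apply/eqP; rewrite -(eqr_nat rat); apply/eqP.
rewrite !natrM natrX natrD num_graphs_coef //; last by lia.
rewrite -/B natrM -[j.-1]subn1.
have E : 60 ^+ j = 60 * 60 ^+ (j - 1) :> rat by rewrite -exprS subn1 prednK.
rewrite E (_ : 2 ^+ (1 + 2).+1 = 16 :> rat) // in H.
rewrite mulrCA (@genus1_solve j%:R (60 ^+ (j - 1)) S%:R A B) //; last by rewrite ler1n.
by ring.
Qed.

(** The factor [(2 x - 2) (2 x - 3)] common to both sides is cancelled; it is nonzero from [x = 2]
    on. *)
Lemma genus2_solve (x A B C s0 s2 s4 X Z Y : rat) : 2 <= x ->
  s0 = (2 * x + 2) * (2 * x + 1) * A ->
  s2 = 4 * (2 * x * (2 * x - 1) * B
    + (2 * x + 2) * (2 * x + 1) * (2 * x) * (2 * x - 1) / 12 * A) ->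
  s4 = 16 * ((2 * x - 2) * (2 * x - 3) * C
    + (2 * x) * (2 * x - 1) * (2 * x - 2) * (2 * x - 3) / 12 * B
    + (2 * x + 2) * (2 * x + 1) * (2 * x) * (2 * x - 1)
        * (2 * x - 2) * (2 * x - 3) / 360 * A) ->
  X = 10 * s2 - 2 * x * (2 * x * (2 * s0) - 2 * s0) ->
  Z = 30 * s4 - (2 * x * (2 * x * X) - 5 * (2 * x * X) + 6 * X) ->
  2 * (3 * (2 * x * Z) + 2 * Z) = 3 * (2 * x * (2 * x * Y) - 5 * (2 * x * Y) + 6 * Y) ->
  (3 * x + 1) * (640 * C) = Y.
Proof.
move=> x2 s0E s2E s4E XE ZE H.
have nz : 3 * ((2 * x - 2) * (2 * x - 3)) != 0 :> rat.
  by rewrite !mulf_neq0 //; lra.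
apply: (mulfI nz); apply/eqP; rewrite -subr_eq0; apply/eqP.
move/eqP: H; rewrite -subr_eq0 => /eqP <-; rewrite ZE XE s4E s2E s0E.
by field.
Qed.

(** The guards drop the terms with [j < a], where truncated subtraction would leave
    [conv_sum _ 0 8 = 1]. One formula then covers all [j] from 2 on, including the small values. *)
Definition genus2_sum (j : nat) : nat :=
  (371 * (if 2 <= j then conv_sum (3 * j) (j - 2) 8 else 0)
   + (6 * 1000 + 735) * (if 3 <= j then conv_sum (3 * j) (j - 3) 8 else 0)
   + (23 * 1000 + 496) * (if 4 <= j then conv_sum (3 * j) (j - 4) 8 else 0)
   + (25 * 1000 + 4) * (if 5 <= j then conv_sum (3 * j) (j - 5) 8 else 0)
   + (7 * 1000 + 872) * (if 6 <= j then conv_sum (3 * j) (j - 6) 8 else 0))%N.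

Lemma genus2_rhs_coef z w j : z = 15 * (fpsX rat * (2 + z) ^+ 3) -> z * w = w - 1 ->
  fcoef (genus2_rhs z w) j = 16 * 60 ^+ j * (genus2_sum j)%:R.
Proof.
move=> zE z_w; pose c a := if (a <= j)%N then conv_sum (3 * j) (j - a) 8 else 0%N.
have F a : fcoef (z ^+ a * (2 + z) ^+ 1 * w ^+ 9) j = 2 ^+ a.+1 * 60 ^+ j * (c a)%:R.
  rewrite /c; case: leqP => aj; last by rewrite lagrange_zero ?mulr0.
  by rewrite (@lagrange_power z w zE z_w a 0 8 j aj) !addn0.
have K (a b : nat) (f : fps rat) : fcoef ((a%:R * 1000 + b%:R) * f) j = (a%:R * 1000 + b%:R) * fcoef f j.
  by rewrite mulrDl -mulrA fcoefD !fcoef_natM; ring.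
have E (a b n : nat) : ((a * 1000 + b) * n)%:R = (a%:R * 1000 + b%:R) * n%:R :> rat.
  by rewrite natrM natrD natrM.
rewrite /genus2_rhs 4!fcoefD (fcoef_natM 742) F (K 6 735)%N F (K 11 748)%N F (K 6 251)%N F (fcoef_natM 984) F.
rewrite /genus2_sum -!/(c _).
move: (c 2%N) (c 3%N) (c 4%N) (c 5%N) (c 6%N) => c2 c3 c4 c5 c6.
rewrite 4!natrD (E 6%N) (E 23%N) (E 25%N) (E 7%N) natrM.
move: (60 ^+ j) c2%:R c3%:R c4%:R c5%:R c6%:R => p d2 d3 d4 d5 d6.
by rewrite !exprS expr0; ring.
Qed.

Lemma num_graphs2 j : (1 < j)%N ->
  (2 * (3 * j + 1) * num_graphs 2 6 j
   = 3 * (j - 1)`! * 60 ^ (j - 1) * genus2_sum j)%N.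
Proof.
move=> j1; have j0 : (0 < j)%N by apply: ltnW.
have [z [w [zE z_w s0 s2 s4]]] := genus_expansion.
have := genus2_identity zE z_w s2 s4; have := genus2_rhs_coef j zE z_w.
move: (genus2_rhs z w) => Y YE /(congr1 (fun f => fcoef f j)).
rewrite -s0 !(fcoef_delta, fcoefD, fcoefN, fcoef_natM) => H.
have x2 : 2 <= j%:R :> rat by rewrite ler_nat.
have := genus2_solve x2 (sord0_coef j) (sord2_coef j0) (sord4_coef j1) erefl erefl H.
rewrite YE => {}H.
apply/eqP; rewrite -(eqr_nat rat); apply/eqP.
rewrite !natrM natrX natrD natrM num_graphs_coef //; last by lia.
have E : 60 ^+ j = 60 * 60 ^+ (j - 1) :> rat by rewrite -exprS subn1 prednK.
rewrite E in H; rewrite -subn1; move: H.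
move: (genus_coef 2 j) (60 ^+ (j - 1)) (genus2_sum j)%:R ((j - 1)`!)%:R (j%:R) => C p S f x H.
have nz : 4 * 80 != 0 :> rat by rewrite mulf_neq0.
apply: (mulfI nz).
transitivity (f * ((3 * x + 1) * (640 * C))); first by ring.
by rewrite H; ring.
Qed.

From mathcomp Require Import reals topology normedtype sequences.
Import numFieldNormedType.Exports.

(** * Terminating hypergeometric series *)

Section Hypergeometric.
Variable R : realType.
Implicit Types (a c : R).

Lemma pochhammerS a k : pochhammer a k.+1 = pochhammer a k * (a + k%:R).
Proof. by rewrite /pochhammer big_nat_recr. Qed.

Lemma pochhammer0 a : pochhammer a 0 = 1.
Proof. by rewrite /pochhammer big_nil. Qed.

Lemma pochhammer_bin m k : pochhammer (m.+1%:R : R) k = ('C(k + m, k))%:R * (k`!)%:R.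
Proof.
elim: k => [|k IH]; first by rewrite pochhammer0 bin0 fact0 mulr1.
rewrite pochhammerS IH factS -natrD -!natrM; congr (_%:R).
have := mul_bin_diag (k + m).+1 k; rewrite /= !addSn => E.
rewrite mulnA [('C(_, k.+1) * _)%N]mulnC -E [(m + k)%N]addnC mulnAC.
by congr (_ * _)%N; rewrite mulnC.
Qed.

Lemma pochhammer_neg n k : (n < k)%N -> pochhammer (- n%:R : R) k = 0.
Proof.
move=> nk; rewrite /pochhammer big_mkord (bigD1 (Ordinal nk)) //=.
by rewrite addNr mul0r.
Qed.

Lemma pochhammer_gt0 a k : 0 < a -> 0 < pochhammer a k.
Proof.
move=> a0; elim: k => [|k IH]; first by rewrite pochhammer0.
by rewrite pochhammerS mulr_gt0 // ltr_wpDr.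
Qed.

Lemma bin_pochhammer N n k : (n <= N)%N -> (k <= n)%N ->
  ('C(N, n))%:R * pochhammer (- n%:R) k * (-1) ^+ k =
  ('C(N, n - k))%:R * pochhammer ((N - n)%:R + 1) k :> R.
Proof.
move=> nN; elim: k => [|k IH] kn; first by rewrite !pochhammer0 expr0 !mulr1 subn0.
rewrite !pochhammerS exprS.
transitivity ((('C(N, n))%:R * pochhammer (- n%:R) k * (-1) ^+ k) * (n%:R - k%:R) : R); first by ring.
rewrite IH; last exact: ltnW.
have E : ('C(N, n - k))%:R * (n%:R - k%:R) = ('C(N, n - k.+1))%:R * ((N - n)%:R + 1 + k%:R) :> R.
  rewrite -natrB; last exact: ltnW.
  rewrite natr1 -natrD -!natrM; congr (_%:R).
  have -> : (n - k = (n - k.+1).+1)%N by lia.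
  rewrite mulnC mul_bin_left mulnC; congr (_ * _)%N; lia.
by rewrite mulrAC E; ring.
Qed.

Lemma limn_series_finite (f : nat -> R) n : (forall k, (n < k)%N -> f k = 0) ->
  limn (series f) = \sum_(k < n.+1) f k.
Proof.
move=> f0; apply: cvg_lim => //; apply: cvg_near_cst; exists n.+1 => // m /= nm.
rewrite /series /= (big_cat_nat _ (n := n.+1)) //= big_mkord big_nat_cond.
by rewrite [X in _ + X]big1 ?addr0 // => k /andP[/andP[nk _] _]; apply: f0.
Qed.

(** The upper parameter [- n] stops the series at [k = n]. By [bin_pochhammer] its rising factorial
    absorbs the sign of [(-2) ^ k] and cancels that of [c], leaving the terms of [conv_sum]. *)
Lemma bin_hyp2F1 N n m c : (n <= N)%N -> c = (N - n)%:R + 1 ->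
  ('C(N, n))%:R * hyp2F1 m.+1%:R (- n%:R) c (-2) = (conv_sum N n m.+1)%:R :> R.
Proof.
move=> nN cE; rewrite /hyp2F1 (@limn_series_finite _ n) => [|k nk]; last first.
  by rewrite (pochhammer_neg nk) mulr0 !mul0r.
rewrite mulr_sumr natr_sum; apply: eq_bigr => k _.
have kn : (k <= n)%N by rewrite -ltnS.
have c0 : 0 < c by rewrite cE ltr_wpDl.
have := bin_pochhammer nN kn; rewrite -cE.
rewrite pochhammer_bin addnS /= !natrM natrX.
have pn0 : pochhammer c k != 0 by rewrite gt_eqF // pochhammer_gt0.
have fn0 : k`!%:R != 0 :> R by rewrite pnatr_eq0 -lt0n fact_gt0.
have -> : (-2 : R) ^+ k = (-1) ^+ k * 2 ^+ k by rewrite -exprMn mulN1r.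
move: (pochhammer c k) (pochhammer (- n%:R) k) (k`!%:R) pn0 fn0 => p q f p0 f0 E.
rewrite [_ * ('C(N, n - k))%:R]mulrC.
transitivity (2 ^+ k * ('C(k + m, k))%:R * (('C(N, n))%:R * q * (-1) ^+ k) / p).
  by field; rewrite p0 f0.
by rewrite E; field; rewrite p0.
Qed.

End Hypergeometric.

Section Literals.

(* Number literals above 5000 are opaque to [lia] and [ring]; these equations unfold them
   digit by digit. *)
Ltac literal :=
  rewrite /Nat.of_num_uint /Nat.of_uint; cbn [Nat.of_uint_acc];
  rewrite !PeanoNat.Nat.tail_mul_spec; lia.

Lemma genus2_literals :
  [/\ 6735 = 6 * 1000 + 735, 23496 = 23 * 1000 + 496,
      25004 = 25 * 1000 + 4 & 7872 = 7 * 1000 + 872]%N.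
Proof. by split; literal. Qed.

Lemma small_count_literals :
  [/\ 17290800 = (17 * 1000 + 290) * 1000 + 800,
      54015984 = (54 * 1000 + 15) * 1000 + 984
    & 174855024 = (174 * 1000 + 855) * 1000 + 24]%N.
Proof. by split; literal. Qed.

End Literals.

Lemma conv_sumE N m c :
  conv_sum N m c = sumn [seq (2 ^ k * 'C((k + c).-1, k) * 'C(N, m - k))%N | k <- iota 0 m.+1].
Proof.
rewrite /conv_sum sumnE big_map.
by rewrite -(big_mkord xpredT (fun k => 2 ^ k * 'C((k + c).-1, k) * 'C(N, m - k))%N) /index_iota subn0.
Qed.

Lemma num_graphs_2_small :
  [/\ num_graphs 2 6 2 = 4770, num_graphs 2 6 3 = 17290800,
      num_graphs 2 6 4 = 54015984 * 10 ^ 3 & num_graphs 2 6 5 = 174855024 * 10 ^ 6]%N.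
Proof.
have [-> -> ->] := small_count_literals.
have S2 : genus2_sum 2 = (371 * 1 + (6 * 1000 + 735) * 0 + (23 * 1000 + 496) * 0
    + (25 * 1000 + 4) * 0 + (7 * 1000 + 872) * 0)%N.
  by rewrite /genus2_sum [conv_sum _ (2 - 2) _]conv_sumE.
have S3 : genus2_sum 3 = (371 * 25 + (6 * 1000 + 735) * 1 + (23 * 1000 + 496) * 0
    + (25 * 1000 + 4) * 0 + (7 * 1000 + 872) * 0)%N.
  by rewrite /genus2_sum [conv_sum _ (3 - 2) _]conv_sumE [conv_sum _ (3 - 3) _]conv_sumE.
have S4 : genus2_sum 4 = (371 * 402 + (6 * 1000 + 735) * 28 + (23 * 1000 + 496) * 1
    + (25 * 1000 + 4) * 0 + (7 * 1000 + 872) * 0)%N.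
  by rewrite /genus2_sum [conv_sum _ (4 - 2) _]conv_sumE [conv_sum _ (4 - 3) _]conv_sumE
    [conv_sum _ (4 - 4) _]conv_sumE.
have S5 : genus2_sum 5 = (371 * conv_sum (3 * 5) (5 - 2) 8
    + (6 * 1000 + 735) * conv_sum (3 * 5) (5 - 3) 8
    + (23 * 1000 + 496) * conv_sum (3 * 5) (5 - 4) 8
    + (25 * 1000 + 4) * conv_sum (3 * 5) (5 - 5) 8 + (7 * 1000 + 872) * 0)%N by [].
have c2 : conv_sum (3 * 5) (5 - 2) 8 = (5 * 1000 + 255)%N by rewrite conv_sumE; vm_compute.
have c3 : conv_sum (3 * 5) (5 - 3) 8 = 489 by rewrite conv_sumE; vm_compute.
have c4 : conv_sum (3 * 5) (5 - 4) 8 = 31 by rewrite conv_sumE; vm_compute.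
have c5 : conv_sum (3 * 5) (5 - 5) 8 = 1%N by rewrite conv_sumE; vm_compute.
have f1 : 1`! = 1%N by [].
have f2 : 2`! = 2%N by [].
have f3 : 3`! = 6%N by [].
have f4 : 4`! = 24%N by [].
split.
- by have := @num_graphs2 2 isT; rewrite S2 -[(2 - 1)%N]/1%N f1; lia.
- by have := @num_graphs2 3 isT; rewrite S3 -[(3 - 1)%N]/2%N f2; lia.
- by have := @num_graphs2 4 isT; rewrite S4 -[(4 - 1)%N]/3%N f3; lia.
by have := @num_graphs2 5 isT; rewrite S5 -[(5 - 1)%N]/4%N f4 c2 c3 c4 c5; lia.
Qed.

Theorem theoremA5 (R : realType) :
  (forall j : nat, (1 <= j)%N ->
     (num_graphs 0 6 j)%:R
       = 60 ^+ j * ((3 * j - 1)`!)%:R / ((2 * j + 2)`!)%:R :> R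
  /\ (num_graphs 1 6 j)%:R
       = 40 / (3 * j%:R + 1) * ((j - 1)`!)%:R * 60 ^+ (j - 1)
         * ('C(2 + 3 * j, j - 1))%:R
         * hyp2F1 3 (1 - j%:R) (4 + 2 * j%:R) (- 2) :> R)
  /\
  (forall j : nat, (6 <= j)%N ->
     (num_graphs 2 6 j)%:R
       = 3 / (2 * (3 * j%:R + 1)) * ((j - 1)`!)%:R * 60 ^+ (j - 1)
         * (  371%:R * ('C(3 * j, j - 2))%:R
                * hyp2F1 8 (2 - j%:R) (3 + 2 * j%:R) (- 2)
            + 6735%:R * ('C(3 * j, j - 3))%:R
                * hyp2F1 8 (3 - j%:R) (4 + 2 * j%:R) (- 2)
            + 23496%:R * ('C(3 * j, j - 4))%:R
                * hyp2F1 8 (4 - j%:R) (5 + 2 * j%:R) (- 2)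
            + 25004%:R * ('C(3 * j, j - 5))%:R
                * hyp2F1 8 (5 - j%:R) (6 + 2 * j%:R) (- 2)
            + 7872%:R * ('C(3 * j, j - 6))%:R
                * hyp2F1 8 (6 - j%:R) (7 + 2 * j%:R) (- 2)) :> R)
  /\ num_graphs 2 6 1 = 0%N
  /\ num_graphs 2 6 2 = 4770%N
  /\ num_graphs 2 6 3 = 17290800%N
  /\ num_graphs 2 6 4 = (54015984 * 10 ^ 3)%N
  /\ num_graphs 2 6 5 = (174855024 * 10 ^ 6)%N.
Proof.
split; [|split].
- move=> j j0; have jB : 1 - j%:R = - (j - 1)%:R :> R.
    by rewrite (natrB _ j0) opprB.
  have x0 : 3 * j%:R + 1 != 0 :> R by rewrite gt_eqF // ltr_wpDl // mulr_ge0.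
  split.
    have f0 : ((2 * j + 2)`!)%:R != 0 :> R by rewrite pnatr_eq0 -lt0n fact_gt0.
    apply: (mulIf f0); rewrite divfK //.
    by rewrite -natrM num_graphs0 // natrM natrX.
  have := congr1 (fun n : nat => n%:R : R) (num_graphs1 j0).
  rewrite !natrM natrX natrD natrM -(@bin_hyp2F1 R (2 + 3 * j) (j - 1) 2 (4 + 2 * j%:R)); last 2 first.
  - by lia.
  - rewrite (_ : 2 + 3 * j - (j - 1) = 2 * j + 3)%N; last by lia.
    by rewrite natrD natrM; ring.
  rewrite -jB => H; apply: (mulfI x0); rewrite H.
  by field.
- move=> j j6; have x0 : 3 * j%:R + 1 != 0 :> R by rewrite gt_eqF // ltr_wpDl // mulr_ge0.
  have B a : (a <= j)%N -> a%:R - j%:R = - (j - a)%:R :> R.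
    by move=> aj; rewrite (natrB _ aj) opprB.
  have E a (c : R) : (a <= j)%N -> c = (2 * j + a + 1)%:R ->
      (conv_sum (3 * j) (j - a) 8)%:R = ('C(3 * j, j - a))%:R * hyp2F1 8 (a%:R - j%:R) c (- 2) :> R.
    move=> aj cE; rewrite B // (@bin_hyp2F1 R _ _ 7) //; first by lia.
    by rewrite cE natr1; congr (_%:R); lia.
  have F : (2 * (3 * j%:R + 1)) * (num_graphs 2 6 j)%:R
      = 3 * ((j - 1)`!)%:R * 60 ^+ (j - 1) * (genus2_sum j)%:R :> R.
    have j1 : (1 < j)%N by lia.
    have := congr1 (fun n : nat => n%:R : R) (num_graphs2 j1).
    by rewrite !natrM natrX natrD natrM.
  have D (a b c d e x y z u v : nat) : (a * x + b * y + c * z + d * u + e * v)%:R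
      = a%:R * x%:R + b%:R * y%:R + c%:R * z%:R + d%:R * u%:R + e%:R * v%:R :> R.
    by rewrite !natrD !natrM.
  have S : (genus2_sum j)%:R = 371%:R * (conv_sum (3 * j) (j - 2) 8)%:R
      + 6735%:R * (conv_sum (3 * j) (j - 3) 8)%:R
      + 23496%:R * (conv_sum (3 * j) (j - 4) 8)%:R
      + 25004%:R * (conv_sum (3 * j) (j - 5) 8)%:R
      + 7872%:R * (conv_sum (3 * j) (j - 6) 8)%:R :> R.
    have [-> -> -> ->] := genus2_literals.
    rewrite /genus2_sum !ifT; [|lia..].
    exact: D.
  have n0 : 2 * (3 * j%:R + 1) != 0 :> R by rewrite mulf_neq0 ?pnatr_eq0.
  apply: (mulfI n0); rewrite F S.
  rewrite (@E 2 (3 + 2 * j%:R)) 1?(@E 3 (4 + 2 * j%:R)) 1?(@E 4 (5 + 2 * j%:R))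
    1?(@E 5 (6 + 2 * j%:R)) 1?(@E 6 (7 + 2 * j%:R)); try lia;
    try by rewrite 2!natrD natrM; ring.
  rewrite -!mulrA.
  (* The remaining identity holds for arbitrary coefficients, so the numerals are hidden from
     [field]. *)
  set c2 := 371%:R; set c3 := 6735%:R; set c4 := 23496%:R; set c5 := 25004%:R; set c6 := 7872%:R.
  clearbody c2 c3 c4 c5 c6.
  by field.
have [n2 n3 n4 n5] := num_graphs_2_small.
exact (conj num_graphs_1_2 (conj n2 (conj n3 (conj n4 n5)))).
Qed.
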